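(* Let $N\geq 2$ and $k\geq 1$ be integers. The compact quantum group $\mathbb{G}_N(W^{(\circ,k)})$ is (isomorphic to) the quantum automorphism group of the rooted tracial $M_N(\mathbb{C})$-regular quantum tree $\mathcal{G}_k=(B_k,\psi_k,\mathcal{A}_k)$ of depth $k$.
   Context: A compact quantum group $\mathbb{G}$ is given by a CQG-algebra $\mathcal{O}(\mathbb{G})$ (a Hopf $*$-algebra spanned by coefficients of finite-dimensional unitary corepresentations, called representations of $\mathbb{G}$); isomorphism means isomorphism of Hopf $*$-algebras. $U_N^+$: $\mathcal{O}(U_N^+)$ is the universal $*$-algebra generated by $u_{ij}$, $1\leq i,j\leq N$, such that $u=(u_{ij})$ and $\overline{u}=(u_{ij}^* )$ are unitary, with $\Delta(u_{ij})=\sum_k u_{ik}\otimes u_{kj}$. Its irreducible representations are indexed by words $w$ on $\{\circ,\bullet\}$, with $u^\circ=u$, $\overline{u^w}=u^{\overline{w}}$ and $u^w\otimes u^{w'}=\bigoplus_{w=az,\,w'=\overline{z}b}u^{ab}$; here $\overline{\circ}=\bullet$, $\overline{\bullet}=\circ$, $\overline{w_1\cdots w_n}=\overline{w}_n\cdots\overline{w}_1$. The color balance $c(w)$ is the number of $\circ$'s minus the number of $\bullet$'s in $w$, and $W^{(\circ,k)}=\{w=w_1\cdots w_n\mid c(w)=0,\ 0\leq c(w_1\cdots w_l)\leq k\ \forall\, 1\leq l\leq n\}$. $\mathcal{O}(\mathbb{G}_N(W^{(\circ,k)}))\subset\mathcal{O}(U_N^+)$ is the Hopf $*$-subalgebra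 spanned by the coefficients of the $u^w$ with $w\in W^{(\circ,k)}$. The quantum tree. Let $B=M_N(\mathbb{C})$ with its normalized trace $\psi=\mathrm{tr}$, which is a $\delta$-form with $\delta=N$ (i.e. $mm^*=\delta^2\,\mathrm{id}$, where $m$ is the multiplication and $m^*$ its adjoint for the inner products defined by $\psi$). Put $B^{\otimes 0}=\mathbb{C}$, $\psi^{\otimes 0}=\mathrm{id}_{\mathbb{C}}$ and $$B_k=\bigoplus_{i=0}^kB^{\otimes i},\qquad \delta_k=\sum_{i=0}^k\delta^i,\qquad \psi_k=\frac{1}{\delta_k}\sum_{i=0}^k\delta^i\psi^{\otimes i}.$$ For $0\leq i\leq k-1$ let $A_i:B^{\otimes i}\to B^{\otimes(i+1)}$, $A_i(x)=x\otimes 1$, and let $\mathcal{A}_k=\mathrm{Id}+\sum_{i=0}^{k-1}A_i:B_k\to B_k$. The rooted tracial $M_N(\mathbb{C})$-regular quantum tree of depth $k$ is $\mathcal{G}_k=(B_k,\psi_k,\mathcal{A}_k)$. The quantum automorphism group $\mathrm{Aut}^+(\mathcal{G}_k)$ is the universal compact quantum group $\mathbb{G}$ with an action (unital $*$-homomorphism which is a coaction) $\alpha:B_k\to\mathcal{O}(\mathbb{G})\otimes B_k$ which preserves $\psi_k$, i.e. $(\mathrm{id}\otimes\psi_k)\alpha(x)=\psi_k(x)1$, and commutes with the adjacency matrix, i.e. $(\mathrm{id}\otimes\mathcal{A}_k)\circ\alpha=\alpha\circ\mathcal{A}_k$. *)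

(* Defs.v *)
From HB Require Import structures.
From mathcomp Require Import all_boot all_order all_algebra.
From mathcomp Require Import generic_quotient.
From mathcomp Require Import mxtens.
From mathcomp Require Import boolp classical_sets.

Set Implicit Arguments.
Unset Strict Implicit.
Unset Printing Implicit Defensive.

Import GRing.Theory Num.Theory.
Local Open Scope ring_scope.
Local Open Scope quotient_scope.

Section TensorProduct.
Variables (C : numClosedFieldType) (A B : lmodType C).

Definition bilinear_map (V : lmodType C) (f : A -> B -> V) : Prop :=
  (forall b, linear (fun a => f a b)) /\ (forall a, linear (f a)).

(* The list [:: (a1, b1); ...; (an, bn)] stands for the formal sum
   a1 (x) b1 + ... + an (x) bn; scalars are absorbed by the first factor. Two
   formal sums are the same tensor when no bilinear map separates them. *)
Definition tens_eqv : rel (seq (A * B)) := fun s t =>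
  `[< forall (V : lmodType C) (f : A -> B -> V), bilinear_map f ->
      \sum_(p <- s) f p.1 p.2 = \sum_(p <- t) f p.1 p.2 >].

Fact tens_eqv_refl : reflexive tens_eqv.
Proof. by move=> s; apply/asboolP. Qed.

Fact tens_eqv_sym : symmetric tens_eqv.
Proof.
by move=> s t; apply/asboolP/asboolP => h V f bf; rewrite (h V f bf).
Qed.

Fact tens_eqv_trans : transitive tens_eqv.
Proof.
move=> t s r /asboolP h1 /asboolP h2; apply/asboolP => V f bf.
by rewrite (h1 V f bf) (h2 V f bf).
Qed.

Canonical tens_equiv := EquivRel tens_eqv tens_eqv_refl tens_eqv_sym tens_eqv_trans.

Definition tensor : Type := {eq_quot tens_equiv}.

HB.instance Definition _ := Choice.on tensor.
HB.instance Definition _ := EqQuotient.on tensor.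

Definition tens_of_seq (s : seq (A * B)) : tensor := \pi_tensor s.
Definition tens (a : A) (b : B) : tensor := tens_of_seq [:: (a, b)].

(* The map induced by f on the tensor product; it is independent of the chosen
   representative when f is bilinear. *)
Definition tlift (V : nmodType) (f : A -> B -> V) (x : tensor) : V :=
  \sum_(p <- (repr x : seq (A * B))) f p.1 p.2.

Lemma tlift_seq (V : lmodType C) (f : A -> B -> V) (s : seq (A * B)) :
  bilinear_map f -> tlift f (tens_of_seq s) = \sum_(p <- s) f p.1 p.2.
Proof.
move=> bf; rewrite /tlift.
have /eqmodP /asboolP h : repr (tens_of_seq s) = s %[mod tensor].
  by rewrite reprK.
exact: h.
Qed.

Lemma tlift_tens (V : lmodType C) (f : A -> B -> V) a b :
  bilinear_map f -> tlift f (tens a b) = f a b.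
Proof. by move=> bf; rewrite tlift_seq // big_seq1. Qed.

Lemma tens_of_reprK (x : tensor) : tens_of_seq (repr x) = x.
Proof. exact: reprK. Qed.

Lemma tensorP (x y : tensor) :
  (forall (V : lmodType C) (f : A -> B -> V), bilinear_map f ->
     tlift f x = tlift f y) -> x = y.
Proof.
move=> h; rewrite -(tens_of_reprK x) -(tens_of_reprK y).
by apply/eqmodP/asboolP.
Qed.

Definition tens0 : tensor := tens_of_seq [::].
Definition tens_add (x y : tensor) : tensor := tens_of_seq (repr x ++ repr y).
Definition tens_scale (c : C) (x : tensor) : tensor :=
  tens_of_seq [seq (c *: p.1, p.2) | p <- repr x].
Definition tens_opp (x : tensor) : tensor := tens_scale (- 1) x.

Section Lift.
Variables (V : lmodType C) (f : A -> B -> V) (bf : bilinear_map f).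

Lemma bilinZl c a b : f (c *: a) b = c *: f a b.
Proof.
pose g := HB.pack_for {linear A -> V} (fun a => f a b)
  (GRing.isLinear.Build C A V *:%R _ (bf.1 b)).
exact: (linearZ_LR g).
Qed.

Lemma tlift0 : tlift f tens0 = 0.
Proof. by rewrite tlift_seq // big_nil. Qed.

Lemma tliftD x y : tlift f (tens_add x y) = tlift f x + tlift f y.
Proof. by rewrite tlift_seq // big_cat. Qed.

Lemma tliftZ c x : tlift f (tens_scale c x) = c *: tlift f x.
Proof.
rewrite tlift_seq // big_map scaler_sumr.
by apply: eq_bigr => p _; rewrite bilinZl.
Qed.

Lemma tliftN x : tlift f (tens_opp x) = - tlift f x.
Proof. by rewrite tliftZ scaleN1r. Qed.

End Lift.

Fact tens_addA : associative tens_add.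
Proof. by move=> x y z; apply: tensorP => V f bf; rewrite !tliftD ?addrA. Qed.
Fact tens_addC : commutative tens_add.
Proof. by move=> x y; apply: tensorP => V f bf; rewrite !tliftD // addrC. Qed.
Fact tens_add0 : left_id tens0 tens_add.
Proof. by move=> x; apply: tensorP => V f bf; rewrite tliftD ?tlift0 ?add0r. Qed.
Fact tens_addN : left_inverse tens0 tens_opp tens_add.
Proof.
by move=> x; apply: tensorP => V f bf; rewrite tliftD ?tliftN ?tlift0 ?addNr.
Qed.

HB.instance Definition _ :=
  GRing.isZmodule.Build tensor tens_addA tens_addC tens_add0 tens_addN.

Fact tens_scaleA a b x : tens_scale a (tens_scale b x) = tens_scale (a * b) x.
Proof. by apply: tensorP => V f bf; rewrite !tliftZ ?scalerA. Qed.
Fact tens_scale1 : left_id 1 tens_scale.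
Proof. by move=> x; apply: tensorP => V f bf; rewrite tliftZ ?scale1r. Qed.
Fact tens_scaleDr : right_distributive tens_scale +%R.
Proof.
move=> c x y; apply: tensorP => V f bf.
by rewrite tliftZ // !tliftD // !tliftZ // scalerDr.
Qed.
Fact tens_scaleDl x : {morph tens_scale^~ x : a b / a + b}.
Proof.
move=> a b; apply: tensorP => V f bf.
by rewrite tliftD // !tliftZ // scalerDl.
Qed.

HB.instance Definition _ := GRing.Zmodule_isLmodule.Build C tensor
  tens_scaleA tens_scale1 tens_scaleDr tens_scaleDl.

Lemma tlift_linear (V : lmodType C) (f : A -> B -> V) :
  bilinear_map f -> linear (tlift f).
Proof. by move=> bf c x y; rewrite [LHS]tliftD // tliftZ. Qed.

Lemma tens_bilinear : bilinear_map tens.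
Proof.
split=> [b c a a' | a c b b']; apply: tensorP => V f bf.
  rewrite [RHS]tliftD // [X in _ = X + _]tliftZ // !tlift_tens //.
  exact: bf.1.
rewrite [RHS]tliftD // [X in _ = X + _]tliftZ // !tlift_tens //.
exact: bf.2.
Qed.

Lemma tens_sumE (x : tensor) :
  x = \sum_(p <- (repr x : seq (A * B))) tens p.1 p.2.
Proof.
apply: tensorP => V f bf.
pose g := HB.pack_for {linear tensor -> V} (tlift f)
  (GRing.isLinear.Build C tensor V *:%R _ (tlift_linear bf)).
rewrite -[RHS]/(g _) linear_sum /=.
by apply: eq_bigr => p _; rewrite tlift_tens.
Qed.

End TensorProduct.

Arguments tens {C A B}.
Arguments tlift {C A B V}.
Arguments bilinear_map {C A B V}.

Section TensorMaps.
Variable C : numClosedFieldType.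

Definition tmap (A B A' B' : lmodType C) (f : A -> A') (g : B -> B') :
  tensor A B -> tensor A' B' := tlift (fun a b => tens (f a) (g b)).

Definition tassoc (A B D : lmodType C) :
  tensor (tensor A B) D -> tensor A (tensor B D) :=
  tlift (fun x d => tlift (fun a b => tens a (tens b d)) x).

End TensorMaps.

Section TensorNonzero.
Variable C : numClosedFieldType.
Local Open Scope classical_set_scope.

Lemma exists_functional (A : lmodType C) (e : A) : e != 0 ->
  exists phi : A -> C, linear_for *%R phi /\ phi e = 1.
Proof.
move=> e0.
pose P (M : set A) :=
  (forall (c : C) x y, M x -> M y -> M (c *: x + y)) /\ ~ M e.
have [|M [[Mlin Me] Mmax]] := @Zorn_bigcup A P.
  move=> F FP Ftot; split; last by move=> [X FX Xe]; exact: (FP X FX).2 Xe.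
  move=> c x y [X FX Xx] [Y FY Yy].
  have [XY|YX] := Ftot X Y FX FY.
    by exists Y => //; apply: (FP Y FY).1 => //; exact: XY.
  by exists X => //; apply: (FP X FX).1 => //; exact: YX.
have M0 : M 0.
  apply: contrapT => M0.
  have Mempty x : ~ M x.
    by move=> Mx; apply: M0; have := Mlin (- 1) x x Mx Mx; rewrite scaleN1r addNr.
  apply: (Mmax [set 0]); first split.
  - by move=> x /Mempty.
  - by move=> /(_ 0 erefl)/Mempty.
  - split=> [c x y -> -> | /= /eqP]; first by rewrite /= scaler0 addr0.
    by rewrite (negPf e0).
have MZ c x : M x -> M (c *: x) by move=> Mx; have := Mlin c x 0 Mx M0; rewrite addr0.
have MB x y : M x -> M y -> M (x - y).
  by move=> Mx My; have := Mlin (- 1) y x My Mx; rewrite scaleN1r addrC.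
have dec x : exists t, M (x - t *: e).
  have [Mx|nMx] := pselect (M x); first by exists 0; rewrite scale0r subr0.
  pose Q : set A := [set z | exists t m, M m /\ z = t *: x + m].
  have MQ : M `<=` Q by move=> z Mz; exists 0, z; rewrite scale0r add0r.
  have Qx : Q x by exists 1, 0; rewrite scale1r addr0.
  have : ~ P Q by apply: Mmax; split=> // QM; exact: nMx (QM _ Qx).
  have Qlin c y z : Q y -> Q z -> Q (c *: y + z).
    move=> [t [m [Mm ->]]] [t' [m' [Mm' ->]]].
    exists (c * t + t'), (c *: m + m'); split; first exact: Mlin.
    by rewrite scalerDr scalerA scalerDl addrACA.
  move=> nPQ; have [t [m [Mm em]]] : Q e by apply: contrapT => nQe; exact: nPQ.
  have [t0|t0] := eqVneq t 0.
    by exfalso; apply: Me; rewrite em t0 scale0r add0r.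
  exists t^-1; rewrite em scalerDr scalerA mulVf // scale1r opprD addNKr.
  by rewrite -scaleNr; exact: MZ.
have uniq x t t' : M (x - t *: e) -> M (x - t' *: e) -> t = t'.
  move=> Mt Mt'; apply/eqP/negPn/negP; rewrite -subr_eq0 => tt'.
  apply: Me; have := MZ (t - t')^-1 _ (MB _ _ Mt' Mt).
  rewrite opprB [x - t' *: e]addrC addrACA subrr addr0 addrC -scalerBl.
  by rewrite scalerA mulVf ?scale1r.
pose phi x := sval (cid (dec x)).
have phiP x : M (x - phi x *: e) := svalP (cid (dec x)).
exists phi; split; last by apply: uniq (phiP e) _; rewrite scale1r subrr.
move=> c x y; apply: uniq (phiP _) _.
rewrite scalerDl -scalerA opprD addrACA -scalerBr.
exact: Mlin.
Qed.

Lemma tens_neq0 (A B : lmodType C) (a : A) (b : B) :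
  a != 0 -> b != 0 -> tens a b != 0.
Proof.
move=> a0 b0; have [phi [philin phia]] := exists_functional a0.
have bf : bilinear_map (fun (x : A) (y : B) => phi x *: y).
  split=> [y c x x' | x c y y']; first by rewrite philin scalerDl scalerA.
  by rewrite scalerDr !scalerA mulrC.
apply/eqP => /(congr1 (tlift (fun (x : A) (y : B) => phi x *: y))).
by rewrite tlift_tens // phia scale1r [RHS]tlift0 //; apply/eqP.
Qed.

End TensorNonzero.

Section TensorAlgebra.
Variables (C : numClosedFieldType) (A B : algType C).
Local Notation AB := (tensor A B).

Definition tens_one : AB := tens 1 1.
Definition tens_mul (x y : AB) : AB :=
  tlift (fun a b => tlift (fun a' b' => tens (a * a') (b * b')) y) x.

Lemma tensDl (a a' : A) (b : B) : tens (a + a') b = tens a b + tens a' b.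
Proof. by have := (tens_bilinear A B).1 b 1 a a'; rewrite !scale1r. Qed.
Lemma tensDr (a : A) (b b' : B) : tens a (b + b') = tens a b + tens a b'.
Proof. by have := (tens_bilinear A B).2 a 1 b b'; rewrite !scale1r. Qed.
Lemma tensZl c (a : A) (b : B) : tens (c *: a) b = c *: tens a b.
Proof. exact: bilinZl (tens_bilinear A B) c a b. Qed.
Lemma tensZr c (a : A) (b : B) : tens a (c *: b) = c *: tens a b.
Proof.
have t0 : tens a 0 = 0 :> AB.
  by apply: (addrI (tens a 0)); rewrite addr0 -tensDr addr0.
by have := (tens_bilinear A B).2 a c b 0; rewrite t0 !addr0.
Qed.

Lemma tens_ind (P : AB -> Prop) :
  P 0 -> (forall a b x, P x -> P (tens a b + x)) -> forall x, P x.
Proof.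
move=> P0 Pt x; rewrite (tens_sumE x).
elim: (repr x : seq (A * B)) => [|p s IH]; first by rewrite big_nil.
by rewrite big_cons; apply: Pt.
Qed.

Lemma tens_mul_bil1 a b :
  bilinear_map (fun (a' : A) (b' : B) => tens (a * a') (b * b')).
Proof.
split=> [b' c x y | a' c x y].
  by rewrite mulrDr -scalerAr tensDl tensZl.
by rewrite mulrDr -scalerAr tensDr tensZr.
Qed.

Lemma tens_mul_bil2 (y : AB) :
  bilinear_map (fun a b => tlift (fun a' b' => tens (a * a') (b * b')) y).
Proof.
split=> [b c x x' | a c x x']; rewrite /tlift scaler_sumr -big_split /=;
  apply: eq_bigr => p _; rewrite mulrDl -scalerAl.
  by rewrite tensDl tensZl.
by rewrite tensDr tensZr.
Qed.

Lemma tens_mulDl : left_distributive tens_mul +%R.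
Proof.
move=> x y z; have := tlift_linear (tens_mul_bil2 z) 1 x y.
by rewrite !scale1r.
Qed.

Lemma tens_mulDr : right_distributive tens_mul +%R.
Proof.
move=> x y z; rewrite /tens_mul /tlift -big_split /=.
apply: eq_bigr => p _.
by have := tlift_linear (tens_mul_bil1 p.1 p.2) 1 y z; rewrite !scale1r.
Qed.

Lemma tens_mulE a b a' b' :
  tens_mul (tens a b) (tens a' b') = tens (a * a') (b * b').
Proof.
rewrite /tens_mul tlift_tens ?tlift_tens //; first exact: tens_mul_bil1.
exact: tens_mul_bil2.
Qed.

Lemma tens_mul0l x : tens_mul 0 x = 0.
Proof. by apply: (addrI (tens_mul 0 x)); rewrite -tens_mulDl !addr0. Qed.
Lemma tens_mul0r x : tens_mul x 0 = 0.
Proof. by apply: (addrI (tens_mul x 0)); rewrite -tens_mulDr !addr0. Qed.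

Fact tens_mulA : associative tens_mul.
Proof.
move=> x y z; elim/tens_ind: x => [|a b x IHx]; first by rewrite !tens_mul0l.
rewrite !tens_mulDl IHx; congr (_ + _) => {x IHx}.
elim/tens_ind: y => [|a' b' y IHy]; first by rewrite !(tens_mul0l, tens_mul0r).
rewrite !(tens_mulDl, tens_mulDr) IHy; congr (_ + _) => {y IHy}.
elim/tens_ind: z => [|a2 b2 z IHz]; first by rewrite !tens_mul0r.
by rewrite !tens_mulDr IHz !tens_mulE !mulrA.
Qed.

Fact tens_mul1l : left_id tens_one tens_mul.
Proof.
elim/tens_ind => [|a b x IHx]; first by rewrite tens_mul0r.
by rewrite tens_mulDr IHx tens_mulE !mul1r.
Qed.

Fact tens_mul1r : right_id tens_one tens_mul.
Proof.
elim/tens_ind => [|a b x IHx]; first by rewrite tens_mul0l.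
by rewrite tens_mulDl IHx tens_mulE !mulr1.
Qed.

Fact tens_one_neq0 : tens_one != 0.
Proof. by apply: tens_neq0; exact: oner_neq0. Qed.

HB.instance Definition _ := GRing.Zmodule_isNzRing.Build (tensor A B)
  tens_mulA tens_mul1l tens_mul1r tens_mulDl tens_mulDr tens_one_neq0.

Fact tens_scalerAl (c : C) (x y : AB) : c *: (x * y) = (c *: x) * y.
Proof.
have := tlift_linear (tens_mul_bil2 y) c x 0.
by rewrite -/(tens_mul _ y) !addr0 -/(tens_mul _ y) -/(tens_mul _ y) tens_mul0l addr0.
Qed.

HB.instance Definition _ := GRing.Lmodule_isLalgebra.Build C (tensor A B) tens_scalerAl.

Fact tens_scalerAr (c : C) (x y : AB) : c *: (x * y) = x * (c *: y).
Proof.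
rewrite [LHS]scaler_sumr; apply: eq_bigr => p _.
have := tlift_linear (tens_mul_bil1 p.1 p.2) c y 0.
by rewrite !addr0 [X in _ = _ + X](tlift0 (tens_mul_bil1 p.1 p.2)) addr0 => ->.
Qed.

HB.instance Definition _ := GRing.Lalgebra_isAlgebra.Build C (tensor A B) tens_scalerAr.

Lemma tensM a b a' b' : tens a b * tens a' b' = tens (a * a') (b * b') :> AB.
Proof. exact: tens_mulE. Qed.

Lemma tens1 : tens 1 1 = 1 :> AB.
Proof. by []. Qed.

End TensorAlgebra.

HB.mixin Record isStarAlgebra (C : numClosedFieldType) A of GRing.Algebra C A := {
  star : A -> A;
  starD : {morph star : x y / x + y};
  starZ : forall (c : C) (x : A), star (c *: x) = c^* *: star x;
  starM : forall x y : A, star (x * y) = star y * star x;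
  starK : involutive star
}.

#[short(type="starAlgType")]
HB.structure Definition StarAlgebra (C : numClosedFieldType) :=
  {A of GRing.Algebra C A & isStarAlgebra C A}.

Definition star_compatible (C : numClosedFieldType) (A B : starAlgType C)
  (f : A -> B) : Prop := {morph f : x / star x}.

Section ScalarStar.
Variable C : numClosedFieldType.

Definition scalar_star (x : C^o) : C^o := (x : C)^*.

Fact scalar_starD : {morph scalar_star : x y / x + y}.
Proof. by move=> x y; exact: rmorphD. Qed.
Fact scalar_starZ (c : C) (x : C^o) : scalar_star (c *: x) = c^* *: scalar_star x.
Proof. exact: rmorphM. Qed.
Fact scalar_starM (x y : C^o) : scalar_star (x * y) = scalar_star y * scalar_star x.
Proof. by rewrite mulrC; exact: rmorphM. Qed.
Fact scalar_starK : involutive scalar_star.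
Proof. by move=> x; exact: conjCK. Qed.

HB.instance Definition _ := isStarAlgebra.Build C C^o
  scalar_starD scalar_starZ scalar_starM scalar_starK.

End ScalarStar.

Section MatrixStar.
Variables (C : numClosedFieldType) (n : nat).
Local Notation M := 'M[C]_n.+1.

Definition conj_trmx (x : M) : M := (map_mx (fun c : C => c^*) x)^T.

Fact conj_trmxD : {morph conj_trmx : x y / x + y}.
Proof. by move=> x y; apply/matrixP => i j; rewrite !mxE rmorphD. Qed.
Fact conj_trmxZ (c : C) (x : M) : conj_trmx (c *: x) = c^* *: conj_trmx x.
Proof. by apply/matrixP => i j; rewrite !mxE rmorphM. Qed.
Fact conj_trmxM (x y : M) : conj_trmx (x * y) = conj_trmx y * conj_trmx x.
Proof.
apply/matrixP => i j; rewrite !mxE rmorph_sum; apply: eq_bigr => k _.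
by rewrite !mxE rmorphM mulrC.
Qed.
Fact conj_trmxK : involutive conj_trmx.
Proof. by move=> x; apply/matrixP => i j; rewrite !mxE conjCK. Qed.

HB.instance Definition _ := isStarAlgebra.Build C 'M[C]_n.+1
  conj_trmxD conj_trmxZ conj_trmxM conj_trmxK.

End MatrixStar.

Section PairStar.
Variables (C : numClosedFieldType) (A B : starAlgType C).

Definition pair_star (x : A * B) : A * B := (star x.1, star x.2).

Fact pair_starD : {morph pair_star : x y / x + y}.
Proof. by move=> x y; rewrite /pair_star !starD. Qed.
Fact pair_starZ (c : C) (x : A * B) : pair_star (c *: x) = c^* *: pair_star x.
Proof. by rewrite /pair_star !starZ. Qed.
Fact pair_starM (x y : A * B) : pair_star (x * y) = pair_star y * pair_star x.
Proof. by rewrite /pair_star !starM. Qed.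
Fact pair_starK : involutive pair_star.
Proof. by case=> a b; rewrite /pair_star !starK. Qed.

HB.instance Definition _ := isStarAlgebra.Build C (A * B)%type
  pair_starD pair_starZ pair_starM pair_starK.

End PairStar.

(* The complex conjugate of a vector space: an antilinear map into V is a
   linear map into conj_lmod V. *)
Definition conj_lmod (C : numClosedFieldType) (V : lmodType C) : Type := V.

Section ConjLmod.
Variables (C : numClosedFieldType) (V : lmodType C).

HB.instance Definition _ := GRing.Zmodule.on (conj_lmod V).

Definition conj_scale (c : C) (v : conj_lmod V) : conj_lmod V := c^* *: (v : V).

Fact conj_scaleA a b v : conj_scale a (conj_scale b v) = conj_scale (a * b) v.
Proof. by rewrite /conj_scale scalerA rmorphM. Qed.
Fact conj_scale1 : left_id 1 conj_scale.
Proof. by move=> v; rewrite /conj_scale rmorph1 scale1r. Qed.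
Fact conj_scaleDr : right_distributive conj_scale +%R.
Proof. by move=> c u v; exact: scalerDr. Qed.
Fact conj_scaleDl v : {morph conj_scale^~ v : a b / a + b}.
Proof. by move=> a b; rewrite /conj_scale rmorphD; exact: scalerDl. Qed.

HB.instance Definition _ := GRing.Zmodule_isLmodule.Build C (conj_lmod V)
  conj_scaleA conj_scale1 conj_scaleDr conj_scaleDl.

End ConjLmod.

Section TensorStar.
Variables (C : numClosedFieldType) (A B : starAlgType C).
Local Notation AB := (tensor A B).

Definition tens_star : AB -> AB := tlift (fun a b => tens (star a) (star b)).

Lemma tens_star_bilinear :
  @bilinear_map C A B (conj_lmod AB) (fun a b => tens (star a) (star b)).
Proof.
split=> [b c a a' | a c b b'].
  by rewrite starD starZ tensDl tensZl.
by rewrite starD starZ tensDr tensZr.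
Qed.

Lemma tens_starE a b : tens_star (tens a b) = tens (star a) (star b).
Proof. exact: tlift_tens tens_star_bilinear. Qed.

Fact tens_starD : {morph tens_star : x y / x + y}.
Proof. exact: tliftD tens_star_bilinear. Qed.

Fact tens_starZ (c : C) (x : AB) : tens_star (c *: x) = c^* *: tens_star x.
Proof. exact: (tliftZ tens_star_bilinear c x). Qed.

Lemma tens_star0 : tens_star 0 = 0.
Proof. exact: tlift0 tens_star_bilinear. Qed.

Fact tens_starM (x y : AB) : tens_star (x * y) = tens_star y * tens_star x.
Proof.
elim/tens_ind: x => [|a b x IHx]; first by rewrite mul0r tens_star0 mulr0.
rewrite mulrDl !tens_starD mulrDr IHx; congr (_ + _) => {x IHx}.
elim/tens_ind: y => [|a' b' y IHy]; first by rewrite mulr0 tens_star0 mul0r.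
by rewrite mulrDr !tens_starD mulrDl IHy tensM !tens_starE tensM !starM.
Qed.

Fact tens_starK : involutive tens_star.
Proof.
elim/tens_ind => [|a b x IHx]; first by rewrite !tens_star0.
by rewrite !tens_starD IHx !tens_starE !starK.
Qed.

HB.instance Definition _ := isStarAlgebra.Build C (tensor A B)
  tens_starD tens_starZ tens_starM tens_starK.

End TensorStar.

Section Corepresentations.
Variables (C : numClosedFieldType) (A : starAlgType C).

Definition star_mx m n (v : 'M[A]_(m, n)) : 'M[A]_(m, n) := map_mx star v.

Definition unitary_mx n (v : 'M[A]_n) : Prop :=
  v *m (star_mx v)^T = 1%:M /\ (star_mx v)^T *m v = 1%:M.

Definition unitary_corep_for (comul : A -> tensor A A) n (v : 'M[A]_n) : Prop :=
  (forall i j, comul (v i j) = \sum_k tens (v i k) (v k j)) /\ unitary_mx v.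

Definition lin_span (S : A -> Prop) (a : A) : Prop :=
  exists2 s : seq (C * A), (forall p, p \in s -> S p.2) &
    a = \sum_(p <- s) p.1 *: p.2.

End Corepresentations.

HB.mixin Record isCQG (C : numClosedFieldType) A of StarAlgebra C A := {
  comul : {lrmorphism A -> tensor A A};
  counit : {lrmorphism A -> C | *%R};
  antipode : {linear A -> A};
  comul_star : star_compatible comul;
  counit_star : forall a : A, counit (star a) = (counit a)^*;
  comulA : forall a : A, tassoc (tmap comul id (comul a)) = tmap id comul (comul a);
  counitl : forall a : A, tlift (fun x y => counit x *: y) (comul a) = a;
  counitr : forall a : A, tlift (fun x y => counit y *: x) (comul a) = a;
  antipodel : forall a : A,
    tlift (fun x y => antipode x * y) (comul a) = counit a *: 1;
  antipoder : forall a : A,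
    tlift (fun x y => x * antipode y) (comul a) = counit a *: 1;
  coreps_span : forall a : A,
    lin_span (fun x => exists n (v : 'M[A]_n) i j,
      unitary_corep_for comul v /\ x = v i j) a
}.

#[short(type="cqgType")]
HB.structure Definition CQG (C : numClosedFieldType) :=
  {A of StarAlgebra C A & isCQG C A}.

Section CompactQuantumGroups.
Variable C : numClosedFieldType.

Definition unitary_corep (G : cqgType C) n (v : 'M[G]_n) : Prop :=
  unitary_corep_for comul v.

Definition cqg_morphism (G H : cqgType C) (f : {lrmorphism G -> H}) : Prop :=
  [/\ star_compatible f,
      forall a, comul (f a) = tmap f f (comul a) &
      forall a, counit (f a) = counit a].

Variable G : cqgType C.

Definition scalar_mx_of m n (T : 'M[C]_(m, n)) : 'M[G]_(m, n) :=
  map_mx (in_alg G) T.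

Definition corep_equiv m n (v : 'M[G]_m) (w : 'M[G]_n) : Prop :=
  exists (T : 'M[C]_(m, n)) (S : 'M[C]_(n, m)),
    [/\ T *m S = 1%:M, S *m T = 1%:M &
        v *m scalar_mx_of T = scalar_mx_of T *m w].

(* v acts on C^n by e_j |-> \sum_i e_i (x) v_ij, so that the range of an
   idempotent P is invariant if and only if P v P = v P. *)
Definition corep_irreducible n (v : 'M[G]_n) : Prop :=
  (0 < n)%N /\
  forall P : 'M[C]_n, P *m P = P ->
    scalar_mx_of P *m v *m scalar_mx_of P = v *m scalar_mx_of P ->
    P = 0 \/ P = 1%:M.

(* The coefficient at ((i, j), (k, l)) is v_ik w_jl, in this order. *)
Definition corep_tensor m n (v : 'M[G]_m) (w : 'M[G]_n) : 'M[G]_(m * n) :=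
  tensmx v w.

Definition corep_conj n (v : 'M[G]_n) : 'M[G]_n := star_mx v.

End CompactQuantumGroups.

Section FreeUnitary.
Variables (C : numClosedFieldType) (N : nat).

Definition free_unitary_relations (A : starAlgType C) (u : 'M[A]_N) : Prop :=
  unitary_mx u /\ unitary_mx (star_mx u).

Definition is_free_unitary (U : cqgType C) (u : 'M[U]_N) : Prop :=
  [/\ free_unitary_relations u,
      forall i j, comul (u i j) = \sum_k tens (u i k) (u k j) &
      forall (A : starAlgType C) (v : 'M[A]_N), free_unitary_relations v ->
        exists f : {lrmorphism U -> A},
          [/\ star_compatible f, forall i j, f (u i j) = v i j &
              forall g : {lrmorphism U -> A}, star_compatible g ->
                (forall i j, g (u i j) = v i j) -> g =1 f]].

End FreeUnitary.

(* true is the white letter, false the black one. *)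
Definition word := seq bool.

Definition word_conj (w : word) : word := rev (map negb w).

Definition color_balance (w : word) : int :=
  (count_mem true w)%:Z - (count_mem false w)%:Z.

Definition Wwhite (k : nat) (w : word) : Prop :=
  color_balance w = 0 /\
  forall l, (1 <= l <= size w)%N -> 0 <= color_balance (take l w) <= k%:Z.

(* The list of the words ab, over all z with w = az and w' = (word_conj z)b. *)
Definition fusion_words (w w' : word) : seq word :=
  [seq take l w ++ drop (size w - l) w' |
     l <- iota 0 (size w).+1 & take (size w - l) w' == word_conj (drop l w)].

Section FreeUnitaryIrreps.
Variables (C : numClosedFieldType) (N : nat) (U : cqgType C) (u : 'M[U]_N).
Variables (d : word -> nat) (uw : forall w, 'M[U]_(d w)).

Definition fusion_sum (w w' : word) :=
  \mxdiag_(i < size (fusion_words w w')) uw (nth [::] (fusion_words w w') i).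

Definition is_irrep_indexing : Prop :=
  [/\ forall w, unitary_corep (uw w) /\ corep_irreducible (uw w),
      forall w w', corep_equiv (uw w) (uw w') -> w = w',
      forall n (v : 'M[U]_n), unitary_corep v -> corep_irreducible v ->
        exists w, corep_equiv v (uw w) &
      [/\ corep_equiv (uw [:: true]) u,
          forall w, corep_equiv (corep_conj (uw w)) (uw (word_conj w)) &
          forall w w', corep_equiv (corep_tensor (uw w) (uw w')) (fusion_sum w w')]].

Definition coef_span (W : word -> Prop) : U -> Prop :=
  lin_span (fun x => exists w i j, W w /\ x = uw w i j).

Definition is_hopf_subalgebra (S : U -> Prop) (G : cqgType C)
    (incl : {lrmorphism G -> U}) : Prop :=
  [/\ cqg_morphism incl, injective incl &
      forall x, S x <-> exists a, incl a = x].

End FreeUnitaryIrreps.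

Section QuantumTree.
Variables (C : numClosedFieldType) (N : nat).

(* M_N(C); as for 'GL_n, the size N.-1.+1, which is N for N > 0, makes it a
   nontrivial ring. *)
Definition Mat : starAlgType C := 'M[C]_N.-1.+1.

Definition ntrace (x : Mat) : C := N%:R^-1 * \tr (x : 'M[C]_N.-1.+1).

(* The normalized trace of M_N(C) is a delta-form for delta = N. *)
Definition delta : C := N%:R.

(* M_N(C)^{(x) i}, associated to the left and starting from the empty power C;
   in particular the first power is C (x) M_N(C). *)
Fixpoint tpow (i : nat) : starAlgType C :=
  if i is i'.+1 then tensor (tpow i') Mat else C^o.

Fixpoint tpow_state (i : nat) : tpow i -> C :=
  match i with
  | 0 => fun x => x
  | i'.+1 => tlift (fun x y => tpow_state x * ntrace y)
  end.

(* An element of B_k = C (+) B (+) ... (+) B^{(x) k} is a nested pair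
   ((x_0, x_1), ..., x_k). *)
Fixpoint tree_alg (k : nat) : starAlgType C :=
  if k is k'.+1 then (tree_alg k' * tpow k'.+1)%type else tpow 0.

Definition delta_sum (k : nat) : C := \sum_(0 <= i < k.+1) delta ^+ i.

(* \sum_(i <= k) delta^i psi^{(x) i} *)
Fixpoint tree_weight (k : nat) : tree_alg k -> C :=
  match k with
  | 0 => fun x => @tpow_state 0 x
  | k'.+1 => fun x => tree_weight x.1 + delta ^+ k'.+1 * @tpow_state k'.+1 x.2
  end.

Definition tree_state (k : nat) (x : tree_alg k) : C :=
  (delta_sum k)^-1 * tree_weight x.

Definition tree_top (k : nat) : tree_alg k -> tpow k :=
  match k with
  | 0 => fun x => x
  | k'.+1 => fun x => x.2
  end.

(* (x_0, ..., x_k) |-> (0, x_0 (x) 1, ..., x_{k-1} (x) 1) *)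
Fixpoint tree_shift (k : nat) : tree_alg k -> tree_alg k :=
  match k with
  | 0 => fun _ => 0
  | k'.+1 => fun x => (tree_shift x.1, tens (tree_top x.1) 1)
  end.

Definition tree_adj (k : nat) (x : tree_alg k) : tree_alg k := x + tree_shift x.

End QuantumTree.

Section QuantumAutomorphisms.
Variables (C : numClosedFieldType) (B : starAlgType C) (psi : B -> C) (adj : B -> B).

Definition is_graph_action (G : cqgType C) (alpha : {lrmorphism B -> tensor G B}) : Prop :=
  [/\ star_compatible alpha,
      forall x, tassoc (tmap comul id (alpha x)) = tmap id alpha (alpha x) /\
        tlift (fun a y => counit a *: y) (alpha x) = x,
      forall x, tlift (fun a y => psi y *: a) (alpha x) = psi x *: 1 &
      forall x, tmap id adj (alpha x) = alpha (adj x)].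

Definition is_quantum_automorphism_group (G : cqgType C)
    (alpha : {lrmorphism B -> tensor G B}) : Prop :=
  is_graph_action alpha /\
  forall (H : cqgType C) (beta : {lrmorphism B -> tensor H B}),
    is_graph_action beta ->
    exists f : {lrmorphism G -> H},
      [/\ cqg_morphism f, forall x, tmap f id (alpha x) = beta x &
          forall g : {lrmorphism G -> H}, cqg_morphism g ->
            (forall x, tmap g id (alpha x) = beta x) -> g =1 f].

End QuantumAutomorphisms.

(* Main.v *)
Require Import Defs.
From HB Require Import structures.
From mathcomp Require Import all_boot all_order all_algebra.
From mathcomp Require Import mxtens zify.
From mathcomp Require Import boolp classical_sets.
From mathcomp Require Import complex reals.

(* Let U be the matrix with entries U_IK = u_(i1,k1) ... u_(ik,kk). A word of W is
   a path with heights in [0, k]; inserting 1 = sum_j u_ij u_ij^* where needed, one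
   sees that the coefficients of G_N(W) are generated by those of the single word
   white^k black^k, that is, by the elements U_IK U_JM^*. These are the
   coefficients of an action on M_N^(x k), hence on the whole tree.

   Conversely, an action of H on the tree commutes with the powers of the shift
   x |-> x (x) 1, so it preserves each summand and amounts to a trace preserving
   action beta of H on M_N^(x k) that restricts to each M_N^(x i). In
   H (x) M_N^(x k), let e_i(a,b) be the matrix units of the i-th factor and
   g_i(a,b) their images under beta. The elements e_i(0,a) g_i(b,0), cut down by
   suitable projections P_i = g_0(0,0) ... g_(i-1)(0,0) e_i(0,0) ... e_(k-1)(0,0),
   form an N x N matrix v_i from level P_(i+1) to level P_i which is unitary, as is
   its entrywise adjoint. A Halmos dilation of the sum of the v_i is then a
   representation of O(U_N^+); level P_0 commutes with the images of the elements
   U_IK U_JM^*, and its compression, with values in H, sends them to the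
   coefficients of beta. *)

Set Implicit Arguments.
Unset Strict Implicit.
Unset Printing Implicit Defensive.

Import Order.TTheory GRing.Theory Num.Theory.
Local Open Scope ring_scope.

(** * Linear maps and tensor products *)

(** The obstacle is that no presentation of the algebra of G_N(W) is at hand, so a morphism out of
    it cannot be defined by checking relations; only O(U_N^+) has a universal property. The morphism
    to H is therefore the restriction of one defined on all of O(U_N^+). A single u_ij has no
    counterpart in H, so the target is enlarged: by M_N^(x k), by matrices of size k+1 that record
    the height reached on a path, and by 2 x 2 matrices that complete partial isometries.

    Each step from P_i to P_(i+1) replaces e_i(0,0) by g_i(0,0). After k steps U_IK becomes e(0,K)
    beta(e(I,0)), hence U_IK U_JM^* becomes e(0,K) beta(e(I,J)) e(M,0), which carries a coefficient
    of beta. A path that returns to height 0 returns to P_0, hence the commutation, and compression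
    to a corner is multiplicative on the commutant of that corner. Unitarity of v_i is formal; that
    of its entrywise adjoint needs both the invariance of the trace and the antipode of H. *)

Section LinearFunctions.
Variables (C : numClosedFieldType) (V W : lmodType C) (f : V -> W).
Hypothesis lf : linear f.

Lemma linD x y : f (x + y) = f x + f y.
Proof. by have := lf 1 x y; rewrite !scale1r. Qed.
Lemma lin0 : f 0 = 0.
Proof. by apply: (addrI (f 0)); rewrite -linD !addr0. Qed.
Lemma linZ c x : f (c *: x) = c *: f x.
Proof. by have := lf c x 0; rewrite lin0 !addr0. Qed.
Lemma linN x : f (- x) = - f x.
Proof. by rewrite -scaleN1r linZ scaleN1r. Qed.
Lemma linB x y : f (x - y) = f x - f y.
Proof. by rewrite linD linN. Qed.
Lemma lin_sum (I : Type) (r : seq I) (P : pred I) (F : I -> V) :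
  f (\sum_(i <- r | P i) F i) = \sum_(i <- r | P i) f (F i).
Proof. exact: (big_morph f linD lin0). Qed.

End LinearFunctions.

Section LinearCombinators.
Variable C : numClosedFieldType.

Lemma linear_id (V : lmodType C) : linear (@id V).
Proof. by []. Qed.

Lemma linear_comp (V W X : lmodType C) (g : W -> X) (f : V -> W) :
  linear f -> linear g -> linear (g \o f).
Proof. by move=> lf lg c x y; rewrite /= lf lg. Qed.

Lemma linear_sumf (V W : lmodType C) (I : Type) (r : seq I) (F : I -> V -> W) :
  (forall i, linear (F i)) -> linear (fun x => \sum_(i <- r) F i x).
Proof.
move=> lF c x y; rewrite scaler_sumr -big_split /=.
by apply: eq_bigr => i _; rewrite lF.
Qed.

End LinearCombinators.

Definition alg_hom (C : numClosedFieldType) (A B : algType C) (f : A -> B) : Prop :=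
  [/\ linear f, f 1 = 1 & {morph f : x y / x * y}].

Section AlgHom.
Variable C : numClosedFieldType.

Lemma alg_hom_of (A B : algType C) (f : {lrmorphism A -> B}) : alg_hom f.
Proof. by split; [exact: linearP | exact: rmorph1 | exact: rmorphM]. Qed.

Lemma alg_hom_id (A : algType C) : alg_hom (@id A).
Proof. by []. Qed.

Lemma alg_hom_comp (A B D : algType C) (g : B -> D) (f : A -> B) :
  alg_hom f -> alg_hom g -> alg_hom (g \o f).
Proof.
move=> [lf f1 fM] [lg g1 gM]; split; first exact: linear_comp.
  by rewrite /= f1.
by move=> x y /=; rewrite fM gM.
Qed.

Lemma alg_hom_pack (A B : algType C) (f : A -> B) :
  alg_hom f -> {g : {lrmorphism A -> B} | g =1 f}.
Proof.
move=> [lf f1 fM].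
pose g := HB.pack_for {lrmorphism A -> B} f
  (GRing.isLinear.Build C A B *:%R f lf)
  (GRing.isMonoidMorphism.Build A B f (f1, fM)).
by exists g.
Qed.

Lemma alg_hom_prod (A B : algType C) (f : A -> B) (I : Type) (r : seq I) (F : I -> A) :
  alg_hom f -> f (\prod_(i <- r) F i) = \prod_(i <- r) f (F i).
Proof. by case=> _ f1 fM; exact: (big_morph f fM f1). Qed.

End AlgHom.

Section TensorCalculus.
Variable C : numClosedFieldType.
Implicit Types A B : algType C.

Lemma tens0l A B (b : B) : tens (0 : A) b = 0.
Proof. by rewrite -(scale0r (0 : A)) tensZl scale0r. Qed.
Lemma tens0r A B (a : A) : tens a (0 : B) = 0.
Proof. by rewrite -(scale0r (0 : B)) tensZr scale0r. Qed.
Lemma tens_suml A B I (r : seq I) (P : pred I) (F : I -> A) (b : B) :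
  tens (\sum_(i <- r | P i) F i) b = \sum_(i <- r | P i) tens (F i) b.
Proof. exact: (big_morph (fun a => tens a b) (fun x y => tensDl x y b) (tens0l _ b)). Qed.
Lemma tens_sumr A B I (r : seq I) (P : pred I) (F : I -> B) (a : A) :
  tens a (\sum_(i <- r | P i) F i) = \sum_(i <- r | P i) tens a (F i).
Proof. exact: (big_morph (fun b => tens a b) (tensDr a) (tens0r _ a)). Qed.

Lemma linear_tensl A B (b : B) : linear (fun a : A => tens a b).
Proof. exact: (tens_bilinear A B).1. Qed.
Lemma linear_tensr A B (a : A) : linear (fun b : B => tens a b).
Proof. exact: (tens_bilinear A B).2. Qed.

Lemma tensor_lin_eq A B (V : lmodType C) (F G : tensor A B -> V) :
  linear F -> linear G -> (forall a b, F (tens a b) = G (tens a b)) -> F =1 G.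
Proof.
move=> lF lG FG x; elim/tens_ind: x => [|a b x IH]; first by rewrite !lin0.
by rewrite !linD // FG IH.
Qed.

Lemma tmap_bil A B A' B' (f : A -> A') (g : B -> B') : linear f -> linear g ->
  bilinear_map (fun a b => tens (f a) (g b)).
Proof.
move=> lf lg; split=> [b | a].
  exact: (linear_comp lf (linear_tensl (g b))).
exact: (linear_comp lg (linear_tensr (f a))).
Qed.

Lemma linear_tmap A B A' B' (f : A -> A') (g : B -> B') : linear f -> linear g ->
  linear (tmap f g).
Proof. by move=> lf lg; apply: tlift_linear; exact: tmap_bil. Qed.

Lemma tmapE A B A' B' (f : A -> A') (g : B -> B') a b : linear f -> linear g ->
  tmap f g (tens a b) = tens (f a) (g b).
Proof. by move=> lf lg; apply: tlift_tens; exact: tmap_bil. Qed.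

Lemma tmap_comp A B A' B' A2 B2 (f : A -> A') (g : B -> B') (f' : A' -> A2)
    (g' : B' -> B2) : linear f -> linear g -> linear f' -> linear g' ->
  forall x, tmap f' g' (tmap f g x) = tmap (f' \o f) (g' \o g) x.
Proof.
move=> lf lg lf' lg'; apply: tensor_lin_eq => [||a b].
- by apply: linear_comp (linear_tmap lf lg) (linear_tmap lf' lg').
- by apply: linear_tmap; exact: linear_comp.
- by rewrite !tmapE //; exact: linear_comp.
Qed.

Lemma eq_tmap A B A' B' (f f' : A -> A') (g g' : B -> B') :
  f =1 f' -> g =1 g' -> tmap f g =1 tmap f' g'.
Proof. by move=> /funext -> /funext ->. Qed.

Lemma tmap_id A B (x : tensor A B) : tmap id id x = x.
Proof.
have l1 := linear_tmap (@linear_id C A) (@linear_id C B).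
by move: x; apply: (tensor_lin_eq l1 (@linear_id C _)) => a b; rewrite tmapE.
Qed.

Lemma tmapM A B A' B' (f : A -> A') (g : B -> B') : linear f -> linear g ->
  {morph f : x y / x * y} -> {morph g : x y / x * y} -> {morph tmap f g : x y / x * y}.
Proof.
move=> lf lg fM gM x y; have lfg := linear_tmap lf lg.
elim/tens_ind: x => [|a b x IH]; first by rewrite mul0r (lin0 lfg) mul0r.
rewrite mulrDl !(linD lfg) mulrDl IH; congr (_ + _) => {x IH}.
elim/tens_ind: y => [|a' b' y IH]; first by rewrite mulr0 (lin0 lfg) mulr0.
rewrite mulrDr !(linD lfg) mulrDr IH; congr (_ + _).
by rewrite tensM !tmapE // tensM fM gM.
Qed.

Lemma alg_hom_tmap A B A' B' (f : A -> A') (g : B -> B') : alg_hom f -> alg_hom g ->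
  alg_hom (tmap f g).
Proof.
move=> [lf f1 fM] [lg g1 gM]; split; first exact: linear_tmap.
  by rewrite -tens1 tmapE // f1 g1.
exact: tmapM.
Qed.

Lemma star0 (A : starAlgType C) : star (0 : A) = 0.
Proof. by apply: (addrI (star (0 : A))); rewrite -starD !addr0. Qed.
Lemma starN (A : starAlgType C) (x : A) : star (- x) = - star x.
Proof. by apply: (addrI (star x)); rewrite -starD !subrr star0. Qed.
Lemma starB (A : starAlgType C) (x y : A) : star (x - y) = star x - star y.
Proof. by rewrite starD starN. Qed.
Lemma star1 (A : starAlgType C) : star (1 : A) = 1.
Proof. by rewrite -[LHS]mulr1 -{2}(starK (1 : A)) -starM mulr1 starK. Qed.
Lemma star_sum (A : starAlgType C) I (r : seq I) (P : pred I) (F : I -> A) :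
  star (\sum_(i <- r | P i) F i) = \sum_(i <- r | P i) star (F i).
Proof. exact: (big_morph _ (@starD _ A) (@star0 A)). Qed.
Lemma star_tens (A B : starAlgType C) (a : A) (b : B) :
  star (tens a b) = tens (star a) (star b).
Proof. exact: tens_starE. Qed.

Lemma star_tmap (A B A' B' : starAlgType C) (f : A -> A') (g : B -> B') :
  linear f -> linear g -> star_compatible f -> star_compatible g ->
  star_compatible (tmap f g).
Proof.
move=> lf lg sf sg x; have lfg := linear_tmap lf lg.
elim/tens_ind: x => [|a b x IH]; first by rewrite star0 (lin0 lfg) star0.
by rewrite starD !(linD lfg) starD IH star_tens !tmapE // sf sg star_tens.
Qed.

End TensorCalculus.

(** * Matrix units and coefficients *)

Section Kronecker.
Variable T : finType.

Lemma sum_deltaZ (C : pzRingType) (V : lmodType C) (j : T) (F : T -> V) :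
  \sum_i (i == j)%:R *: F i = F j.
Proof.
rewrite (bigD1 j) //= eqxx scale1r big1 ?addr0 // => i /negPf ->.
by rewrite scale0r.
Qed.

Lemma sum_deltal (R : pzRingType) (j : T) (F : T -> R) :
  \sum_i (i == j)%:R * F i = F j.
Proof.
rewrite (bigD1 j) //= eqxx mul1r big1 ?addr0 // => i /negPf ->.
by rewrite mul0r.
Qed.

Lemma sum_deltar (R : pzRingType) (j : T) (F : T -> R) :
  \sum_i F i * (i == j)%:R = F j.
Proof.
rewrite (bigD1 j) //= eqxx mulr1 big1 ?addr0 // => i /negPf ->.
by rewrite mulr0.
Qed.

Lemma natb_and (R : pzRingType) (a b : bool) : (a && b)%:R = a%:R * b%:R :> R.
Proof. by case: a; rewrite ?mul1r ?mul0r. Qed.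

End Kronecker.

(** An identification of B with matrices indexed by T, in a form that passes to tensor products, so
    that scalars, M_N(C) and its tensor powers are handled alike. The coefficients take values in
    [C^o] because linearity asks for a module as target. *)
Record matunits (C : numClosedFieldType) (B : starAlgType C) (T : finType) := Matunits {
  munit :> T -> T -> B;
  mcoef : T -> T -> B -> C^o;
  mcoef_linear : forall K L, linear (mcoef K L);
  mcoef_unit : forall K L I J, mcoef K L (munit I J) = (I == K)%:R * (J == L)%:R;
  munitM : forall I J K L, munit I J * munit K L = (J == K)%:R *: munit I L;
  munit1 : \sum_I munit I I = 1;
  munit_star : forall I J, star (munit I J) = munit J I;
  munit_expand : forall x, x = \sum_I \sum_J mcoef I J x *: munit I J
}.

Lemma munit_lin_eq (C : numClosedFieldType) (B : starAlgType C) (T : finType)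
    (m : matunits B T) (V : lmodType C) (F G : B -> V) : linear F -> linear G ->
  (forall I J, F (m I J) = G (m I J)) -> F =1 G.
Proof.
move=> lF lG FG x; rewrite (munit_expand m x) !(lin_sum lF) !(lin_sum lG).
apply: eq_bigr => I _; rewrite !(lin_sum lF) !(lin_sum lG); apply: eq_bigr => J _.
by rewrite (linZ lF) (linZ lG) FG.
Qed.

Section MatunitsInstances.
Variable C : numClosedFieldType.

Fact scalar_matunits_expand (x : C^o) :
  x = \sum_(I : unit) \sum_(J : unit) (x : C^o) *: (1 : C^o).
Proof. by rewrite !(big_pred1 tt) => [|[]|[]] //; rewrite /GRing.scale /= mulr1. Qed.

(** The three instances end with [Defined] because later proofs compute with their units and
    coefficients, for example to recognise the matrix trace in [ntraceE]. *)
Definition scalar_matunits : matunits (C^o : starAlgType C) unit.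
Proof.
apply: (@Matunits C _ _ (fun _ _ => 1) (fun _ _ x => x)).
- by [].
- by move=> [] [] [] []; rewrite mulr1.
- by move=> [] [] [] []; rewrite mulr1 scale1r.
- by rewrite (big_pred1 tt) // => -[].
- by move=> _ _; rewrite star1.
- exact: scalar_matunits_expand.
Defined.

Definition matrix_matunits n : matunits ('M[C]_n.+1 : starAlgType C) 'I_n.+1.
Proof.
apply: (@Matunits C _ _ (fun i j => delta_mx i j) (fun i j x => x i j)).
- by move=> K L c x y; rewrite !mxE.
- by move=> K L I J; rewrite mxE natb_and eq_sym [L == _]eq_sym.
- move=> I J K L; rewrite -[LHS]/(delta_mx I J *m delta_mx K L).
  have [->|ne] := eqVneq J K; first by rewrite mul_delta_mx scale1r.
  by rewrite mul_delta_mx_0 ?scale0r // .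
- apply/matrixP => i j; rewrite summxE (bigD1 i) //= !mxE eqxx eq_sym big1 ?addr0 //.
  by move=> k /negPf ki; rewrite mxE eq_sym ki.
- by move=> I J; apply/matrixP => i j; rewrite !mxE rmorph_nat andbC.
- by move=> x; rewrite -matrix_sum_delta.
Defined.

Section TensorMatunits.
Variables (A B : starAlgType C) (S T : finType) (mA : matunits A S) (mB : matunits B T).

Definition tens_unit (I J : S * T) : tensor A B := tens (mA I.1 J.1) (mB I.2 J.2).
Definition tens_coef (K L : S * T) : tensor A B -> C^o :=
  tlift (fun a b => mcoef mA K.1 L.1 a * mcoef mB K.2 L.2 b).

Lemma tens_coef_bil K L :
  bilinear_map (fun (a : A) (b : B) => (mcoef mA K.1 L.1 a * mcoef mB K.2 L.2 b : C^o)).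
Proof.
split=> [b | a] c x y.
  by rewrite (mcoef_linear mA) mulrDl /GRing.scale /= mulrA.
by rewrite (mcoef_linear mB) mulrDr /GRing.scale /= mulrCA.
Qed.

Lemma tens_coefE K L a b : tens_coef K L (tens a b) =
  mcoef mA K.1 L.1 a * mcoef mB K.2 L.2 b.
Proof. exact/tlift_tens/tens_coef_bil. Qed.

Fact tens_coef_unit K L I J :
  tens_coef K L (tens_unit I J) = (I == K)%:R * (J == L)%:R.
Proof.
rewrite tens_coefE !mcoef_unit mulrACA -!natb_and.
by case: I J K L => [? ?] [? ?] [? ?] [? ?].
Qed.

Fact tens_coef_linear K L : linear (tens_coef K L).
Proof. exact/tlift_linear/tens_coef_bil. Qed.

Fact tens_unit_expand x : x = \sum_I \sum_J tens_coef I J x *: tens_unit I J.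
Proof.
pose F x := \sum_I \sum_J tens_coef I J x *: tens_unit I J.
have lF : linear F.
  apply: linear_sumf => I; apply: linear_sumf => J c u v.
  by rewrite tens_coef_linear scalerDl scalerA.
apply/esym; move: x; apply: (tensor_lin_eq lF (@linear_id C _)) => a b.
move: a; apply: (munit_lin_eq (m := mA)) => [||I J].
- exact: (linear_comp (linear_tensl b) lF).
- exact: linear_tensl.
move: b; apply: (munit_lin_eq (m := mB)) => [||K L].
- exact: (linear_comp (linear_tensr (mA I J)) lF).
- exact: linear_tensr.
rewrite -[tens _ _]/(tens_unit (I, K) (J, L)) /F.
under eq_bigr => X _.
  under eq_bigr => Y _ do
    rewrite tens_coef_unit [(I, K) == X]eq_sym [(J, L) == Y]eq_sym mulrC -scalerA.
  rewrite sum_deltaZ.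
over.
exact: sum_deltaZ.
Qed.

Definition tens_matunits : matunits (tensor A B : starAlgType C) (S * T)%type.
Proof.
apply: (@Matunits C _ _ tens_unit tens_coef).
- exact: tens_coef_linear.
- by move=> K L I J; exact: tens_coef_unit.
- move=> I J K L; rewrite /tens_unit tensM !munitM tensZl tensZr scalerA.
  by rewrite -natb_and.
- rewrite (eq_bigr (fun I : S * T => tens (mA I.1 I.1) (mB I.2 I.2))) //.
  rewrite -(pair_big xpredT xpredT (fun i j => tens (mA i i) (mB j j))) /=.
  rewrite -[RHS]tens1 -(munit1 mA) -(munit1 mB) tens_suml.
  by apply: eq_bigr => i _; rewrite tens_sumr.
- by move=> I J; rewrite star_tens !munit_star.
- exact: tens_unit_expand.
Defined.

End TensorMatunits.
End MatunitsInstances.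

Section Coefficients.
Variables (C : numClosedFieldType) (B : starAlgType C) (T : finType) (m : matunits B T).

(** Reads an element of H (x) B as a matrix over H; the lemmas below are the matrix rules for
    products, units and adjoints. *)
Definition tcoef (H : algType C) (K L : T) : tensor H B -> H :=
  tlift (fun a y => mcoef m K L y *: a).

Section OneAlgebra.
Variable H : algType C.

Lemma tcoef_bil K L : bilinear_map (fun (a : H) (y : B) => (mcoef m K L y : C) *: a).
Proof.
split=> [y | a] c x z; first by rewrite scalerDr !scalerA mulrC.
by rewrite (mcoef_linear m) scalerDl scalerA.
Qed.

Lemma tcoefE K L (a : H) y : tcoef K L (tens a y) = (mcoef m K L y : C) *: a.
Proof. exact/tlift_tens/tcoef_bil. Qed.

Lemma tcoef_linear K L : linear (@tcoef H K L).
Proof. exact/tlift_linear/tcoef_bil. Qed.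

Lemma tcoef_unit K L (a : H) I J :
  tcoef K L (tens a (m I J)) = (I == K)%:R *: ((J == L)%:R *: a).
Proof. by rewrite tcoefE mcoef_unit -scalerA. Qed.

Lemma tcoef_expand (x : tensor H B) : x = \sum_K \sum_L tens (tcoef K L x) (m K L).
Proof.
have lF : linear (fun x : tensor H B => \sum_K \sum_L tens (tcoef K L x) (m K L)).
  apply: linear_sumf => K; apply: linear_sumf => L.
  exact: linear_comp (tcoef_linear K L) (linear_tensl (m K L)).
apply/esym; move: x; apply: (tensor_lin_eq lF (@linear_id C _)) => a b.
rewrite [in RHS](munit_expand m b) tens_sumr; apply: eq_bigr => K _.
rewrite tens_sumr; apply: eq_bigr => L _.
by rewrite tcoefE tensZl tensZr.
Qed.

Lemma tcoef_ext (x y : tensor H B) :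
  (forall K L, tcoef K L x = tcoef K L y) -> x = y.
Proof.
move=> xy; rewrite (tcoef_expand x) (tcoef_expand y).
by apply: eq_bigr => K _; apply: eq_bigr => L _; rewrite xy.
Qed.

Lemma tcoef_sum_unit K L (F : T -> T -> H) :
  tcoef K L (\sum_I \sum_J tens (F I J) (m I J)) = F K L.
Proof.
rewrite (lin_sum (tcoef_linear K L)).
under eq_bigr => I _.
  rewrite (lin_sum (tcoef_linear K L)).
  under eq_bigr => J _ do rewrite tcoef_unit scalerA mulrC -scalerA.
  rewrite sum_deltaZ.
over.
exact: sum_deltaZ.
Qed.

Lemma tcoefM K L (x y : tensor H B) :
  tcoef K L (x * y) = \sum_M tcoef K M x * tcoef M L y.
Proof.
rewrite {1}(tcoef_expand x) {1}(tcoef_expand y) mulr_suml.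
rewrite (eq_bigr (fun I => \sum_L' tens (\sum_M tcoef I M x * tcoef M L' y) (m I L'))).
  by rewrite tcoef_sum_unit.
move=> I _; rewrite mulr_suml.
under eq_bigr => M _.
  rewrite mulr_sumr.
  under eq_bigr => M' _.
    rewrite mulr_sumr.
    under eq_bigr => L' _ do rewrite tensM munitM tensZr eq_sym.
    rewrite -scaler_sumr.
  over.
  rewrite sum_deltaZ.
over.
rewrite /= (exchange_big _ _ _ _ _ (fun M L' => tens (tcoef I M x * tcoef M L' y) (m I L'))).
by apply: eq_bigr => L' _; rewrite tens_suml.
Qed.

Lemma tcoef_one K L : tcoef K L (1 : tensor H B) = (K == L)%:R.
Proof.
rewrite -tens1 -(munit1 m) tens_sumr (lin_sum (tcoef_linear K L)).
under eq_bigr => I _ do rewrite tcoef_unit.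
by rewrite sum_deltaZ scaler_nat.
Qed.

End OneAlgebra.

Lemma tcoef_star (H : starAlgType C) K L (x : tensor H B) :
  tcoef K L (star x) = star (tcoef L K x).
Proof.
rewrite {1}(tcoef_expand x) star_sum.
under eq_bigr => I _.
  rewrite star_sum.
  under eq_bigr => J _ do rewrite star_tens munit_star.
over.
rewrite /= (exchange_big _ _ _ _ _ (fun I J => tens (star (tcoef I J x)) (m J I))).
by rewrite tcoef_sum_unit.
Qed.

Lemma tcoef_tmap (H H' : algType C) (f : H -> H') K L (x : tensor H B) : linear f ->
  tcoef K L (tmap f id x) = f (tcoef K L x).
Proof.
move=> lf; move: x; apply: tensor_lin_eq => [||a b].
- exact: linear_comp (linear_tmap lf (@linear_id C _)) (tcoef_linear K L).
- exact: linear_comp (tcoef_linear K L) lf.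
- by rewrite tmapE // !tcoefE (linZ lf).
Qed.

End Coefficients.

(** * Actions on matrix algebras *)

Section TensorAssociativity.
Variables (C : numClosedFieldType) (A B D : algType C).

Lemma tassoc_inner_bil (d : D) :
  bilinear_map (fun (a : A) (b : B) => tens a (tens b d)).
Proof.
split=> [b | a]; first exact: linear_tensl.
exact: linear_comp (linear_tensl d) (linear_tensr a).
Qed.

Lemma tassoc_bil : bilinear_map
  (fun (x : tensor A B) (d : D) => tlift (fun a b => tens a (tens b d)) x).
Proof.
split=> [d | x]; first exact/tlift_linear/tassoc_inner_bil.
move=> c d d'; move: x; apply: tensor_lin_eq => [||a b].
- exact/tlift_linear/tassoc_inner_bil.
- move=> e y z; rewrite !(tlift_linear (tassoc_inner_bil _)).
  by rewrite !scalerDr !scalerA addrACA mulrC.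
- rewrite !tlift_tens; try exact: tassoc_inner_bil.
  by rewrite !(linear_tensr _ c).
Qed.

Lemma tassoc_linear : linear (@tassoc C A B D).
Proof. exact/tlift_linear/tassoc_bil. Qed.

Lemma tassocE (a : A) (b : B) (d : D) : tassoc (tens (tens a b) d) = tens a (tens b d).
Proof.
by rewrite /tassoc tlift_tens ?tlift_tens //; [exact: tassoc_inner_bil | exact: tassoc_bil].
Qed.

End TensorAssociativity.

Section Inverses.
Variables (R : pzRingType) (P : finType) (s x y : P -> P -> R).
Hypothesis sx : forall p q, \sum_r s p r * x r q = (p == q)%:R.
Hypothesis xy : forall p q, \sum_r x p r * y r q = (p == q)%:R.

(** Here s = s(xy) = (sx)y = y, for matrices over a noncommutative ring. *)
Lemma left_inverse_eq_right p q : s p q = y p q.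
Proof.
rewrite -[LHS](sum_deltar q (s p)).
under eq_bigr => r _ do rewrite -xy mulr_sumr.
rewrite exchange_big /=.
under eq_bigr => r _.
  under eq_bigr => i _ do rewrite mulrA.
  rewrite -mulr_suml sx eq_sym.
over.
exact: sum_deltal.
Qed.

Lemma right_inverse_is_left p q : \sum_r y p r * x r q = (p == q)%:R.
Proof. by rewrite -sx; apply: eq_bigr => r _; rewrite left_inverse_eq_right. Qed.

End Inverses.

Section CoefficientActions.
Variables (C : numClosedFieldType) (B : starAlgType C) (T : finType) (m : matunits B T).

Definition mtrace (x : B) : C := \sum_I mcoef m I I x.

Lemma mtrace_linear : linear (mtrace : B -> C^o).
Proof. by apply: linear_sumf => I; exact: mcoef_linear. Qed.

Lemma mtrace_unit I J : mtrace (m I J) = (I == J)%:R.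
Proof.
rewrite /mtrace; under eq_bigr => K _ do rewrite mcoef_unit eq_sym.
by rewrite sum_deltal eq_sym.
Qed.

Section ActionOfCoefficients.
Variables (A : starAlgType C) (t : T -> T -> T -> T -> A).

(** The identities on t assumed below are what turns this linear map into an invariant action. *)
Definition coef_action (x : B) : tensor A B :=
  \sum_I \sum_J mcoef m I J x *: \sum_K \sum_L tens (t I J K L) (m K L).

Lemma coef_action_linear : linear coef_action.
Proof.
apply: linear_sumf => I; apply: linear_sumf => J c x y.
by rewrite mcoef_linear scalerDl scalerA.
Qed.

Lemma coef_action_unit I J :
  coef_action (m I J) = \sum_K \sum_L tens (t I J K L) (m K L).
Proof.
rewrite /coef_action; under eq_bigr => X _.
  under eq_bigr => Y _ do rewrite mcoef_unit mulrC -scalerA [J == _]eq_sym [I == _]eq_sym.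
  rewrite sum_deltaZ.
over.
exact: sum_deltaZ.
Qed.

Lemma tcoef_action K L I J : tcoef m K L (coef_action (m I J)) = t I J K L.
Proof. by rewrite coef_action_unit tcoef_sum_unit. Qed.

Hypothesis tM : forall I J J' I' K M,
  \sum_L t I J K L * t J' I' L M = (J == J')%:R * t I I' K M.
Hypothesis t1 : forall K L, \sum_I t I I K L = (K == L)%:R.
Hypothesis tstar : forall I J K L, star (t I J K L) = t J I L K.

Lemma alg_hom_coef_action : alg_hom coef_action.
Proof.
have lc := coef_action_linear; split=> //.
  apply: (tcoef_ext (m := m)) => K L; rewrite -(munit1 m) (lin_sum lc).
  rewrite (lin_sum (tcoef_linear m K L)) tcoef_one -t1.
  by apply: eq_bigr => I _; rewrite tcoef_action.
have lR (y : tensor A B) : linear (fun x => x * y) by move=> c u v; rewrite mulrDl scalerAl.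
have lL (y : tensor A B) : linear (fun x => y * x) by move=> c u v; rewrite mulrDr scalerAr.
have lRB (y : B) : linear (fun x => x * y) by move=> c u v; rewrite mulrDl scalerAl.
have lLB (y : B) : linear (fun x => y * x) by move=> c u v; rewrite mulrDr scalerAr.
move=> x y; move: x; apply: (munit_lin_eq (m := m)) => [||I J].
- exact: linear_comp (lRB y) lc.
- exact: linear_comp lc (lR _).
move: y; apply: (munit_lin_eq (m := m)) => [||J' I'].
- exact: linear_comp (lLB _) lc.
- exact: linear_comp lc (lL _).
rewrite munitM (linZ lc); apply: (tcoef_ext (m := m)) => K M.
rewrite (linZ (tcoef_linear m K M)) tcoefM tcoef_action.
under eq_bigr => L _ do rewrite !tcoef_action.
by rewrite tM scaler_nat mulr_natl.
Qed.

Lemma coef_action_star : star_compatible coef_action.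
Proof.
have lc := coef_action_linear.
have l2 : linear (fun x => star (coef_action (star x))).
  by move=> c x y; rewrite starD starZ lc starD starZ conjCK.
suff h x : star (coef_action (star x)) = coef_action x by move=> x; rewrite -(h (star x)) starK.
move: x; apply: (munit_lin_eq (m := m)) => // I J.
apply: (tcoef_ext (m := m)) => K L.
by rewrite munit_star tcoef_star !tcoef_action tstar.
Qed.

End ActionOfCoefficients.

Definition is_coaction (H : cqgType C) (beta : B -> tensor H B) : Prop :=
  forall x, tassoc (tmap comul id (beta x)) = tmap id beta (beta x) /\
    tlift (fun a y => counit a *: y) (beta x) = x.

(** The trace is left unnormalised: the normalising factor cancels from both sides. *)
Definition trace_preserving (A : algType C) (beta : B -> tensor A B) : Prop :=
  forall x, \sum_K tcoef m K K (beta x) = mtrace x *: 1.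

Lemma counit_bil (H : cqgType C) :
  bilinear_map (fun (a : H) (y : B) => (counit a : C) *: y).
Proof.
split=> [y | a] c x z; first by rewrite linearP scalerDl scalerA.
by rewrite scalerDr !scalerA mulrC.
Qed.

Lemma comul_linear (H : cqgType C) : linear (@comul C H).
Proof. exact: linearP. Qed.

Section CoactionOfCoefficients.
Variables (H : cqgType C) (t : T -> T -> T -> T -> H).
Hypothesis tcomul : forall I J K L,
  comul (t I J K L) = \sum_M \sum_N tens (t I J M N) (t M N K L).
Hypothesis tcounit : forall I J K L, counit (t I J K L) = (I == K)%:R * (J == L)%:R.
Hypothesis ttrace : forall I J, \sum_K t I J K K = (I == J)%:R.

Lemma is_coaction_coef_action : is_coaction (coef_action t).
Proof.
have lc := coef_action_linear t.
have lcm := linear_tmap (comul_linear (H := H)) (@linear_id C B).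
have lid := linear_tmap (@linear_id C H) lc.
have las := @tassoc_linear C H H B.
have lcu := tlift_linear (counit_bil H).
move=> x; split; move: x; apply: (munit_lin_eq (m := m)) => [||I J].
- exact: linear_comp lc (linear_comp lcm las).
- exact: linear_comp lc lid.
- rewrite coef_action_unit (lin_sum lcm) (lin_sum las) (lin_sum lid).
  transitivity (\sum_K \sum_L \sum_M \sum_N tens (t I J M N) (tens (t M N K L) (m K L))).
    apply: eq_bigr => K _; rewrite (lin_sum lcm) (lin_sum las); apply: eq_bigr => L _.
    rewrite tmapE //; last exact: comul_linear.
    rewrite tcomul tens_suml (lin_sum las); apply: eq_bigr => M _.
    by rewrite tens_suml (lin_sum las); apply: eq_bigr => N _; rewrite tassocE.
  transitivity (\sum_K \sum_M \sum_N \sum_L tens (t I J M N) (tens (t M N K L) (m K L))).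
    apply: eq_bigr => K _; rewrite exchange_big /=; apply: eq_bigr => M _.
    exact: exchange_big.
  rewrite exchange_big /=; apply: eq_bigr => M _.
  rewrite (lin_sum lid) exchange_big /=; apply: eq_bigr => N _.
  rewrite tmapE // coef_action_unit tens_sumr; apply: eq_bigr => K _.
  by rewrite tens_sumr.
- exact: linear_comp lc lcu.
- exact: linear_id.
rewrite coef_action_unit (lin_sum lcu).
under eq_bigr => K _.
  rewrite (lin_sum lcu).
  under eq_bigr => L _ do
    rewrite (tlift_tens _ _ (counit_bil H)) tcounit mulrC -scalerA eq_sym.
  rewrite sum_deltaZ eq_sym.
over.
exact: sum_deltaZ.
Qed.

Lemma trace_preserving_coef_action : trace_preserving (coef_action t).
Proof.
have lc := coef_action_linear t.
apply: (munit_lin_eq (m := m)).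
- by apply: linear_sumf => K; exact: linear_comp lc (tcoef_linear m K K).
- by move=> c x y; rewrite (mtrace_linear c x y) scalerDl scalerA.
move=> I J; under eq_bigr => K _ do rewrite tcoef_action.
by rewrite ttrace mtrace_unit scaler_nat.
Qed.

End CoactionOfCoefficients.

Section CoefficientsOfAction.
Variables (H : cqgType C) (beta : B -> tensor H B).
Hypotheses (bhom : alg_hom beta) (bco : is_coaction beta) (btr : trace_preserving beta).
Let lb : linear beta. Proof. by case: bhom. Qed.
Let bM : {morph beta : x y / x * y}. Proof. by case: bhom. Qed.
Let t I J K L := tcoef m K L (beta (m I J)).

Lemma action_coefsM I J J' I' K M :
  \sum_L t I J K L * t J' I' L M = (J == J')%:R * t I I' K M.
Proof.
by rewrite /t -tcoefM -bM munitM (linZ lb) (linZ (tcoef_linear m K M)) scaler_nat mulr_natl.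
Qed.

Lemma action_coefs_trace I J : \sum_K t I J K K = (I == J)%:R.
Proof. by rewrite /t btr mtrace_unit scaler_nat. Qed.

Lemma action_coefs_comul I J K L :
  comul (t I J K L) = \sum_M \sum_N tens (t I J M N) (t M N K L).
Proof.
have lK := tcoef_linear m (H := H) K L.
have lcm := linear_tmap (comul_linear (H := H)) (@linear_id C B).
have lidK := linear_tmap (@linear_id C H) lK.
have lidb := linear_tmap (@linear_id C H) lb.
have las := @tassoc_linear C H H B.
have assocK (w : tensor (tensor H H) B) :
    tmap id (tcoef m K L) (tassoc w) = tcoef m K L w.
  move: w; apply: tensor_lin_eq => [||w y].
  - exact: linear_comp las lidK.
  - exact: tcoef_linear.
  rewrite tcoefE; move: w; apply: tensor_lin_eq => [||a b].
  - exact: linear_comp (linear_tensl y) (linear_comp las lidK).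
  - by move=> c u v; rewrite scalerDr !scalerA mulrC.
  by rewrite tassocE tmapE // tcoefE tensZr.
rewrite /t -(tcoef_tmap m K L _ (comul_linear (H := H))) -assocK (bco _).1.
rewrite {1}(tcoef_expand m (beta (m I J))) !(lin_sum lidb) (lin_sum lidK).
apply: eq_bigr => M _; rewrite (lin_sum lidb) (lin_sum lidK); apply: eq_bigr => N _.
by rewrite !tmapE.
Qed.

Lemma action_coefs_counit I J K L : counit (t I J K L) = (I == K)%:R * (J == L)%:R.
Proof.
have lcu := tlift_linear (counit_bil H).
rewrite -(mcoef_unit m) -(bco (m I J)).2 (tcoef_expand m (beta (m I J))).
rewrite (lin_sum lcu) (lin_sum (mcoef_linear m K L)).
under eq_bigr => X _.
  rewrite (lin_sum lcu) (lin_sum (mcoef_linear m K L)).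
  under eq_bigr => Y _.
    rewrite (tlift_tens _ _ (counit_bil H)) (linZ (mcoef_linear m K L)) mcoef_unit.
    rewrite /GRing.scale /= mulrC -mulrA mulrCA.
  over.
  rewrite /= sum_deltal.
over.
by rewrite /= sum_deltal.
Qed.

(** Multiplicativity and invariance of the trace give a right inverse of the matrix of coefficients,
    the antipode of H gives a left inverse, and the two must agree. The statement is that the right
    inverse is also a left inverse. *)
Lemma action_coefs_inverse K L M N :
  \sum_I \sum_J t I J K L * t J I M N = (L == M)%:R * (K == N)%:R.
Proof.
(* Rows and columns are indexed by pairs; y is the transpose of x with both pairs flipped. *)
pose x (p q : T * T) := t p.1 p.2 q.1 q.2.
pose y (p q : T * T) := t q.2 q.1 p.2 p.1.
pose s (p q : T * T) := antipode (x p q).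
have sx p q : \sum_r s p r * x r q = (p == q)%:R.
  have lS : linear (@antipode C H) by exact: linearP.
  have bS : bilinear_map (fun a b : H => antipode a * b).
    split=> [b | a] c u v; first by rewrite lS mulrDl scalerAl.
    by rewrite mulrDr scalerAr.
  have := antipodel (x p q); rewrite /x action_coefs_comul action_coefs_counit.
  rewrite (lin_sum (tlift_linear bS)) -natb_and scaler_nat.
  rewrite -[(p == q)]/((p.1 == q.1) && (p.2 == q.2)) => <-.
  under [RHS]eq_bigr => X _.
    rewrite (lin_sum (tlift_linear bS)).
    under eq_bigr => Y _ do rewrite tlift_tens //.
  over.
  by rewrite pair_big /=; apply: eq_bigr => -[].
have xy p q : \sum_r x p r * y r q = (p == q)%:R.
  rewrite -[(p == q)]/((p.1 == q.1) && (p.2 == q.2)) /x /y.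
  rewrite -(pair_big xpredT xpredT (fun k l => t p.1 p.2 k l * t q.2 q.1 l k)) /=.
  under eq_bigr => k _ do rewrite action_coefsM.
  by rewrite -mulr_sumr action_coefs_trace -natb_and andbC.
have := right_inverse_is_left sx xy (L, K) (M, N); rewrite /x /y /=.
rewrite -[(_ == _) in RHS]/((L == M) && (K == N)) natb_and => <-.
rewrite exchange_big /= pair_big /=.
by apply: eq_bigr => -[].
Qed.

Lemma tcoef_sandwich (A : algType C) (a b : tensor A B) K L N P :
  tcoef m K P (a * tens 1 (m L N) * b) = tcoef m K L a * tcoef m N P b.
Proof.
rewrite tcoefM (eq_bigr (fun Q => (Q == N)%:R * (tcoef m K L a * tcoef m Q P b))).
  exact: sum_deltal.
move=> Q _; rewrite tcoefM eq_sym mulrA; congr (_ * _).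
rewrite (bigD1 L) //= big1 => [|R /negPf RL].
  by rewrite tcoef_unit eqxx scale1r addr0 scaler_nat mulr_natl mulr_natr.
by rewrite tcoef_unit eq_sym RL scale0r mulr0.
Qed.

(** By [action_coefs_inverse], averaging 1 (x) x over the images of all units gives its trace
    ([full] below); multiplying on the left by one image isolates a single row of this double
    sum. *)
Lemma action_sandwich M M' (x : B) :
  \sum_J beta (m M J) * tens 1 x * beta (m J M') = mtrace x *: beta (m M M').
Proof.
have lL : linear (fun x => \sum_J beta (m M J) * tens 1 x * beta (m J M')).
  apply: linear_sumf => J c u v; rewrite linear_tensr mulrDr mulrDl.
  by rewrite -scalerAr -scalerAl.
move: x; apply: (munit_lin_eq (m := m)) => [//||L N].
  by move=> c u v; rewrite mtrace_linear scalerDl scalerA.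
have full : \sum_I \sum_J beta (m I J) * tens 1 (m L N) * beta (m J I) =
    (L == N)%:R *: 1.
  apply: (tcoef_ext (m := m)) => K P; rewrite (lin_sum (tcoef_linear m K P)).
  rewrite (linZ (tcoef_linear m K P)) tcoef_one scaler_nat.
  rewrite -[RHS]mulr_natl -action_coefs_inverse.
  apply: eq_bigr => I _; rewrite (lin_sum (tcoef_linear m K P)); apply: eq_bigr => J _.
  exact: tcoef_sandwich.
transitivity (\sum_I \sum_J (I == M')%:R *: (beta (m M J) * tens 1 (m L N) * beta (m J I))).
  under [RHS]eq_bigr => I _ do rewrite -scaler_sumr.
  by rewrite sum_deltaZ.
rewrite mtrace_unit -[X in _ *: X]mulr1 scalerAr -full mulr_sumr; apply: eq_bigr => I _.
rewrite mulr_sumr; apply: eq_bigr => J _.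
by rewrite !mulrA -bM munitM (linZ lb) -!scalerAl eq_sym.
Qed.

End CoefficientsOfAction.
End CoefficientActions.

Lemma mtrace_tens (C : numClosedFieldType) (A D : starAlgType C) (S R : finType) (mA : matunits A S)
    (mD : matunits D R) x y :
  mtrace (tens_matunits mA mD) (tens x y) = mtrace mA x * mtrace mD y.
Proof.
rewrite /mtrace -(pair_big xpredT xpredT (fun i j =>
  tens_coef mA mD (i, j) (i, j) (tens x y))) /= mulr_suml; apply: eq_bigr => i _.
by rewrite mulr_sumr; apply: eq_bigr => j _; rewrite tens_coefE.
Qed.

Definition invariant_action (C : numClosedFieldType) (B : starAlgType C) (T : finType)
    (m : matunits B T) (H : cqgType C) (beta : B -> tensor H B) : Prop :=
  [/\ alg_hom beta, star_compatible beta, is_coaction beta & trace_preserving m beta].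

Definition tens_one_r (C : numClosedFieldType) (B D : algType C) (x : B) : tensor B D :=
  tens x 1.

Lemma alg_hom_tens_one_r (C : numClosedFieldType) (B D : algType C) :
  alg_hom (@tens_one_r C B D).
Proof.
split=> [||x y]; [exact: linear_tensl | exact: tens1 |].
by rewrite /tens_one_r tensM mulr1.
Qed.

Lemma exchange_big_pairs (V : nmodType) (S T : finType) (F : S -> S -> T -> T -> V) :
  \sum_P \sum_Q \sum_I \sum_J F P Q I J = \sum_I \sum_J \sum_P \sum_Q F P Q I J.
Proof.
rewrite (pair_big xpredT xpredT (fun P Q => \sum_I \sum_J F P Q I J)) /=.
rewrite (pair_big xpredT xpredT (fun I J => \sum_P \sum_Q F P Q I J)) /=.
under eq_bigr => p _ do rewrite (pair_big xpredT xpredT (F p.1 p.2)) /=.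
under [RHS]eq_bigr => q _ do
  rewrite (pair_big xpredT xpredT (fun P Q => F P Q q.1 q.2)) /=.
exact: exchange_big.
Qed.

Lemma card_matunits_neq0 (C : numClosedFieldType) (B : starAlgType C) (T : finType) :
  matunits B T -> (#|T|%:R : C) != 0.
Proof.
move=> m; rewrite pnatr_eq0 -lt0n; apply/card_gt0P.
case: (pickP (@predT T)) => [x _|T0]; first by exists x.
by have := munit1 m; rewrite big_pred0 // => /esym/eqP; rewrite oner_eq0.
Qed.

Section LinearMultiplication.
Variables (C : numClosedFieldType) (A : algType C).

Lemma linear_mulr (y : A) : linear (fun x => x * y).
Proof. by move=> c u v; rewrite mulrDl scalerAl. Qed.
Lemma linear_mull (y : A) : linear (fun x => y * x).
Proof. by move=> c u v; rewrite mulrDr scalerAr. Qed.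
Lemma linear_scale (V : lmodType C) (f : A -> V) (c : C) :
  linear f -> linear (fun x => c *: f x).
Proof. by move=> lf d u v; rewrite lf scalerDr !scalerA mulrC. Qed.

End LinearMultiplication.

Section McoefMultiplication.
Variables (C : numClosedFieldType) (B : starAlgType C) (T : finType) (m : matunits B T).

Lemma mcoef_mull K L I J (x : B) :
  mcoef m K L (m I J * x) = (I == K)%:R *: mcoef m J L x.
Proof.
move: x; apply: (munit_lin_eq (m := m)) => [||X Y].
- exact: linear_comp (linear_mull _) (mcoef_linear m K L).
- exact: linear_scale (mcoef_linear m J L).
rewrite munitM (linZ (mcoef_linear m K L)) !mcoef_unit /GRing.scale /= eq_sym.
by rewrite mulrCA.
Qed.

Lemma mcoef_mulr K L I J (x : B) :
  mcoef m K L (x * m I J) = (J == L)%:R *: mcoef m K I x.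
Proof.
move: x; apply: (munit_lin_eq (m := m)) => [||X Y].
- exact: linear_comp (linear_mulr _) (mcoef_linear m K L).
- exact: linear_scale (mcoef_linear m K I).
rewrite munitM (linZ (mcoef_linear m K L)) !mcoef_unit /GRing.scale /=.
by rewrite mulrC mulrAC mulrC.
Qed.

End McoefMultiplication.

(** * Adding one tensor factor to an action *)

Section Amplification.
Variables (C : numClosedFieldType) (B D : starAlgType C) (S T : finType).
Variables (mB : matunits B S) (mD : matunits D T) (H : algType C).
Local Notation BD := (tensor B D).
Local Notation mBD := (tens_matunits mB mD).

Definition up : tensor H B -> tensor H BD := tmap id (@tens_one_r C B D).
Lemma up_hom : alg_hom up.
Proof. exact: alg_hom_tmap (alg_hom_id H) (alg_hom_tens_one_r B D). Qed.
Lemma up_last (w : tensor H B) (y : D) :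
  up w * tens 1 (tens 1 y) = tens 1 (tens 1 y) * up w.
Proof.
have lup : linear up by case: up_hom.
move: w; apply: tensor_lin_eq => [||a b].
- exact: linear_comp lup (linear_mulr _).
- exact: linear_comp lup (linear_mull _).
rewrite /up tmapE //; last exact: linear_tensl.
by rewrite !tensM !mulr1 !mul1r.
Qed.

Lemma tcoef_up K L a a' (w : tensor H B) :
  tcoef mBD (K, a) (L, a') (up w) = (a == a')%:R * tcoef mB K L w.
Proof.
have lup : linear up by case: up_hom.
have l1 := tcoef_linear mBD (H := H) (K, a) (L, a').
have l2 := tcoef_linear mB (H := H) K L.
move: w; apply: tensor_lin_eq => [||h b].
- exact: linear_comp lup l1.
- by move=> c u v; rewrite l2 mulrDr scalerAr.
rewrite /up tmapE //; last exact: linear_tensl.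
rewrite !tcoefE /= tens_coefE /= -(munit1 mD) (lin_sum (mcoef_linear mD a a')).
under eq_bigr => i _ do rewrite mcoef_unit.
by rewrite sum_deltal mulrC -scalerA scaler_nat mulr_natl.
Qed.

End Amplification.

Section TowerStep.
Variables (C : numClosedFieldType) (B D : starAlgType C) (S T : finType).
Variables (mB : matunits B S) (mD : matunits D T) (H : cqgType C).
Local Notation BD := (tensor B D).
Local Notation mBD := (tens_matunits mB mD).
Variables (beta : B -> tensor H B) (beta2 : BD -> tensor H BD).
Hypotheses (bN : invariant_action mB beta) (b2N : invariant_action mBD beta2).

Hypothesis tower : forall x, beta2 (tens x 1) = up D (beta x).

Let gam (y : D) := beta2 (tens 1 y).
Let lb : linear beta. Proof. by case: bN => -[]. Qed.
Let lb2 : linear beta2. Proof. by case: b2N => -[]. Qed.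
Let b2M : {morph beta2 : x y / x * y}. Proof. by case: b2N => -[]. Qed.

Let lup : linear (@up C B D H). Proof. by case: (up_hom B D H). Qed.
Let upM : {morph (@up C B D H) : x y / x * y}. Proof. by case: (up_hom B D H). Qed.

(** A partial trace over the last factor. Let z be the difference of the two sides, a matrix over H.
    Pairing z with the coefficients of [beta] compares the trace of the image of a product tensor
    under [beta2] with a product of traces, and gives 0 because both actions preserve the trace.
    Those coefficients are invertible, so z = 0. *)
Lemma slice_trace (y : D) K L :
  \sum_a tcoef mBD (K, a) (L, a) (gam y) = ((K == L)%:R * mtrace mD y) *: 1.
Proof.
case: (bN) => bhom _ bco btr; case: (b2N) => b2hom _ b2co b2tr.
pose z K L := \sum_a tcoef mBD (K, a) (L, a) (gam y) - ((K == L)%:R * mtrace mD y) *: 1.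
suff z0 : z K L = 0 by apply/eqP; rewrite -subr_eq0 -/(z K L) z0.
pose t I J K L := tcoef mB K L (beta (mB I J)).
have zt I J : \sum_P \sum_Q z P Q * t I J Q P = 0.
  have -> : \sum_P \sum_Q z P Q * t I J Q P =
      \sum_X tcoef mBD X X (gam y * beta2 (tens (mB I J) 1)) -
      \sum_P mtrace mD y *: t I J P P.
    rewrite -(pair_big xpredT xpredT (fun P a => tcoef mBD (P, a) (P, a)
      (gam y * beta2 (tens (mB I J) 1)))) /= -sumrB; apply: eq_bigr => P _.
    under eq_bigr => Q _ do rewrite mulrBl.
    rewrite sumrB; congr (_ - _).
      under [RHS]eq_bigr => a _.
        rewrite tcoefM tower.
        rewrite -(pair_big xpredT xpredT (fun Q b => tcoef mBD (P, a) (Q, b) (gam y) *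
           tcoef mBD (Q, b) (P, a) (up D (beta (mB I J))))) /=.
        under eq_bigr => Q _.
          under eq_bigr => b _ do rewrite tcoef_up mulrA mulr_natr -mulr_natl -mulrA.
          rewrite sum_deltal.
        over.
      over.
      rewrite /= exchange_big /=; apply: eq_bigr => Q _.
      by rewrite mulr_suml.
    rewrite (eq_bigr (fun Q => (Q == P)%:R * (mtrace mD y *: t I J Q P))).
      by rewrite sum_deltal.
    by move=> Q _; rewrite -scalerAl mul1r -scalerA scaler_nat mulr_natl eq_sym.
  rewrite -scaler_sumr (btr (mB I J)) mtrace_unit -b2M tensM mul1r mulr1 (b2tr _).
  rewrite mtrace_tens mtrace_unit.
  by rewrite scalerA mulrC subrr.
have inv := action_coefs_inverse bhom bco btr.
(* The Kronecker symbols are then expanded by [inv], which makes the vanishing pairing [zt] appear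
   as a factor. *)
transitivity (\sum_P \sum_Q z P Q * ((P == K)%:R * (Q == L)%:R)).
  under eq_bigr => P _.
    under eq_bigr => Q _ do rewrite mulrA.
    rewrite sum_deltar.
  over.
  by rewrite /= sum_deltar.
transitivity (\sum_I \sum_J (\sum_P \sum_Q z P Q * t I J Q P) * t J I K L); last first.
  by apply: big1 => I _; apply: big1 => J _; rewrite zt mul0r.
transitivity (\sum_P \sum_Q \sum_I \sum_J z P Q * t I J Q P * t J I K L).
  apply: eq_bigr => P _; apply: eq_bigr => Q _; rewrite -inv mulr_sumr.
  by apply: eq_bigr => I _; rewrite mulr_sumr; apply: eq_bigr => J _; rewrite mulrA.
rewrite exchange_big_pairs; apply: eq_bigr => I _; apply: eq_bigr => J _.
by rewrite mulr_suml; apply: eq_bigr => P _; rewrite mulr_suml.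
Qed.

Lemma tcoef_last_legl K a X c d (w : tensor H BD) :
  tcoef mBD (K, a) X (tens 1 (tens 1 (mD c d)) * w) =
    (c == a)%:R *: tcoef mBD (K, d) X w.
Proof.
move: w; apply: tensor_lin_eq => [||h z].
- exact: linear_comp (linear_mull _) (tcoef_linear mBD _ _).
- exact: linear_scale (tcoef_linear mBD _ _).
rewrite tensM mul1r !tcoefE scalerA; congr (_ *: _).
move: z; apply: (tensor_lin_eq (V := C^o)) => [||b y].
- exact: linear_comp (linear_mull _) (mcoef_linear mBD _ _).
- exact: linear_scale (mcoef_linear mBD _ _).
by rewrite tensM mul1r /= !tens_coefE /= mcoef_mull mulrCA.
Qed.

Lemma tcoef_last_legr X L a c d (w : tensor H BD) :
  tcoef mBD X (L, a) (w * tens 1 (tens 1 (mD c d))) =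
    (d == a)%:R *: tcoef mBD X (L, c) w.
Proof.
move: w; apply: tensor_lin_eq => [||h z].
- exact: linear_comp (linear_mulr _) (tcoef_linear mBD _ _).
- exact: linear_scale (tcoef_linear mBD _ _).
rewrite tensM mulr1 !tcoefE scalerA; congr (_ *: _).
move: z; apply: (tensor_lin_eq (V := C^o)) => [||b y].
- exact: linear_comp (linear_mulr _) (mcoef_linear mBD _ _).
- exact: linear_scale (mcoef_linear mBD _ _).
by rewrite tensM mulr1 /= !tens_coefE /= mcoef_mulr mulrCA.
Qed.

(** In terms of coefficients, the sum on the left takes the partial trace of [gam y] over the last
    factor, evaluated by [slice_trace]. This is the source of the relation [ege] of the ladder. *)
Lemma last_leg_sandwich_gam (c c' : T) (y : D) :
  \sum_a tens 1 (tens 1 (mD c a)) * gam y * tens 1 (tens 1 (mD a c')) =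
    mtrace mD y *: tens 1 (tens 1 (mD c c')).
Proof.
apply: (tcoef_ext (m := mBD)) => -[K a0] [L a1].
rewrite (lin_sum (tcoef_linear mBD _ _)) (linZ (tcoef_linear mBD _ _)).
under eq_bigr => a _ do rewrite tcoef_last_legr tcoef_last_legl.
rewrite -!scaler_sumr slice_trace.
rewrite tcoefE /= tens_coefE /= mcoef_unit -[in RHS](munit1 mB).
rewrite (lin_sum (mcoef_linear mB K L)).
under [in RHS]eq_bigr => I _ do rewrite mcoef_unit.
rewrite sum_deltal !scalerA; congr (_ *: _).
rewrite [RHS]mulrC !mulrA; congr (_ * _).
by rewrite mulrC mulrA [in RHS]mulrAC mulrAC; congr (_ * _); rewrite mulrC.
Qed.

(** [action_sandwich] for [beta2] involves the units of all of B (x) D. In the sum over the units of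
    B their images commute with the last factor and contribute card S times 1; on the other side
    card S is the trace of 1 in B, and the two cancel. This is the source of [geg]. *)
Lemma gam_sandwich_last_leg (c c' : T) (x : D) :
  \sum_b gam (mD c b) * tens 1 (tens 1 x) * gam (mD b c') =
    mtrace mD x *: gam (mD c c').
Proof.
case: (b2N) => b2hom _ b2co b2tr; case: (bN) => -[_ b1 bM] _ _ _.
have bE M J a b : beta2 (mBD (M, a) (J, b)) = up D (beta (mB M J)) * gam (mD a b).
  by rewrite -tower -b2M tensM mulr1 mul1r.
have bE' M J a b : beta2 (mBD (M, a) (J, b)) = gam (mD a b) * up D (beta (mB M J)).
  by rewrite -tower -b2M tensM mulr1 mul1r.
apply: (scalerI (card_matunits_neq0 mB)).
transitivity (\sum_M \sum_X beta2 (mBD (M, c) X) * tens 1 (tens 1 x) *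
    beta2 (mBD X (M, c'))).
  under [RHS]eq_bigr => M _.
    rewrite -(pair_big xpredT xpredT (fun J b => beta2 (mBD (M, c) (J, b)) *
      tens 1 (tens 1 x) * beta2 (mBD (J, b) (M, c')))) /= exchange_big /=.
    under eq_bigr => b _.
      under eq_bigr => J _ do
        rewrite bE' bE -!mulrA (mulrA (up _ _) (tens _ _)) up_last !mulrA
          -[_ * up _ _ * up _ _]mulrA -upM -bM munitM eqxx scale1r.
      rewrite /=.
    over.
  over.
  rewrite /= exchange_big /=.
  rewrite scaler_sumr; apply: eq_bigr => b _.
  under [RHS]eq_bigr => M _ do rewrite sumr_const -scaler_nat.
  rewrite -scaler_sumr -mulr_suml -mulr_sumr -(lin_sum lup) -(lin_sum lb) munit1 b1.
  by have [_ -> _] := up_hom B D H; rewrite mulr1.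
under eq_bigr => M _ do rewrite (action_sandwich b2hom b2co b2tr).
rewrite -scaler_sumr -(lin_sum lb2).
rewrite (_ : \sum_(M : S) mBD (M, c) (M, c') = tens 1 (mD c c')); last first.
  by rewrite -(munit1 mB) tens_suml.
rewrite scalerA mtrace_tens; congr (_ * _ *: _).
rewrite -(munit1 mB) (lin_sum (mtrace_linear mB)).
under eq_bigr => I _ do rewrite mtrace_unit eqxx.
by rewrite sumr_const.
Qed.

End TowerStep.

(** * Biunitary matrices and their dilation *)

(** The first two conditions read v v^* = F and v^* v = E for the matrix v; the last two say the
    same of its entrywise adjoint, with E and F exchanged. *)
Definition partial_biunitary (C : numClosedFieldType) (A : starAlgType C) (T : finType)
    (v : T -> T -> A) (F E : A) : Prop :=
  [/\ forall a c, \sum_b v a b * star (v c b) = (a == c)%:R *: F,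
      forall a c, \sum_b star (v b a) * v b c = (a == c)%:R *: E,
      forall a c, \sum_b v b a * star (v b c) = (a == c)%:R *: F &
      forall a c, \sum_b star (v a b) * v c b = (a == c)%:R *: E].

Definition biunitary (C : numClosedFieldType) (A : starAlgType C) (T : finType)
    (v : T -> T -> A) : Prop := partial_biunitary v 1 1.

Definition projection (C : numClosedFieldType) (A : starAlgType C) (p : A) : Prop :=
  p * p = p /\ star p = p.

Section Dilation.
Variables (C : numClosedFieldType) (A : starAlgType C) (T : finType).
Variables (v : T -> T -> A) (F E : A).
Hypotheses (vP : partial_biunitary v F E) (Fp : projection F) (Ep : projection E).
Hypotheses (Fv : forall a b, F * v a b = v a b) (vE : forall a b, v a b * E = v a b).

Local Notation e00 := (delta_mx 0 0 : 'M[C]_2).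
Local Notation e01 := (delta_mx 0 1 : 'M[C]_2).
Local Notation e10 := (delta_mx 1 0 : 'M[C]_2).
Local Notation e11 := (delta_mx 1 1 : 'M[C]_2).

(* Halmos' unitary dilation, with the entrywise adjoint in the second corner. *)
Definition dilation (a b : T) : tensor A 'M[C]_2 :=
  tens (v a b) e00 + tens ((a == b)%:R *: (1 - F)) e01 +
  (tens ((a == b)%:R *: (1 - E)) e10 + tens (star (v a b)) e11).

Let FC : (1 - F) * (1 - F) = 1 - F.
Proof. by rewrite mulrBr mulr1 mulrBl mul1r Fp.1 subrr subr0. Qed.
Let EC : (1 - E) * (1 - E) = 1 - E.
Proof. by rewrite mulrBr mulr1 mulrBl mul1r Ep.1 subrr subr0. Qed.
Let sFC : star (1 - F) = 1 - F. Proof. by rewrite starB star1 Fp.2. Qed.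
Let sEC : star (1 - E) = 1 - E. Proof. by rewrite starB star1 Ep.2. Qed.
Let FCv a b : (1 - F) * v a b = 0. Proof. by rewrite mulrBl mul1r Fv subrr. Qed.
Let vEC a b : v a b * (1 - E) = 0. Proof. by rewrite mulrBr mulr1 vE subrr. Qed.
Let svFC a b : star (v a b) * (1 - F) = 0.
Proof. by rewrite -[LHS]starK starM starK sFC FCv star0. Qed.
Let ECsv a b : (1 - E) * star (v a b) = 0.
Proof. by rewrite -[LHS]starK starM starK sEC vEC star0. Qed.

Let m2 := matrix_matunits C 1.

Lemma star_dilation a b : star (dilation a b) =
  tens (star (v a b)) e00 + tens ((a == b)%:R *: (1 - F)) e10 +
  (tens ((a == b)%:R *: (1 - E)) e01 + tens (v a b) e11).
Proof.
rewrite /dilation !starD !star_tens !(munit_star m2) !starZ sFC sEC starK.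
by rewrite rmorph_nat.
Qed.

Lemma mx2M (x y : A) (i j k l : 'I_2) :
  tens x (delta_mx i j : 'M[C]_2) * tens y (delta_mx k l) =
  (j == k)%:R *: tens (x * y) (delta_mx i l).
Proof. by rewrite tensM (munitM m2) tensZr. Qed.

Lemma one_mx2 (c : C) : tens (c *: (1 : A)) e00 + tens (c *: (1 : A)) e11 = c *: 1.
Proof.
rewrite !tensZl -scalerDr; congr (_ *: _); rewrite -tens1 -tensDr; congr tens.
rewrite -(munit1 m2) big_ord_recl big_ord1; congr (delta_mx _ _ + delta_mx _ _);
  exact: val_inj.
Qed.

(** Mixed products vanish because F v = v = v E, and on the diagonal F and E meet their complements.
    As the entrywise adjoint exchanges F and E, each identity uses two of the four relations for v,
    one in each corner. *)
Lemma dilation_biunitary : biunitary dilation.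
Proof.
case: vP => vv1 vv2 vv3 vv4.
have d0 : (0 == 1 :> 'I_2) = false by [].
have d1 : (1 == 0 :> 'I_2) = false by [].
have q0 : (1 == 1 :> 'I_2) = true by [].
have qq : (0 == 0 :> 'I_2) = true by [].
have s2 (G : A) a c : \sum_b (a == b)%:R *: ((c == b)%:R *: G) = (a == c)%:R *: G.
  under eq_bigr => b _ do rewrite [a == b]eq_sym.
  by rewrite sum_deltaZ eq_sym.
have s3 (G : A) a c : \sum_b (b == a)%:R *: ((b == c)%:R *: G) = (a == c)%:R *: G.
  by rewrite sum_deltaZ.
have fin (d : C) : tens (d *: F) e00 + tens (d *: (1 - F)) e00 +
    (tens (d *: (1 - E)) e11 + tens (d *: E) e11) = d%:A.
  by rewrite -!tensDl -!scalerDr addrC [F + _]addrC !subrK addrC one_mx2.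
have fin' (d : C) : tens (d *: E) e00 + tens (d *: (1 - E)) e00 +
    (tens (d *: (1 - F)) e11 + tens (d *: F) e11) = d%:A.
  by rewrite -!tensDl -!scalerDr addrC [E + _]addrC !subrK addrC one_mx2.
split=> a c.
- under eq_bigr => b _ do rewrite star_dilation /dilation
    !(mulrDl, mulrDr) !mx2M d0 d1 q0 qq !(scale0r, scale1r, addr0, add0r)
    -!scalerAl -!scalerAr FCv vEC svFC ECsv FC EC !scaler0 !tens0l !(addr0, add0r).
  by rewrite /= !big_split /= -!tens_suml vv1 vv4 !s2 fin.
- under eq_bigr => b _ do rewrite star_dilation /dilation
    !(mulrDl, mulrDr) !mx2M d0 d1 q0 qq !(scale0r, scale1r, addr0, add0r)
    -!scalerAl -!scalerAr FCv vEC svFC ECsv FC EC !scaler0 !tens0l !(addr0, add0r).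
  by rewrite /= !big_split /= -!tens_suml vv2 vv3 !s3 addrACA fin'.
- under eq_bigr => b _ do rewrite star_dilation /dilation
    !(mulrDl, mulrDr) !mx2M d0 d1 q0 qq !(scale0r, scale1r, addr0, add0r)
    -!scalerAl -!scalerAr FCv vEC svFC ECsv FC EC !scaler0 !tens0l !(addr0, add0r).
  by rewrite /= !big_split /= -!tens_suml vv3 vv2 !s3 fin.
- under eq_bigr => b _ do rewrite star_dilation /dilation
    !(mulrDl, mulrDr) !mx2M d0 d1 q0 qq !(scale0r, scale1r, addr0, add0r)
    -!scalerAl -!scalerAr FCv vEC svFC ECsv FC EC !scaler0 !tens0l !(addr0, add0r).
  by rewrite /= !big_split /= -!tens_suml vv4 vv1 !s2 addrACA fin'.
Qed.

End Dilation.

(** * Commuting projections and the ladder of levels *)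

Section Projections.
Variables (C : numClosedFieldType) (A : starAlgType C).

Lemma projection1 : projection (1 : A).
Proof. by split; rewrite ?mulr1 ?star1. Qed.

Lemma projectionM (p q : A) : projection p -> projection q -> GRing.comm p q ->
  projection (p * q).
Proof.
move=> [pp sp] [qq sq] pq; split; last by rewrite starM sp sq -pq.
by rewrite mulrA -[p * q * p]mulrA -pq mulrA pp -mulrA qq.
Qed.

Lemma projection_prod (I : eqType) (s : seq I) (F : I -> A) :
  (forall i, i \in s -> projection (F i)) ->
  {in s &, forall i j, GRing.comm (F i) (F j)} -> projection (\prod_(i <- s) F i).
Proof.
elim: s => [|i s IH] pF cF; first by rewrite big_nil; exact: projection1.
rewrite big_cons; apply: projectionM.
- by apply: pF; rewrite mem_head.
- apply: IH => [j js | j l js ls]; first by apply: pF; rewrite inE js orbT.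
  by apply: cF; rewrite inE ?js ?ls orbT.
- rewrite big_seq; apply: commr_prod => j js.
  by apply: cF; rewrite inE ?eqxx ?js ?orbT.
Qed.

End Projections.

(* Below, e i are the matrix units of the i-th tensor factor and g i their images
   under an action. The relations ege and geg come from the invariance of the
   trace and from the antipode; they make lad_v i, which goes from level i.+1 to
   level i, unitary together with its entrywise adjoint. *)
Section Ladder.
Variables (C : numClosedFieldType) (D : starAlgType C) (T : finType) (o : T) (k : nat).
Variables e g : nat -> T -> T -> D.

Definition unit_system (f : T -> T -> D) : Prop :=
  [/\ forall a b c d, f a b * f c d = (b == c)%:R *: f a d,
      \sum_a f a a = 1 & forall a b, star (f a b) = f b a].

Hypothesis eU : forall i, (i < k)%N -> unit_system (e i).
Hypothesis gU : forall i, (i < k)%N -> unit_system (g i).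
Hypothesis eC : forall i j a b c d, (i < k)%N -> (j < k)%N -> i != j ->
  GRing.comm (e i a b) (e j c d).
Hypothesis gC : forall i j a b c d, (i < k)%N -> (j < k)%N -> i != j ->
  GRing.comm (g i a b) (g j c d).
(** Only i < j is available: [g i] involves the factors up to the i-th one. At i = j the relations
    [ege] and [geg] take the place of commutation. *)
Hypothesis geC : forall i j a b c d, (i < j < k)%N -> GRing.comm (g i a b) (e j c d).
Hypothesis ege : forall i c b d c', (i < k)%N ->
  \sum_a e i c a * g i b d * e i a c' = (b == d)%:R *: e i c c'.
Hypothesis geg : forall i c a a' c', (i < k)%N ->
  \sum_b g i c b * e i a a' * g i b c' = (a == a')%:R *: g i c c'.

Definition lad_p i := \prod_(0 <= j < i) g j o o.
Definition lad_r i := \prod_(i <= j < k) e j o o.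
(** The common part of [lad_P i] and [lad_P i.+1], which differ by having [e i o o] or [g i o o] in
    position i. It commutes with the units [e i] and [g i], so cutting down by it keeps their
    relations. *)
Definition lad_q i := lad_p i * lad_r i.+1.
Definition lad_P i := lad_p i * lad_r i.
Definition lad_v i a b := lad_q i * (e i o a * g i b o).

Lemma lad_pC i x : (i <= k)%N ->
  (forall j, (j < i)%N -> GRing.comm x (g j o o)) -> GRing.comm x (lad_p i).
Proof.
move=> ik xc; rewrite /lad_p big_seq; apply: commr_prod => j.
by rewrite mem_index_iota => /andP[_ ji]; exact: xc.
Qed.

Lemma lad_rC i x : (forall j, (i <= j < k)%N -> GRing.comm x (e j o o)) ->
  GRing.comm x (lad_r i).
Proof.
move=> xc; rewrite /lad_r big_seq; apply: commr_prod => j.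
by rewrite mem_index_iota; exact: xc.
Qed.

Lemma lad_p_e i a b : (i < k)%N -> GRing.comm (e i a b) (lad_p i).
Proof.
move=> ik; apply: lad_pC => [|j ji]; first exact: ltnW.
by apply/commr_sym/geC; rewrite ji ik.
Qed.

Lemma lad_p_g i a b : (i < k)%N -> GRing.comm (g i a b) (lad_p i).
Proof.
move=> ik; apply: lad_pC => [|j ji]; first exact: ltnW.
by apply: gC; rewrite ?ik ?(ltn_trans ji ik) // eq_sym ltn_eqF.
Qed.

Lemma lad_r_e i a b : (i < k)%N -> GRing.comm (e i a b) (lad_r i.+1).
Proof. by move=> ik; apply: lad_rC => j /andP[ij jk]; apply: eC; rewrite ?ltn_eqF. Qed.

Lemma lad_r_g i a b : (i < k)%N -> GRing.comm (g i a b) (lad_r i.+1).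
Proof. by move=> ik; apply: lad_rC => j ijk; exact: geC. Qed.

Lemma lad_pr i l : (i <= l <= k)%N -> GRing.comm (lad_p i) (lad_r l).
Proof.
move=> /andP[il lk]; apply: lad_rC => j /andP[lj jk].
apply/commr_sym/lad_pC => [|j' j'i]; first exact: leq_trans lk.
by apply/commr_sym/geC; rewrite jk (leq_trans j'i) // (leq_trans il).
Qed.

Lemma unit_projection (f : T -> T -> D) : unit_system f -> projection (f o o).
Proof. by move=> [fM _ fs]; split; rewrite ?fM ?eqxx ?scale1r ?fs. Qed.

Lemma projection_p i : (i <= k)%N -> projection (lad_p i).
Proof.
move=> ik; apply: projection_prod => [j|j l]; rewrite !mem_index_iota.
  by move=> /andP[_ ji]; apply/unit_projection/gU/(leq_trans ji).
move=> /andP[_ ji] /andP[_ li].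
have [->|jl] := eqVneq j l; first by [].
by apply: gC => //; exact: leq_trans ik.
Qed.

Lemma projection_r i : projection (lad_r i).
Proof.
apply: projection_prod => [j|j l]; rewrite !mem_index_iota.
  by move=> /andP[_ ji]; exact/unit_projection/eU.
move=> /andP[_ ji] /andP[_ li].
have [->|jl] := eqVneq j l; first by [].
exact: eC.
Qed.

Lemma projection_q i : (i < k)%N -> projection (lad_q i).
Proof.
move=> ik; apply: projectionM (projection_p (ltnW ik)) (projection_r _) _.
by apply: lad_pr; rewrite leqnSn.
Qed.

Lemma projection_P i : (i <= k)%N -> projection (lad_P i).
Proof.
move=> ik; apply: projectionM (projection_p ik) (projection_r _) _.
by apply: lad_pr; rewrite leqnn.
Qed.

Lemma lad_q_e i a b : (i < k)%N -> GRing.comm (e i a b) (lad_q i).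
Proof. by move=> ik; apply: commrM; [exact: lad_p_e | exact: lad_r_e]. Qed.

Lemma lad_q_g i a b : (i < k)%N -> GRing.comm (g i a b) (lad_q i).
Proof. by move=> ik; apply: commrM; [exact: lad_p_g | exact: lad_r_g]. Qed.

Lemma lad_r_split i : (i < k)%N -> lad_r i = e i o o * lad_r i.+1.
Proof. by move=> ik; rewrite /lad_r big_ltn. Qed.

Lemma lad_p_split i : lad_p i.+1 = lad_p i * g i o o.
Proof. by rewrite /lad_p big_nat_recr. Qed.

Lemma lad_P_e i : (i < k)%N -> lad_P i = lad_q i * e i o o.
Proof. by move=> ik; rewrite /lad_P lad_r_split // (lad_r_e _ _ ik) mulrA. Qed.

Lemma lad_P_g i : (i < k)%N -> lad_P i.+1 = lad_q i * g i o o.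
Proof. by move=> ik; rewrite /lad_P lad_p_split -!mulrA (lad_r_g _ _ ik). Qed.

Lemma lad_qM i x y : (i < k)%N -> GRing.comm (lad_q i) x ->
  lad_q i * x * (lad_q i * y) = lad_q i * (x * y).
Proof.
move=> ik qx; have [qq _] := projection_q ik.
by rewrite mulrA -[_ * x * _]mulrA -qx mulrA qq mulrA.
Qed.

Lemma lad_q_w i a b : (i < k)%N -> GRing.comm (lad_q i) (e i o a * g i b o).
Proof.
by move=> ik; apply/commrM; apply/commr_sym; [exact: lad_q_e | exact: lad_q_g].
Qed.

(** The projection [lad_q i] factors out of every sum. What remains is, for the first two
    identities, that diagonal units add up to 1, and for the last two, [ege] and [geg]. *)
Lemma lad_v_biunitary i : (i < k)%N ->
  partial_biunitary (lad_v i) (lad_P i) (lad_P i.+1).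
Proof.
move=> ik; have [qq sq] := projection_q ik.
have [eM e1 es] := eU ik; have [gM g1 gs] := gU ik.
have qw a b := @lad_q_w i a b ik.
have qsw a b : GRing.comm (lad_q i) (g i o b * e i a o).
  by apply/commrM; apply/commr_sym; [exact: lad_q_g | exact: lad_q_e].
have qxy x y := @lad_qM i x y ik.
have sv a b : star (lad_v i a b) = lad_q i * (g i o b * e i a o).
  by rewrite /lad_v starM sq starM es gs qsw.
have mv a b c d : lad_v i a b * star (lad_v i c d) =
    lad_q i * (e i o a * g i b d * e i c o).
  rewrite sv qxy //; congr (_ * _).
  by rewrite mulrA -[e i o a * _ * g i o d]mulrA gM eqxx scale1r.
have mv' a b c d : star (lad_v i a b) * lad_v i c d =
    lad_q i * (g i o b * e i a c * g i d o).
  rewrite sv qxy //; congr (_ * _).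
  by rewrite mulrA -[g i o b * _ * e i o c]mulrA eM eqxx scale1r.
rewrite lad_P_e // lad_P_g //.
split=> a c; under eq_bigr => b _ do rewrite ?mv ?mv'.
- by rewrite -mulr_sumr -mulr_suml -mulr_sumr g1 mulr1 eM scalerAr.
- by rewrite -mulr_sumr -mulr_suml -mulr_sumr e1 mulr1 gM scalerAr.
- by rewrite -mulr_sumr ege // scalerAr.
- by rewrite -mulr_sumr geg // scalerAr.
Qed.

Lemma lad_Pv i a b : (i < k)%N -> lad_P i * lad_v i a b = lad_v i a b.
Proof.
move=> ik; have [eM _ _] := eU ik.
rewrite lad_P_e // lad_qM //; last exact/commr_sym/lad_q_e.
by congr (_ * _); rewrite mulrA eM eqxx scale1r.
Qed.

Lemma lad_vP i a b : (i < k)%N -> lad_v i a b * lad_P i.+1 = lad_v i a b.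
Proof.
move=> ik; have [gM _ _] := gU ik.
rewrite lad_P_g // lad_qM //; last exact: lad_q_w.
by rewrite -mulrA gM eqxx scale1r.
Qed.

(** By [lad_x0] and [lad_xS] this is P_0 v_0 ... v_(i-1), where v_j has the indices a j and b j, in
    a normal form with every e to the left of every g. At i = k the remaining product [lad_r] is
    empty, which leaves [lad_end]. *)
Definition lad_x (a b : nat -> T) i :=
  (\prod_(0 <= j < i) e j o (a j)) * (\prod_(0 <= j < i) g j (b j) o) * lad_r i.

Lemma lad_x0 a b : lad_x a b 0 = lad_P 0.
Proof. by rewrite /lad_x /lad_P /lad_p !big_geq // mul1r. Qed.

Lemma lad_gp b i : (i <= k)%N ->
  (\prod_(0 <= j < i) g j (b j) o) * lad_p i = \prod_(0 <= j < i) g j (b j) o.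
Proof.
elim: i => [|i IH] ik; first by rewrite /lad_p !big_geq ?mulr1.
rewrite lad_p_split big_nat_recr //= -mulrA [g i _ _ * _]mulrA lad_p_g // -mulrA.
have [gM _ _] := gU ik; rewrite gM eqxx scale1r mulrA IH //; exact: ltnW.
Qed.

Lemma lad_xS a b i : (i < k)%N ->
  lad_x a b i.+1 = lad_x a b i * lad_v i (a i) (b i).
Proof.
move=> ik; have [eM e1 es] := eU ik.
have ge : GRing.comm (\prod_(0 <= j < i) g j (b j) o) (e i o (a i)).
  apply/commr_sym; rewrite big_seq; apply: commr_prod => j.
  rewrite mem_index_iota => /andP[_ ji].
  by apply/commr_sym/geC; rewrite ji ik.
have gp := lad_gp b (ltnW ik).
rewrite /lad_x !big_nat_recr //= (lad_r_split ik) /lad_v /lad_q.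
set Pe := \prod_(_ <= _ < _) e _ _ _; set Pg := \prod_(_ <= _ < _) g _ _ _ in ge gp *.
set r := lad_r i.+1; set p := lad_p i in gp *.
have [rr _] := projection_r i.+1; rewrite -/r in rr.
have re c d : r * e i c d = e i c d * r by exact/commr_sym/lad_r_e.
have rg c d : r * g i c d = g i c d * r by exact/commr_sym/lad_r_g.
have pe c d : e i c d * p = p * e i c d by exact: lad_p_e.
have pr : p * r = r * p by apply: lad_pr; rewrite leqnSn ik.
(* One copy of r is absorbed by the other, after crossing the units in position i. *)
have -> : Pe * Pg * (e i o o * r) * (p * r * (e i o (a i) * g i (b i) o)) =
   Pe * Pg * (e i o o * p * (e i o (a i) * g i (b i) o) * r).
  rewrite -!mulrA; congr (_ * (_ * (_ * _))).
  by rewrite mulrA -pr -mulrA [r * (r * _)]mulrA rr [r * (_ * _)]mulrA re -mulrA rg.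
(* Now Pg absorbs p, the two units e_i multiply, and the result moves left across the g_j with j <
   i. *)
rewrite pe -!mulrA [Pg * (p * _)]mulrA gp [e i o o * (_ * _)]mulrA eM eqxx scale1r.
by rewrite [Pg * (e _ _ _ * _)]mulrA ge -!mulrA.
Qed.

Local Notation Mk := ('M[C]_k.+1).
Let mk := matrix_matunits C k.
(** There are k steps between the levels 0 to k; step i joins level i, [lo i], to level i + 1,
    [hi i]. *)
Let lo (i : 'I_k) : 'I_k.+1 := widen_ord (leqnSn k) i.
Let hi (i : 'I_k) : 'I_k.+1 := lift ord0 i.

Let lo_inj : injective lo.
Proof. by move=> i j /(congr1 val) /= ij; exact: val_inj. Qed.
Let hi_inj : injective hi. Proof. exact: lift_inj. Qed.

Lemma block_mul (x y : 'I_k -> D) (al si be : 'I_k -> 'I_k.+1) : injective si ->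
  (\sum_i tens (x i) (delta_mx (al i) (si i) : Mk)) *
  (\sum_i tens (y i) (delta_mx (si i) (be i))) =
  \sum_i tens (x i * y i) (delta_mx (al i) (be i)).
Proof.
move=> si_inj; rewrite mulr_suml; apply: eq_bigr => i _; rewrite mulr_sumr.
under eq_bigr => j _ do rewrite tensM (munitM mk) tensZr (inj_eq si_inj) eq_sym.
by rewrite sum_deltaZ.
Qed.

(** A shift over the levels with the v_i as weights. Distinct steps occupy distinct rows and
    columns, so the sum is still partially biunitary. *)
Definition lad_vv a b : tensor D Mk :=
  \sum_(i < k) tens (lad_v i a b) (delta_mx (lo i) (hi i)).
Definition lad_F : tensor D Mk := \sum_(i < k) tens (lad_P i) (delta_mx (lo i) (lo i)).
Definition lad_E : tensor D Mk := \sum_(i < k) tens (lad_P i.+1) (delta_mx (hi i) (hi i)).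

Lemma star_lad_vv a b :
  star (lad_vv a b) = \sum_(i < k) tens (star (lad_v i a b)) (delta_mx (hi i) (lo i)).
Proof. by rewrite star_sum; apply: eq_bigr => i _; rewrite star_tens (munit_star mk). Qed.

Lemma projection_F : projection lad_F.
Proof.
split; first rewrite block_mul //; last rewrite star_sum.
  by apply: eq_bigr => i _; have [-> _] := projection_P (ltnW (ltn_ord i)).
apply: eq_bigr => i _; rewrite star_tens (munit_star mk).
by have [_ ->] := projection_P (ltnW (ltn_ord i)).
Qed.

Lemma projection_E : projection lad_E.
Proof.
split; first rewrite block_mul //; last rewrite star_sum.
  by apply: eq_bigr => i _; have [-> _] := projection_P (ltn_ord i).
apply: eq_bigr => i _; rewrite star_tens (munit_star mk).
by have [_ ->] := projection_P (ltn_ord i).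
Qed.

Lemma lad_Fvv a b : lad_F * lad_vv a b = lad_vv a b.
Proof. by rewrite block_mul //; apply: eq_bigr => i _; rewrite lad_Pv. Qed.

Lemma lad_vvE a b : lad_vv a b * lad_E = lad_vv a b.
Proof. by rewrite block_mul //; apply: eq_bigr => i _; rewrite lad_vP. Qed.

Lemma lad_vv_biunitary : partial_biunitary lad_vv lad_F lad_E.
Proof.
split=> a c; under eq_bigr => b _ do rewrite star_lad_vv block_mul //;
  rewrite /= exchange_big scaler_sumr /=; apply: eq_bigr => i _;
  rewrite -tens_suml -tensZl; have [h1 h2 h3 h4] := lad_v_biunitary (ltn_ord i).
- by rewrite h1.
- by rewrite h2.
- by rewrite h3.
- by rewrite h4.
Qed.

Definition lad_W := dilation lad_vv lad_F lad_E.

Lemma lad_W_biunitary : biunitary lad_W.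
Proof.
exact: dilation_biunitary lad_vv_biunitary projection_F projection_E lad_Fvv lad_vvE.
Qed.

(** Row 0 of the level matrices plays the role of a row vector: x is what has been accumulated on
    arrival at level i, in the first corner of the dilation. *)
Definition corner (x : D) (i : 'I_k.+1) : tensor (tensor D Mk) 'M[C]_2 :=
  tens (tens x (delta_mx ord0 i)) (delta_mx 0 0).

(** As x is supported by P_i, the dilating entry 1 - F kills it; so one step up stays in the first
    corner and acts by [lad_v i]. *)
Lemma cornerW x (i : 'I_k) a b : x * lad_P i = x ->
  corner x (lo i) * lad_W a b = corner (x * lad_v i a b) (hi i).
Proof.
move=> xP; rewrite /corner /lad_W /dilation !mulrDr !mx2M.
have -> : (0 == 1 :> 'I_2) = false by [].
rewrite !eqxx !scale0r !scale1r !addr0.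
have xl (y : 'I_k -> D) (be : 'I_k -> 'I_k.+1) :
    tens x (delta_mx ord0 (lo i) : Mk) * (\sum_j tens (y j) (delta_mx (lo j) (be j))) =
    tens (x * y i) (delta_mx ord0 (be i)).
  rewrite mulr_sumr.
  under eq_bigr => j _ do rewrite tensM (munitM mk) tensZr (inj_eq lo_inj) eq_sym.
  by rewrite sum_deltaZ.
rewrite xl -scalerAr mulrBr mulr1 xl xP subrr scaler0 tens0l addr0 //.
Qed.

Lemma cornerW_prod (a b : nat -> T) (i : 'I_k.+1) :
  corner (lad_P 0) ord0 * \prod_(0 <= j < i) lad_W (a j) (b j) = corner (lad_x a b i) i.
Proof.
case: i => i; elim: i => [|i IH] ik.
  rewrite big_geq // mulr1 -(lad_x0 a b); congr corner; exact: val_inj.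
rewrite big_nat_recr //= mulrA (IH (ltnW ik)).
have -> : Ordinal (ltnW ik) = lo (Ordinal (ltnSE ik)) by exact: val_inj.
have -> : Ordinal ik = hi (Ordinal (ltnSE ik)) by exact: val_inj.
rewrite cornerW /= ?lad_xS //.
case: i ik {IH} => [|i] ik; first by rewrite lad_x0; have [->] := projection_P (leq0n k).
have ik' : (i < k)%N by exact: ltnW.
by rewrite lad_xS // -mulrA lad_vP.
Qed.

Lemma lad_xP a b i : (i <= k)%N -> lad_x a b i * lad_P i = lad_x a b i.
Proof.
case: i => [|i] ik; first by rewrite lad_x0; have [->] := projection_P (leq0n k).
by rewrite lad_xS // -mulrA lad_vP.
Qed.

Lemma corner_starW x (i : 'I_k) a b : x * lad_P i.+1 = x ->
  corner x (hi i) * star (lad_W a b) = corner (x * star (lad_v i a b)) (lo i).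
Proof.
move=> xP; rewrite /corner /lad_W (star_dilation _ projection_F projection_E).
rewrite !mulrDr !mx2M star_lad_vv.
have -> : (0 == 1 :> 'I_2) = false by [].
rewrite !eqxx !scale0r !scale1r !addr0.
have xl (y : 'I_k -> D) (be : 'I_k -> 'I_k.+1) :
    tens x (delta_mx ord0 (hi i) : Mk) * (\sum_j tens (y j) (delta_mx (hi j) (be j))) =
    tens (x * y i) (delta_mx ord0 (be i)).
  rewrite mulr_sumr.
  under eq_bigr => j _ do rewrite tensM (munitM mk) tensZr (inj_eq hi_inj) eq_sym.
  by rewrite sum_deltaZ.
rewrite xl -scalerAr mulrBr mulr1 xl xP subrr scaler0 tens0l addr0 //.
Qed.

Lemma corner_starW_prod (a b : nat -> T) (i : 'I_k.+1) x : x * lad_P i = x ->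
  corner x i * star (\prod_(0 <= j < i) lad_W (a j) (b j)) =
    corner (x * star (lad_x a b i)) ord0.
Proof.
case: i => i /=; elim: i x => [|i IH] x ik xP.
  rewrite big_geq // star1 mulr1 lad_x0.
  have [_ ->] := projection_P (leq0n k); rewrite xP; congr corner; exact: val_inj.
have ik' := ltnSE ik.
have -> : Ordinal ik = hi (Ordinal ik') by exact: val_inj.
rewrite big_nat_recr //= starM mulrA corner_starW //.
have -> : lo (Ordinal ik') = Ordinal (ltnW ik) by exact: val_inj.
rewrite (IH _ (ltnW ik)) /=; first by rewrite lad_xS // [in RHS]starM [in RHS]mulrA.
rewrite -mulrA; congr (_ * _).
have [_ sP] := projection_P (ltnW ik').
by rewrite -{1}sP -starM lad_Pv.
Qed.

Definition lad_end (a b : nat -> T) : D :=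
  (\prod_(0 <= j < k) e j o (a j)) * \prod_(0 <= j < k) g j (b j) o.

Definition lad_word (a b : nat -> T) := \prod_(0 <= j < k) lad_W (a j) (b j).

(** k steps up and k steps down lead from level 0 back to level 0. The second equality is the
    adjoint of the first with the two words exchanged; together they say that the product commutes
    with the corner of P_0. *)
Lemma corner_lad_word a b a' b' :
  corner (lad_P 0) ord0 * (lad_word a b * star (lad_word a' b')) =
    corner (lad_end a b * star (lad_end a' b')) ord0 /\
  (lad_word a b * star (lad_word a' b')) * corner (lad_P 0) ord0 =
    corner (lad_end a b * star (lad_end a' b')) ord0.
Proof.
have endE c d : lad_x c d k = lad_end c d by rewrite /lad_x /lad_r (big_geq (leqnn k)) mulr1.
have sc y : star (corner y ord0) = corner (star y) ord0.
  by rewrite /corner !star_tens (munit_star mk) (munit_star (matrix_matunits C 1)).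
have left c d c' d' : corner (lad_P 0) ord0 * (lad_word c d * star (lad_word c' d')) =
    corner (lad_end c d * star (lad_end c' d')) ord0.
  have := cornerW_prod c d ord_max; rewrite mulrA -/(lad_word c d) /= => ->.
  by rewrite corner_starW_prod /= ?lad_xP // !endE.
split=> //; have [_ sP] := projection_P (leq0n k).
apply: (can_inj starK); rewrite [LHS]starM sc sP [X in _ * X]starM starK left.
by rewrite sc [in RHS]starM starK.
Qed.

End Ladder.

(** * Towers of actions on tensor powers *)

Lemma tens_unit_sandwich (C : numClosedFieldType) (A B : starAlgType C) (T : finType)
    (m : matunits B T) (a a' : A) O K M P (z : tensor A B) :
  tens a (m O K) * z * tens a' (m M P) = tens (a * tcoef m K M z * a') (m O P).
Proof.
have lm x y : linear (fun z : tensor A B => x * z * y).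
  by move=> c u v; rewrite mulrDr mulrDl -scalerAr -scalerAl.
have lg : linear (fun w : A => tens (a * w * a') (m O P)).
  by move=> c u v; rewrite mulrDr mulrDl -scalerAr -scalerAl tensDl tensZl.
move: z; apply: tensor_lin_eq => [||b y]; first exact: lm.
  exact: linear_comp (tcoef_linear m K M) lg.
rewrite !tensM tcoefE -scalerAr -scalerAl tensZl -tensZr; congr tens.
move: y; apply: (munit_lin_eq (m := m)) => [c u v|c u v|I J].
- by rewrite mulrDr mulrDl -scalerAr -scalerAl.
- by rewrite mcoef_linear scalerDl scalerA.
by rewrite munitM mcoef_unit -scalerAl munitM scalerA eq_sym.
Qed.

Section TensorPowers.
Variables (C : numClosedFieldType) (n : nat).
Local Notation L := 'I_n.+1.
Local Notation B k := (tpow C n.+1 k).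

Fixpoint idx (k : nat) : finType :=
  if k is k'.+1 then (idx k' * L)%type : finType else unit : finType.

Fixpoint tpow_units (k : nat) : matunits (B k) (idx k) :=
  match k with
  | 0 => scalar_matunits C
  | k'.+1 => tens_matunits (tpow_units k') (matrix_matunits C n)
  end.

(* The matrix unit e_ab in position j < k; positions are numbered from 0. *)
Fixpoint leg (k j : nat) (a b : L) : B k :=
  match k with
  | 0 => 0
  | k'.+1 => if j == k' then tens 1 (delta_mx a b : Mat C n.+1) else tens (leg k' j a b) 1
  end.

(** A total function of the position, as products over [nat] require; its value is [ord0] at
    positions from k on. *)
Fixpoint digit (k : nat) : idx k -> nat -> L :=
  match k with
  | 0 => fun _ _ => ord0
  | k'.+1 => fun I j => if j == k' then I.2 else digit I.1 j
  end.

Fixpoint idx0 (k : nat) : idx k :=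
  match k with 0 => tt | k'.+1 => (idx0 k', ord0) end.

Lemma digit_idx0 k j : digit (idx0 k) j = ord0.
Proof. by elim: k => //= k IH; case: ifP. Qed.

Lemma leg_last k a b : leg k.+1 k a b = tens 1 (delta_mx a b : Mat C n.+1).
Proof. by rewrite /= eqxx. Qed.

Lemma leg_lt k j a b : (j < k)%N -> leg k.+1 j a b = tens (leg k j a b) 1.
Proof. by move=> jk; rewrite /= ltn_eqF. Qed.

Lemma tpow_unitE k (I J : idx k) :
  tpow_units k I J = \prod_(0 <= j < k) leg k j (digit I j) (digit J j).
Proof.
elim: k I J => [|k IH]; first by move=> [] []; rewrite big_geq.
move=> [I a] [J b]; rewrite big_nat_recr //= eqxx.
rewrite (eq_big_nat _ _ (F2 := fun j => tens (leg k j (digit I j) (digit J j)) 1)); last first.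
  by move=> j /andP[_ jk]; rewrite ltn_eqF.
have := alg_hom_prod (index_iota 0 k) (fun j => leg k j (digit I j) (digit J j))
  (alg_hom_tens_one_r (B k) (Mat C n.+1)).
rewrite /tens_one_r => <-.
by rewrite tensM mul1r mulr1 -IH.
Qed.

Lemma leg_unit_system k j : (j < k)%N -> unit_system (leg k j).
Proof.
elim: k => // k IH; rewrite ltnS leq_eqVlt => /orP[/eqP ->|jk].
  split=> [a b c d||a b].
  - by rewrite !leg_last tensM mul1r (munitM (matrix_matunits C n)) tensZr.
  - under eq_bigr => a _ do rewrite leg_last.
    by rewrite -tens_sumr (munit1 (matrix_matunits C n)) tens1.
  - by rewrite !leg_last star_tens star1 (munit_star (matrix_matunits C n)).
have [lM l1 ls] := IH jk; split=> [a b c d||a b].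
- by rewrite !leg_lt // tensM mulr1 lM tensZl.
- under eq_bigr => a _ do rewrite leg_lt //.
  by rewrite -tens_suml l1 tens1.
- by rewrite !leg_lt // star_tens star1 ls.
Qed.

Lemma leg_comm k i j a b c d : (i < k)%N -> (j < k)%N -> i != j ->
  GRing.comm (leg k i a b) (leg k j c d).
Proof.
elim: k => // k IH; rewrite !ltnS /GRing.comm.
rewrite leq_eqVlt => /orP[/eqP ->|ik]; rewrite leq_eqVlt => /orP[/eqP ->|jk] ij.
- by rewrite eqxx in ij.
- by rewrite leg_last leg_lt // !tensM !mulr1 !mul1r.
- by rewrite leg_last leg_lt // !tensM !mulr1 !mul1r.
- by rewrite !leg_lt // !tensM mulr1 IH.
Qed.

Section Towers.
Variable H : cqgType C.

Fixpoint tower (k : nat) : (B k -> tensor H (B k)) -> Prop :=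
  match k with
  | 0 => fun beta => invariant_action (tpow_units 0) beta
  | k'.+1 => fun beta => invariant_action (tpow_units k'.+1) beta /\
      exists2 beta' : B k' -> tensor H (B k'), tower beta' &
        forall x, beta (tens x 1) = up (Mat C n.+1) (beta' x)
  end.

Lemma tower_invariant k (beta : B k -> tensor H (B k)) : tower beta ->
  invariant_action (tpow_units k) beta.
Proof. by case: k beta => [|k] beta //= []. Qed.

Lemma up_leg k (x : B k) : tens 1 (tens x 1) = up (Mat C n.+1) (tens (1 : H) x).
Proof. by rewrite /up tmapE //; exact: linear_tensl. Qed.

(** If j is the last position, the image of [leg i] comes from the smaller power by [up] and does
    not involve the last factor. Otherwise both elements come from the smaller power. *)
Lemma tower_comm k (beta : B k -> tensor H (B k)) i j a b c d : tower beta ->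
  (i < j < k)%N -> GRing.comm (beta (leg k i a b)) (tens 1 (leg k j c d)).
Proof.
elim: k beta => [|k IH] beta; first by rewrite ltn0 andbF.
move=> /= [bN [beta' b'T bb']]; rewrite ltnS [(j <= k)%N]leq_eqVlt => /andP[ij jk].
have [_ _ uM] := up_hom (B k) (Mat C n.+1) H.
have ik : (i < k)%N by move: jk => /orP[/eqP <- //|]; exact: ltn_trans.
rewrite -!/(leg k.+1 _ _ _) leg_lt // bb'.
case/orP: jk ij => [/eqP ->|jk] ij; first by rewrite leg_last; exact: up_last.
by rewrite leg_lt // up_leg /GRing.comm -!uM IH ?ij.
Qed.

(** In the last position, this and [tower_geg] are the one-step relations; in the others, both sides
    come by [up] from the smaller power, where induction applies. *)
Lemma tower_ege k (beta : B k -> tensor H (B k)) i c b d c' : tower beta -> (i < k)%N ->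
  \sum_a tens 1 (leg k i c a) * beta (leg k i b d) * tens 1 (leg k i a c') =
    (b == d)%:R *: tens 1 (leg k i c c').
Proof.
elim: k beta => [//|k IH] beta [bN [beta' b'T bb']].
have uH := up_hom (B k) (Mat C n.+1) H; have [ul u1 uM] := uH.
rewrite ltnS leq_eqVlt => /orP[/eqP ->|ik].
  rewrite !leg_last; under eq_bigr => a _ do rewrite !leg_last.
  rewrite (last_leg_sandwich_gam (mB := tpow_units k) (mD := matrix_matunits C n)
    (tower_invariant b'T) bN bb').
  by rewrite (mtrace_unit (matrix_matunits C n)).
rewrite [leg k.+1 i c c']leg_lt // up_leg -(linZ ul) -(IH beta' b'T ik) (lin_sum ul).
apply: eq_bigr => a _.
by rewrite !leg_lt // !up_leg bb' !uM.
Qed.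

Lemma tower_geg k (beta : B k -> tensor H (B k)) i c a a' c' : tower beta -> (i < k)%N ->
  \sum_b beta (leg k i c b) * tens 1 (leg k i a a') * beta (leg k i b c') =
    (a == a')%:R *: beta (leg k i c c').
Proof.
elim: k beta => [//|k IH] beta [bN [beta' b'T bb']].
have uH := up_hom (B k) (Mat C n.+1) H; have [ul u1 uM] := uH.
rewrite ltnS leq_eqVlt => /orP[/eqP ->|ik].
  rewrite !leg_last; under eq_bigr => b _ do rewrite !leg_last.
  rewrite (gam_sandwich_last_leg (mB := tpow_units k) (mD := matrix_matunits C n)
    (tower_invariant b'T) bN bb').
  by rewrite (mtrace_unit (matrix_matunits C n)).
rewrite [leg k.+1 i c c']leg_lt // bb' -(linZ ul) -(IH beta' b'T ik) (lin_sum ul).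
apply: eq_bigr => b _.
by rewrite !leg_lt // up_leg !bb' !uM.
Qed.

(* A tower of actions yields a biunitary matrix, over some *-algebra, whose
   compression to one corner has the coefficients of the action. *)
Lemma tower_biunitary k (beta : B k -> tensor H (B k)) : tower beta ->
  exists (A : starAlgType C) (W : L -> L -> A) (chi : A -> H) (S : A -> Prop),
    [/\ biunitary W,
        [/\ linear chi, chi 1 = 1, forall x, chi (star x) = star (chi x) &
            forall x y, S x -> S y -> chi (x * y) = chi x * chi y],
        [/\ S 1, forall x y, S x -> S y -> S (x * y) &
            forall c x y, S x -> S y -> S (c *: x + y)] &
        forall I J K M : idx k,
          let w I K := \prod_(0 <= j < k) W (digit K j) (digit I j) in
          S (w I K * star (w J M)) /\
          chi (w I K * star (w J M)) =
            tcoef (tpow_units k) K M (beta (tpow_units k I J))].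
Proof.
move=> bT; have [bH bS _ _] := tower_invariant bT; have [bl b1 bM] := bH.
pose e j a b : tensor H (B k) := tens 1 (leg k j a b).
pose g j a b : tensor H (B k) := beta (leg k j a b).
have eU i : (i < k)%N -> unit_system (e i).
  move=> /leg_unit_system[lM l1 ls]; rewrite /e; split=> [a b c d||a b].
  - by rewrite tensM mulr1 lM tensZr.
  - by rewrite -tens_sumr l1.
  - by rewrite star_tens star1 ls.
have gU i : (i < k)%N -> unit_system (g i).
  move=> /leg_unit_system[lM l1 ls]; rewrite /g; split=> [a b c d||a b].
  - by rewrite -bM lM (linZ bl).
  - by rewrite -(lin_sum bl) l1.
  - by rewrite -bS ls.
have eC i j a b c d : (i < k)%N -> (j < k)%N -> i != j ->
    GRing.comm (e i a b) (e j c d).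
  by move=> ik jk ij; rewrite /GRing.comm /e !tensM (leg_comm _ _ _ _ ik jk ij).
have gC i j a b c d : (i < k)%N -> (j < k)%N -> i != j ->
    GRing.comm (g i a b) (g j c d).
  by move=> ik jk ij; rewrite /GRing.comm /g -!bM (leg_comm _ _ _ _ ik jk ij).
have geC i j a b c d : (i < j < k)%N -> GRing.comm (g i a b) (e j c d).
  exact: tower_comm.
have ege i c b d c' : (i < k)%N ->
    \sum_a e i c a * g i b d * e i a c' = (b == d)%:R *: e i c c' by exact: tower_ege.
have geg i c a a' c' : (i < k)%N ->
    \sum_b g i c b * e i a a' * g i b c' = (a == a')%:R *: g i c c' by exact: tower_geg.
have Wb := lad_W_biunitary ord0 eU gU eC gC geC ege geg.
have wE := corner_lad_word ord0 eU gU eC gC geC.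
pose m1 := matrix_matunits C 1; pose mk := matrix_matunits C k.
pose mB := tpow_units k; pose O := idx0 k.
pose A : starAlgType C := tensor (tensor (tensor H (B k)) 'M[C]_k.+1) 'M[C]_2.
pose W : L -> L -> A := lad_W ord0 k e g.
(* [chi] extracts the corner entry in each of the three matrix layers and [iota] puts an element of
   H there; P0 turns out to be [iota 1]. *)
pose tc0 (x : A) : tensor H (B k) := tcoef mk ord0 ord0 (tcoef m1 ord0 ord0 x).
pose chi (x : A) : H := tcoef mB O O (tc0 x).
pose P0 : A := @corner _ _ k (lad_P ord0 k e g 0) ord0.
pose iota (h : H) : A := @corner _ _ k (tens h (mB O O)) ord0.
have eprod X Y : \prod_(0 <= j < k) e j (digit X j) (digit Y j) = tens 1 (mB X Y).
  rewrite /mB tpow_unitE; apply/esym/alg_hom_prod; split; first exact: linear_tensr.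
    exact: tens1.
  by move=> x y; rewrite tensM mulr1.
have gprod X Y : \prod_(0 <= j < k) g j (digit X j) (digit Y j) = beta (mB X Y).
  by rewrite /mB tpow_unitE; apply/esym/alg_hom_prod.
have endE X Y : lad_end ord0 k e g (digit X) (digit Y) = tens 1 (mB O X) * beta (mB Y O).
  rewrite /lad_end -eprod -gprod; congr (_ * _).
    by apply: eq_bigr => j _; rewrite digit_idx0.
  by apply: eq_bigr => j _; rewrite digit_idx0.
have P0E : P0 = iota 1.
  rewrite /P0 /iota; congr corner; rewrite /lad_P /lad_p big_geq // mul1r /lad_r.
  under eq_bigr => j _ do rewrite -(digit_idx0 k j).
  exact: eprod.
have iotaM x y : iota x * iota y = iota (x * y).
  by rewrite /iota /corner !mx2M tensM (munitM mk) tensM (munitM mB) !eqxx !scale1r.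
have chi_iota x : chi (iota x) = x.
  rewrite /chi /tc0 /iota /corner (tcoef_unit m1) !eqxx !scale1r (tcoef_unit mk) !eqxx !scale1r.
  by rewrite tcoef_unit !eqxx !scale1r.
have chiP x : P0 * x * P0 = iota (chi x).
  rewrite P0E /iota /corner -[delta_mx 0 0]/(m1 ord0 ord0) tens_unit_sandwich.
  rewrite -[delta_mx ord0 ord0 in LHS]/(mk ord0 ord0) tens_unit_sandwich.
  by rewrite tens_unit_sandwich mul1r mulr1.
have lchi : linear chi.
  apply: linear_comp (tcoef_linear mB O O).
  exact: linear_comp (tcoef_linear m1 _ _) (tcoef_linear mk _ _).
have P0P : P0 * P0 = P0 by rewrite P0E iotaM mulr1.
(* S is the commutant of P0, on which compression by P0 is multiplicative. *)
exists A, W, chi, (fun x => P0 * x = x * P0); split=> //.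
- split=> // [|x|x y Sx Sy].
  + by apply: (can_inj chi_iota); rewrite -chiP mulr1 P0P P0E.
  + by rewrite /chi /tc0 !tcoef_star.
  apply: (can_inj chi_iota); rewrite -iotaM -!chiP.
  have PS z : P0 * z = z * P0 -> P0 * z * P0 = z * P0 by move=> ->; rewrite -mulrA P0P.
  rewrite (PS x) // (PS y) // (PS (x * y)); last by rewrite mulrA Sx -mulrA Sy mulrA.
  by rewrite mulrA -[x * P0 * y]mulrA Sy -!mulrA P0P.
- split=> [|x y Sx Sy|c x y Sx Sy]; first by rewrite mulr1 mul1r.
  + by rewrite mulrA Sx -mulrA Sy mulrA.
  + by rewrite mulrDr mulrDl -scalerAr -scalerAl Sx Sy.
move=> I J K M w.
have [w1 w2] := wE (digit K) (digit I) (digit M) (digit J).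
split; first by rewrite /P0 [LHS]w1 [RHS]w2.
(* The compressed word is e(O,K) beta(e(I,O)) beta(e(O,J)) e(M,O). The middle factors multiply to
   beta(e(I,J)), and the outer units cut out its (K, M) coefficient. *)
apply: (can_inj chi_iota); rewrite -chiP /P0 w1.
rewrite !endE starM -bS star_tens star1 !munit_star -mulrA [beta _ * (_ * _)]mulrA.
rewrite -bM munitM eqxx scale1r mulrA tens_unit_sandwich mul1r mulr1 -/(iota _).
by rewrite -[corner _ _]/P0 P0E iotaM mulr1.
Qed.

End Towers.
End TensorPowers.

(** * Actions on quantum trees *)

Section Naturality.
Variable C : numClosedFieldType.

Lemma tmap_compr (A B B' B2 : algType C) (g : B -> B') (g' : B' -> B2) (z : tensor A B) :
  linear g -> linear g' -> tmap id g' (tmap id g z) = tmap id (g' \o g) z.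
Proof. by move=> lg lg'; rewrite tmap_comp. Qed.

Lemma tmap_swap (A A' B B' : algType C) (f : A -> A') (g : B -> B') (z : tensor A B) :
  linear f -> linear g -> tmap id g (tmap f id z) = tmap f id (tmap id g z).
Proof. by move=> lf lg; rewrite !tmap_comp. Qed.

Lemma tmap_addr (A B B' : algType C) (g g' : B -> B') (z : tensor A B) :
  linear g -> linear g' -> tmap id (fun x => g x + g' x) z = tmap id g z + tmap id g' z.
Proof.
move=> lg lg'.
have lgg : linear (fun x => g x + g' x).
  by move=> c u v; rewrite lg lg' scalerDr addrACA.
have l1 := linear_tmap (@linear_id C A) lg; have l2 := linear_tmap (@linear_id C A) lg'.
move: z; apply: tensor_lin_eq => [||a b]; first exact: linear_tmap.
  by move=> c u v; rewrite l1 l2 scalerDr addrACA.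
by rewrite !tmapE // tensDr.
Qed.

Lemma tmap_zero (A B B' : algType C) (g : B -> B') (z : tensor A B) :
  (forall x, g x = 0) -> tmap id g z = 0.
Proof.
move=> g0; have lg : linear g by move=> c u v; rewrite !g0 scaler0 addr0.
have l0 : linear (fun _ : tensor A B => 0 : tensor A B').
  by move=> c u v; rewrite scaler0 addr0.
move: z; apply: (tensor_lin_eq (linear_tmap (@linear_id C A) lg) l0) => a b.
by rewrite tmapE // g0 tens0r.
Qed.

Lemma tassoc_tmapr (A : cqgType C) (B B' : algType C) (g : B -> B') (z : tensor A B) :
  linear g ->
  tassoc (tmap comul id (tmap id g z)) = tmap id (tmap id g) (tassoc (tmap comul id z)).
Proof.
move=> lg; have lc := comul_linear (H := A).
have li := @linear_id C.
have lAg := linear_tmap (li A) lg.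
rewrite tmap_comp // -(tmap_comp (f := comul) (g := id) (f' := id) (g' := g)) //.
move: (tmap comul id z) => {}z; move: z; apply: tensor_lin_eq => [||w b].
- exact: linear_comp (linear_tmap (li _) lg) (@tassoc_linear _ _ _ _).
- exact: linear_comp (@tassoc_linear _ _ _ _) (linear_tmap (li _) lAg).
rewrite tmapE //; move: w; apply: tensor_lin_eq => [||a a'].
- exact: linear_comp (linear_tensl (g b)) (@tassoc_linear _ _ _ _).
- apply: linear_comp (linear_tmap (li _) lAg).
  exact: linear_comp (linear_tensl b) (@tassoc_linear _ _ _ _).
by rewrite !tassocE !tmapE.
Qed.

Definition cslice (A : cqgType C) (B : lmodType C) (z : tensor A B) : B :=
  tlift (fun a y => (counit a : C) *: y) z.

Definition wslice (A B : algType C) (phi : B -> C^o) (z : tensor A B) : A :=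
  tlift (fun a y => (phi y : C) *: a) z.

Section Slices.
Variables (A B : algType C) (phi : B -> C^o).
Hypothesis lphi : linear phi.

Lemma wslice_bil : bilinear_map (fun (a : A) (y : B) => (phi y : C) *: a).
Proof.
split=> [y | a] c x z; first by rewrite scalerDr !scalerA mulrC.
by rewrite lphi scalerDl scalerA.
Qed.
Lemma wslice_linear : linear (@wslice A B phi).
Proof. exact/tlift_linear/wslice_bil. Qed.
Lemma wsliceE (a : A) (y : B) : wslice phi (tens a y) = (phi y : C) *: a.
Proof. exact/tlift_tens/wslice_bil. Qed.

End Slices.

Lemma wslice_tmapr (A B B' : algType C) (phi : B' -> C^o) (g : B -> B') (z : tensor A B) :
  linear phi -> linear g -> wslice phi (tmap id g z) = wslice (phi \o g) z.
Proof.
move=> lp lg; have lpg := linear_comp lg lp.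
move: z; apply: tensor_lin_eq => [||a b].
- exact: linear_comp (linear_tmap (@linear_id C A) lg) (wslice_linear (A := A) lp).
- exact: wslice_linear.
by rewrite tmapE // !wsliceE.
Qed.

Lemma wslice_tmapl (A A' B : algType C) (phi : B -> C^o) (f : A -> A') (z : tensor A B) :
  linear phi -> linear f -> wslice phi (tmap f id z) = f (wslice phi z).
Proof.
move=> lp lf; move: z; apply: tensor_lin_eq => [||a b].
- exact: linear_comp (linear_tmap lf (@linear_id C B)) (wslice_linear (A := A') lp).
- exact: linear_comp (wslice_linear lp) lf.
by rewrite tmapE // !wsliceE // (linZ lf).
Qed.

Lemma tmap_rank1 (A B B' : algType C) (phi : B -> C^o) (t : B') (z : tensor A B) :
  linear phi -> tmap id (fun y => (phi y : C) *: t) z = tens (wslice phi z) t.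
Proof.
move=> lp; have lpt : linear (fun y => (phi y : C) *: t).
  by move=> c u v; rewrite lp scalerDl scalerA.
move: z; apply: tensor_lin_eq => [||a b]; first exact: linear_tmap.
  exact: linear_comp (wslice_linear lp) (linear_tensl t).
by rewrite tmapE // wsliceE // tensZl tensZr.
Qed.

Lemma cslice_linear (A : cqgType C) (B : starAlgType C) : linear (@cslice A B).
Proof. exact/tlift_linear/counit_bil. Qed.

Lemma cslice_tmapr (A : cqgType C) (B B' : starAlgType C) (g : B -> B') (z : tensor A B) :
  linear g -> cslice (tmap id g z) = g (cslice z).
Proof.
move=> lg; move: z; apply: tensor_lin_eq => [||a b].
- exact: linear_comp (linear_tmap (@linear_id C A) lg) (@cslice_linear _ _).
- exact: linear_comp (@cslice_linear _ _) lg.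
by rewrite tmapE // /cslice !(tlift_tens _ _ (counit_bil _ A)) (linZ lg).
Qed.

End Naturality.

Section Restriction.
Variables (C : numClosedFieldType) (A : starAlgType C) (B B1 : starAlgType C).
Variables (iota : B1 -> B) (rho : B -> B1).
Hypotheses (il : linear iota) (iM : {morph iota : x y / x * y}).
Hypotheses (ist : star_compatible iota) (rhom : alg_hom rho) (rst : star_compatible rho).
Hypothesis ri : forall x, rho (iota x) = x.
Let rl : linear rho. Proof. by case: rhom. Qed.

(** Compression of an action to a direct summand, with inclusion [iota] and projection [rho]. The
    inclusion of a summand is not unital, so [restriction_hom] asks for unitality separately. *)
Definition restriction (gam : B -> tensor A B) (x : B1) : tensor A B1 :=
  tmap id rho (gam (iota x)).

Lemma restriction_hom gam : alg_hom gam -> restriction gam 1 = 1 ->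
  alg_hom (restriction gam).
Proof.
move=> [lg _ gM] r1; have [lr r11 rM] := alg_hom_tmap (alg_hom_id A) rhom.
split=> [||x y] //; first exact: linear_comp (linear_comp il lg) lr.
by rewrite /restriction iM gM rM.
Qed.

Lemma restriction_star gam : star_compatible gam -> star_compatible (restriction gam).
Proof. by move=> gs x; rewrite /restriction ist gs star_tmap. Qed.

End Restriction.

(** Coassociativity survives because [gam] maps the summand into itself, so that applying [rho]
    loses nothing. *)
Lemma restriction_coaction (C : numClosedFieldType) (H : cqgType C) (B B1 : starAlgType C)
    (iota : B1 -> B) (rho : B -> B1) (gam : B -> tensor H B) :
  linear iota -> linear rho -> (forall x, rho (iota x) = x) -> linear gam ->
  (forall x, gam (iota x) = tmap id iota (restriction iota rho gam x)) ->
  is_coaction gam -> is_coaction (restriction iota rho gam).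
Proof.
move=> il rl ri lg gi gco.
have li := @linear_id C.
have lr : linear (restriction iota rho gam).
  exact: linear_comp (linear_comp il lg) (linear_tmap (li _) rl).
move=> x; have [gco1 gco2] := gco (iota x); split.
  rewrite {1}/restriction tassoc_tmapr // gco1 gi.
  have lr1 := linear_tmap (li H) rl.
  have lr2 := linear_comp lg lr1.
  by rewrite !tmap_compr.
rewrite -/(cslice _) /restriction cslice_tmapr // /cslice gco2 ri //.
Qed.

Section TreeActions.
Variables (C : numClosedFieldType) (n : nat).
Local Notation L := 'I_n.+1.
Local Notation B k := (tpow C n.+1 k).
Local Notation T k := (tree_alg C n.+1 k).

Definition tree_inl k (x : T k) : T k.+1 := (x, 0).
Definition tree_inr k (y : B k.+1) : T k.+1 := (0, y).
Definition tree_fst k (x : T k.+1) : T k := x.1.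
Definition tree_snd k (x : T k.+1) : B k.+1 := x.2.

Lemma linear_inl k : linear (@tree_inl k).
Proof.
move=> c x y; rewrite /tree_inl -[RHS]/(c *: x + y, c *: (0 : B k.+1) + 0).
by rewrite scaler0 addr0.
Qed.
Lemma linear_inr k : linear (@tree_inr k).
Proof.
move=> c x y; rewrite /tree_inr -[RHS]/(c *: (0 : T k) + 0, c *: x + y).
by rewrite scaler0 addr0.
Qed.
Lemma tree_inlM k : {morph @tree_inl k : x y / x * y}.
Proof. by move=> x y; rewrite /tree_inl -[RHS]/(x * y, 0 * 0 : B k.+1) mulr0. Qed.
Lemma tree_inrM k : {morph @tree_inr k : x y / x * y}.
Proof. by move=> x y; rewrite /tree_inr -[RHS]/(0 * 0 : T k, x * y) mulr0. Qed.
Lemma tree_inl_star k : star_compatible (@tree_inl k).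
Proof. by move=> x; rewrite /tree_inl -[RHS]/(star x, star (0 : B k.+1)) star0. Qed.
Lemma tree_inr_star k : star_compatible (@tree_inr k).
Proof. by move=> x; rewrite /tree_inr -[RHS]/(star (0 : T k), star x) star0. Qed.
Lemma tree_split k (x : T k.+1) : x = tree_inl (tree_fst x) + tree_inr (tree_snd x).
Proof.
case: x => x y; rewrite -[RHS]/(x + 0, 0 + y) addr0 add0r //.
Qed.

Lemma linear_top k : linear (@tree_top C n.+1 k).
Proof. by case: k. Qed.

Lemma linear_shift k : linear (@tree_shift C n.+1 k).
Proof.
elim: k => [|k IH] c x y; first by rewrite /= scaler0 addr0.
rewrite /= IH linear_top linear_tensl //.
Qed.

Lemma ntraceE (y : Mat C n.+1) : ntrace y = n.+1%:R^-1 * mtrace (matrix_matunits C n) y.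
Proof. by []. Qed.

Lemma tpow_stateE k (x : B k) :
  tpow_state x = (n.+1%:R ^+ k)^-1 * mtrace (tpow_units C n k) x.
Proof.
elim: k x => [|k IH] x; first by rewrite expr0 invr1 mul1r /mtrace (big_pred1 tt) // => -[].
have bil : bilinear_map (fun (x : B k) (y : Mat C n.+1) => (tpow_state x * ntrace y : C^o)).
  have lt : linear (fun x : B k => tpow_state x : C^o).
    move=> c u v; rewrite !IH (mtrace_linear (tpow_units C n k) c u v) mulrDr.
    by rewrite /GRing.scale /= mulrCA.
  split=> [y | u] c v w; first rewrite lt mulrDl.
    by congr (_ + _); exact/esym/mulrA.
  rewrite !ntraceE (mtrace_linear (matrix_matunits C n) c v w) /GRing.scale /=.
  have AC (a b d m : C) : a * (b * (d * m)) = d * (a * (b * m)).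
    by rewrite (mulrCA b d m) (mulrCA a d).
  by rewrite !mulrDr; congr (_ + _); exact: AC.
rewrite /=.
have lR : linear (fun x => (n.+1%:R ^+ k.+1)^-1 * mtrace (tpow_units C n k.+1) x : C^o).
  move=> c u v; rewrite (mtrace_linear (tpow_units C n k.+1) c u v) mulrDr.
  by rewrite /GRing.scale /= mulrCA.
move: x; apply: (tensor_lin_eq (V := C^o) (tlift_linear bil) lR) => a b.
rewrite (tlift_tens _ _ bil) IH ntraceE mtrace_tens exprSr invfM.
by rewrite mulrACA.
Qed.

Lemma linear_tpow_state k : linear (@tpow_state C n.+1 k : B k -> C^o).
Proof.
move=> c u v; rewrite !tpow_stateE (mtrace_linear (tpow_units C n k) c u v) mulrDr.
by rewrite /GRing.scale /= mulrCA.
Qed.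

Lemma tpow_state1 k : tpow_state (1 : B k) = 1.
Proof.
have n0 : n.+1%:R != 0 :> C by rewrite pnatr_eq0.
rewrite tpow_stateE; suff -> : mtrace (tpow_units C n k) 1 = n.+1%:R ^+ k.
  by rewrite mulVf // expf_neq0.
elim: k => [|k IH]; first by rewrite /mtrace (big_pred1 tt) // => -[].
rewrite -tens1 mtrace_tens IH exprSr; congr (_ * _).
rewrite -[LHS]/(\tr (1 : 'M[C]_n.+1)); exact: mxtrace1.
Qed.

Lemma linear_weight k : linear (@tree_weight C n.+1 k : T k -> C^o).
Proof.
elim: k => [|k IH]; first exact: linear_tpow_state.
move=> c u v; rewrite -[LHS]/(tree_weight (c *: u.1 + v.1) +
  delta C n.+1 ^+ k.+1 * @tpow_state C n.+1 k.+1 (c *: u.2 + v.2)).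
rewrite IH (@linear_tpow_state k.+1) mulrDr /GRing.scale /=.
by rewrite addrACA mulrDr mulrCA.
Qed.

Definition tree_topu k : T k :=
  match k with 0 => 1 | k'.+1 => tree_inr 1 end.

Fixpoint tree_botu k : T k :=
  match k with 0 => 1 | k'.+1 => tree_inl (tree_botu k') end.

Fixpoint tree_botc k : T k -> C^o :=
  match k with 0 => fun x => x | k'.+1 => fun x => tree_botc x.1 end.

Lemma linear_botc k : linear (@tree_botc k).
Proof. by elim: k => [|k IH] c x y //=; rewrite -IH. Qed.

Lemma shift_topu k : tree_shift (tree_topu k) = 0.
Proof.
case: k => [|k] //=; rewrite (lin0 (@linear_shift k)) (lin0 (@linear_top k)) tens0l //.
Qed.

Lemma top_topu k : tree_top (tree_topu k) = 1.
Proof. by case: k. Qed.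

Lemma botc_botu k : tree_botc (tree_botu k) = 1.
Proof. by elim: k. Qed.

(** Each shift raises every level by one and discards the top. After k of them only the root is
    left, sitting at the top: the k-th power has rank one. *)
Lemma iter_shift k (x : T k) : iter k (@tree_shift C n.+1 k) x = (tree_botc x : C) *: tree_topu k.
Proof.
elim: k x => [|k IH] x; first by rewrite /= /GRing.scale /= mulr1.
have it m : iter m.+1 (@tree_shift C n.+1 k.+1) x =
    (iter m.+1 (@tree_shift C n.+1 k) x.1, tens (tree_top (iter m (@tree_shift C n.+1 k) x.1)) 1).
  by elim: m => [//|m IHm]; rewrite iterS IHm.
rewrite it iterS IH (linZ (@linear_shift k)) shift_topu scaler0.
rewrite (linZ (@linear_top k)) top_topu tensZl tens1.
by rewrite -[RHS]/(tree_botc x.1 *: (0 : T k), tree_botc x.1 *: (1 : B k.+1)) scaler0.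
Qed.

(** The conditions on a graph action that make sense over any star algebra, without normalisation:
    the weight replaces the state, and the shift replaces the adjacency matrix. *)
Definition tree_action k (A : starAlgType C) (gam : T k -> tensor A (T k)) : Prop :=
  [/\ alg_hom gam, star_compatible gam,
      forall x, wslice (@tree_weight C n.+1 k) (gam x) = tree_weight x *: 1 &
      forall x, tmap id (@tree_shift C n.+1 k) (gam x) = gam (tree_shift x)].

Section Decomposition.
Variables (k : nat) (A : starAlgType C) (gam : T k.+1 -> tensor A (T k.+1)).
Hypothesis gA : tree_action gam.
Let lg : linear gam. Proof. by case: gA => -[]. Qed.
Let gM : {morph gam : x y / x * y}. Proof. by case: gA => -[]. Qed.
Let g1 : gam 1 = 1. Proof. by case: gA => -[]. Qed.

(** The action commutes with a power of the shift that has rank one, so it sends the unit of the top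
    summand to h (x) that unit for some h; invariance of the weight forces h = 1. *)
Lemma tree_action_topu : gam (tree_inr 1) = tens 1 (tree_inr 1).
Proof.
have [_ _ gw gs] := gA.
have lsh := @linear_shift k.+1.
have itl m : linear (iter m (@tree_shift C n.+1 k.+1)).
  elim: m => [|m IH]; first exact: linear_id.
  exact: linear_comp IH lsh.
have its m x : tmap id (iter m (@tree_shift C n.+1 k.+1)) (gam x) =
    gam (iter m (@tree_shift C n.+1 k.+1) x).
  elim: m => [|m IH]; first by rewrite tmap_id.
  rewrite iterS -gs -IH tmap_compr //.
have e1 : gam (tree_inr 1) = tens (wslice (@tree_botc k.+1) (gam (tree_botu k.+1))) (tree_inr 1).
  rewrite -(tmap_rank1 _ _ (@linear_botc k.+1)).
  have := its k.+1 (tree_botu k.+1); rewrite iter_shift botc_botu scale1r => <-.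
  by apply: eq_tmap => // x; rewrite iter_shift.
have wt : tree_weight (tree_inr 1 : T k.+1) = delta C n.+1 ^+ k.+1.
  rewrite -[LHS]/(tree_weight (0 : T k) + delta C n.+1 ^+ k.+1 * tpow_state (1 : B k.+1)).
  by rewrite (lin0 (@linear_weight k)) add0r tpow_state1 mulr1.
have wt0 : delta C n.+1 ^+ k.+1 != 0 by rewrite expf_neq0 // pnatr_eq0.
have := gw (tree_inr 1); rewrite e1 wsliceE; last exact: (@linear_weight k.+1).
by rewrite wt => /(scalerI wt0) ->.
Qed.

Lemma tree_action_botu : gam (tree_inl 1) = tens 1 (tree_inl 1).
Proof.
have e : tree_inl 1 = 1 - tree_inr 1 :> T k.+1.
  by rewrite -[RHS]/(1 - 0, 1 - 1) subr0 subrr.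
by rewrite e (linB lg) g1 tree_action_topu -tens1 -(linB (@linear_tensr _ A _ 1)).
Qed.

Lemma tree_mul_topu (z : tensor A (T k.+1)) :
  tens 1 (tree_inr 1) * z = tmap id (@tree_inr k) (tmap id (@tree_snd k) z).
Proof.
rewrite tmap_compr //; last exact: linear_inr.
have ls : linear (@tree_inr k \o @tree_snd k) by apply: linear_comp => //; exact: linear_inr.
move: z; apply: tensor_lin_eq => [||a [x y]]; first exact: linear_mull.
  exact: linear_tmap.
rewrite tmapE // tensM mul1r -[_ * (x, y)]/(0 * x, 1 * y) mul0r mul1r //.
Qed.

Lemma tree_mul_botu (z : tensor A (T k.+1)) :
  tens 1 (tree_inl 1) * z = tmap id (@tree_inl k) (tmap id (@tree_fst k) z).
Proof.
rewrite tmap_compr //; last exact: linear_inl.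
have ls : linear (@tree_inl k \o @tree_fst k) by apply: linear_comp => //; exact: linear_inl.
move: z; apply: tensor_lin_eq => [||a [x y]]; first exact: linear_mull.
  exact: linear_tmap.
rewrite tmapE // tensM mul1r -[_ * (x, y)]/(1 * x, 0 * y) mul0r mul1r //.
Qed.

Definition tree_res := restriction (@tree_inl k) (@tree_fst k) gam.
Definition tree_last := restriction (@tree_inr k) (@tree_snd k) gam.

(** The unit of the summand is fixed by the action, so multiplying by it shows that the image stays
    in the summand. *)
Lemma tree_action_inr y : gam (tree_inr y) = tmap id (@tree_inr k) (tree_last y).
Proof. by rewrite -tree_mul_topu -tree_action_topu -gM -tree_inrM mul1r. Qed.

Lemma tree_action_inl x : gam (tree_inl x) = tmap id (@tree_inl k) (tree_res x).
Proof. by rewrite -tree_mul_botu -tree_action_botu -gM -tree_inlM mul1r. Qed.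

End Decomposition.
End TreeActions.

Section TreeTowers.
Variables (C : numClosedFieldType) (n : nat).
Local Notation L := 'I_n.+1.
Local Notation B k := (tpow C n.+1 k).
Local Notation T k := (tree_alg C n.+1 k).
Local Notation inl := (@tree_inl C n _).
Local Notation inr := (@tree_inr C n _).
Local Notation fst := (@tree_fst C n _).
Local Notation snd := (@tree_snd C n _).

Lemma wslice_mtrace (A : algType C) (D : starAlgType C) (S : finType)
    (m : matunits D S) (z : tensor A D) :
  wslice (mtrace m : D -> C^o) z = \sum_K tcoef m K K z.
Proof.
move: z; apply: tensor_lin_eq => [||a b]; first exact/wslice_linear/mtrace_linear.
  by apply: linear_sumf => K; exact: tcoef_linear.
rewrite wsliceE; last exact: mtrace_linear.
by rewrite /mtrace scaler_suml; apply: eq_bigr => K _; rewrite tcoefE.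
Qed.

Lemma weight_inl k (x : T k) : tree_weight (tree_inl x) = tree_weight x.
Proof.
rewrite -[LHS]/(tree_weight x + delta C n.+1 ^+ k.+1 * tpow_state (0 : B k.+1)).
by rewrite (lin0 (@linear_tpow_state _ _ k.+1)) mulr0 addr0.
Qed.

Lemma weight_inr k (y : B k.+1) : tree_weight (tree_inr y) = mtrace (tpow_units C n k.+1) y.
Proof.
rewrite -[LHS]/(tree_weight (0 : T k) + delta C n.+1 ^+ k.+1 * tpow_state y).
rewrite (lin0 (@linear_weight C n k)) add0r tpow_stateE mulVKf // expf_neq0 //.
by rewrite pnatr_eq0.
Qed.

Lemma shift_inl k (x : T k) :
  tree_shift (tree_inl x) = tree_inl (tree_shift x) + tree_inr (tens (tree_top x) 1).
Proof. exact: tree_split. Qed.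

Lemma shift_inr k (y : B k.+1) : tree_shift (tree_inr y) = 0.
Proof.
by rewrite /= (lin0 (@linear_shift C n k)) (lin0 (@linear_top C n k)) tens0l.
Qed.

Lemma tmap_fst_inr k (A : algType C) (z : tensor A (B k.+1)) :
  tmap id (@tree_fst C n k) (tmap id (@tree_inr C n k) z) = 0.
Proof. by rewrite tmap_compr //; [exact: tmap_zero | exact: linear_inr]. Qed.

Lemma tmap_snd_inl k (A : algType C) (z : tensor A (T k)) :
  tmap id (@tree_snd C n k) (tmap id (@tree_inl C n k) z) = 0.
Proof. by rewrite tmap_compr //; [exact: tmap_zero | exact: linear_inl]. Qed.

Lemma tmap_snd_inr k (A : algType C) (z : tensor A (B k.+1)) :
  tmap id (@tree_snd C n k) (tmap id (@tree_inr C n k) z) = z.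
Proof. by rewrite tmap_compr //; [exact: tmap_id | exact: linear_inr]. Qed.

Section Step.
Variables (k : nat) (A : starAlgType C) (gam : T k.+1 -> tensor A (T k.+1)).
Hypothesis gA : tree_action gam.
Let lg : linear gam. Proof. by case: gA => -[]. Qed.

Lemma tree_res_action : tree_action (tree_res gam).
Proof.
have [gh gs gw gsh] := gA.
have lfst := linear_tmap (@linear_id C A) (g := @tree_fst C n k) (fun _ _ _ => erefl).
split.
- apply: restriction_hom => //; [exact: linear_inl | exact: tree_inlM |].
  by rewrite /restriction (tree_action_botu gA) tmapE //= tens1.
- by apply: restriction_star => //; exact: tree_inl_star.
- move=> x; rewrite -weight_inl -gw (tree_action_inl gA).
  rewrite [in RHS]wslice_tmapr; [|exact: linear_weight | exact: linear_inl].
  by congr wslice; apply: funext => y; exact/esym/weight_inl.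
move=> x; rewrite /tree_res /restriction tmap_compr //; last exact: linear_shift.
have -> : @tree_shift C n.+1 k \o @tree_fst C n k = @tree_fst C n k \o @tree_shift C n.+1 k.+1.
  by [].
rewrite -tmap_compr //; last exact: linear_shift.
by rewrite gsh shift_inl (linD lg) (linD lfst) [X in _ + tmap _ _ X](tree_action_inr gA)
  tmap_fst_inr addr0.
Qed.

(** This is the top component of the commutation with the shift, on an element of the lower tree. *)
Lemma tree_last_tower x :
  tree_last gam (tens (tree_top x) 1) =
    up (Mat C n.+1) (tmap id (@tree_top C n.+1 k) (tree_res gam x)).
Proof.
have [gh gs gw gsh] := gA.
have lsnd := linear_tmap (@linear_id C A) (g := @tree_snd C n k) (fun _ _ _ => erefl).
have ltop := @linear_top C n k.
have := congr1 (tmap id (@tree_snd C n k)) (gsh (tree_inl x)).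
rewrite shift_inl (linD lg) (linD lsnd) [X in _ = tmap _ _ X + _](tree_action_inl gA).
rewrite tmap_snd_inl add0r => /esym h.
rewrite -[LHS]/(tmap id (@tree_snd C n k) (gam (tree_inr (tens (tree_top x) 1)))) h.
have l1 : linear (@tree_inl C n k) by exact: linear_inl.
have l2 := @linear_shift C n k.+1.
have l3 : linear (@tens_one_r C (B k) (Mat C n.+1)) by exact: linear_tensl.
have l5 : linear (@tree_fst C n k) by [].
have l6 : linear (@tree_snd C n k) by [].
have l7 := linear_comp ltop l3.
have l8 := linear_comp l2 l6.
have l9 := linear_comp l1 l8.
by rewrite (tree_action_inl gA) /up !tmap_compr.
Qed.

End Step.

Definition tree_topin k : B k -> T k :=
  match k with 0 => fun y => y | k'.+1 => fun y => tree_inr y end.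

Lemma top_topin k (y : B k) : tree_top (tree_topin y) = y.
Proof. by case: k y. Qed.

Section Coaction.
Variable H : cqgType C.

Lemma tree_last_invariant k (gam : T k.+1 -> tensor H (T k.+1)) :
  tree_action gam -> is_coaction gam -> invariant_action (tpow_units C n k.+1) (tree_last gam).
Proof.
move=> gA gco; have [gh gs gw gsh] := gA; have [lg _ _] := gh; split.
- apply: restriction_hom => //; [exact: linear_inr | exact: tree_inrM |].
  by rewrite /restriction (tree_action_topu gA) tmapE //= tens1.
- by apply: restriction_star => //; exact: tree_inr_star.
- by apply: restriction_coaction => //; [exact: linear_inr | exact: tree_action_inr].
move=> y; rewrite -wslice_mtrace -weight_inr -gw (tree_action_inr gA).
rewrite [in RHS]wslice_tmapr; [|exact: linear_weight | exact: linear_inr].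
by congr wslice; apply: funext => z; exact/esym/weight_inr.
Qed.

Lemma tree_tower k (gam : T k -> tensor H (T k)) :
  tree_action gam -> is_coaction gam ->
  exists2 beta : B k -> tensor H (B k), tower beta &
    forall x, tmap id (@tree_top C n.+1 k) (gam x) = beta (tree_top x).
Proof.
elim: k gam => [|k IH] gam gA gco.
  exists gam; last by move=> x; exact: tmap_id.
  have [gh gs gw gsh] := gA; split=> //.
  move=> x; rewrite -wslice_mtrace.
  have -> : mtrace (tpow_units C n 0) = @tree_weight C n.+1 0.
    by apply: funext => z; rewrite /mtrace (big_pred1 tt) // => -[].
  exact: gw.
have [||beta bT bE] := IH (tree_res gam).
- exact: tree_res_action.
- have [[lg _ _] _ _ _] := gA.
  by apply: restriction_coaction => //; [exact: linear_inl | exact: tree_action_inl].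
exists (tree_last gam).
  split; first exact: tree_last_invariant.
  exists beta => // x; rewrite -{1}(top_topin x) (tree_last_tower gA) bE top_topin //.
move=> x; have [[lg _ _] _ _ _] := gA.
have lsnd := linear_tmap (@linear_id C H) (g := @tree_snd C n k) (fun _ _ _ => erefl).
rewrite -[LHS]/(tmap id (@tree_snd C n k) (gam x)) {1}(tree_split x) (linD lg) (linD lsnd).
by rewrite (tree_action_inl gA) tmap_snd_inl add0r.
Qed.

End Coaction.

Lemma up_injective k (A : algType C) : injective (@up C (B k) (Mat C n.+1) A).
Proof.
move=> x y xy; apply: (tcoef_ext (m := tpow_units C n k)) => K M.
have E z : tcoef (tpow_units C n k) K M z =
    tcoef (tens_matunits (tpow_units C n k) (matrix_matunits C n)) (K, ord0) (M, ord0)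
      (up (Mat C n.+1) z).
  by rewrite tcoef_up eqxx mul1r.
by rewrite !E xy.
Qed.

(** The maps x |-> x (x) 1 between consecutive levels are equivariant and stay injective after
    tensoring with A, so the action on the top level determines all the others. *)
Lemma tree_action_ext k (A : starAlgType C) (gam gam' : T k -> tensor A (T k)) :
  tree_action gam -> tree_action gam' ->
  (forall y, tmap id (@tree_top C n.+1 k) (gam (tree_topin y)) =
     tmap id (@tree_top C n.+1 k) (gam' (tree_topin y))) ->
  gam =1 gam'.
Proof.
elim: k gam gam' => [|k IH] gam gam' gA g'A gg' x.
  by have := gg' x; rewrite !tmap_id.
have lastE y : tree_last gam y = tree_last gam' y by exact: gg'.
have resE : tree_res gam =1 tree_res gam'.
  apply: IH; try exact: tree_res_action.
  move=> y; apply: up_injective.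
  by rewrite -!tree_last_tower // lastE.
have [[lg _ _] _ _ _] := gA; have [[lg' _ _] _ _ _] := g'A.
rewrite (tree_split x) (linD lg) (linD lg') !(tree_action_inl gA) !(tree_action_inl g'A).
by rewrite !(tree_action_inr gA) !(tree_action_inr g'A) lastE resE.
Qed.

(** * Direct sums of compatible actions on the levels *)

Section Assembly.
Variables (H : cqgType C) (a : forall i, B i -> tensor H (B i)).

Fixpoint tree_assembly k : T k -> tensor H (T k) :=
  match k with
  | 0 => fun x => a (x : B 0)
  | k'.+1 => fun x => tmap id (@tree_inl C n k') (tree_assembly (tree_fst x)) +
                      tmap id (@tree_inr C n k') (a (tree_snd x))
  end.

(** Images of different summands are orthogonal ([IR] and [RI]), which gives multiplicativity.
    Equivariance of x |-> x (x) 1 between consecutive levels is what commutation with the shift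
    requires. *)
Lemma tree_assembly_action k :
  (forall i, (i <= k)%N -> invariant_action (tpow_units C n i) (@a i)) ->
  (forall i x, (i < k)%N -> @a i.+1 (tens (x : B i) 1) = up (Mat C n.+1) (@a i x)) ->
  [/\ tree_action (@tree_assembly k), is_coaction (@tree_assembly k) &
      forall x, tmap id (@tree_top C n.+1 k) (tree_assembly x) = a (tree_top x)].
Proof.
elim: k => [|k IH] aN aT.
  have [ah ast aco atr] := aN 0 (leqnn 0).
  split; [split=> // | by [] |].
  - move=> x; have := atr x; rewrite -wslice_mtrace.
    have -> : mtrace (tpow_units C n 0) = @tree_weight C n.+1 0.
      by apply: funext => z; rewrite /mtrace (big_pred1 tt) // => -[].
    by [].
  - move=> x; rewrite /= (lin0 (f := @a 0)); last by case: ah.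
    exact: tmap_zero.
  - by move=> x; exact: tmap_id.
have [||gA gco gtop] := IH.
- by move=> i ik; apply: aN; exact: leqW.
- by move=> i x ik; apply: aT; exact: ltnW.
set gam := @tree_assembly k in gA gco gtop *.
set gam2 := @tree_assembly k.+1.
have [[gl g1 gM] gst gw gsh] := gA.
have [[al a1 aM] ast aco atr] := aN k.+1 (leqnn _).
have li : linear (@tree_inl C n k) by exact: linear_inl.
have lr : linear (@tree_inr C n k) by exact: linear_inr.
have lf : linear (@tree_fst C n k) by [].
have ls : linear (@tree_snd C n k) by [].
have lid := @linear_id C H.
have lI := linear_tmap lid li; have lR := linear_tmap lid lr.
have IM := tmapM lid li (fun _ _ => erefl) (@tree_inlM C n k).
have RM := tmapM lid lr (fun _ _ => erefl) (@tree_inrM C n k).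
have I1 : tmap id (@tree_inl C n k) 1 = tens (1 : H) (tree_inl 1) by rewrite -tens1 tmapE.
have R1 : tmap id (@tree_inr C n k) 1 = tens (1 : H) (tree_inr 1) by rewrite -tens1 tmapE.
have IR z w : tmap id (@tree_inl C n k) z * tmap id (@tree_inr C n k) w = 0 :> tensor H (T k.+1).
  by rewrite -{1}[z]mulr1 IM -mulrA I1 tree_mul_botu tmap_fst_inr (lin0 lI) mulr0.
have RI z w : tmap id (@tree_inr C n k) w * tmap id (@tree_inl C n k) z = 0 :> tensor H (T k.+1).
  by rewrite -{1}[w]mulr1 RM -mulrA R1 tree_mul_topu tmap_snd_inl (lin0 lR) mulr0.
have gam2E x : gam2 x = tmap id (@tree_inl C n k) (gam (tree_fst x)) +
    tmap id (@tree_inr C n k) (a (tree_snd x)) by [].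
have g2l : linear gam2.
  move=> c x y; rewrite !gam2E (lf c x y) (ls c x y) gl al lI lR scalerDr addrACA //.
have g2i x : gam2 (tree_inl x) = tmap id (@tree_inl C n k) (gam x).
  by rewrite gam2E /= (lin0 al) (lin0 lR) addr0.
have g2r y : gam2 (tree_inr y) = tmap id (@tree_inr C n k) (a y).
  by rewrite gam2E /= (lin0 gl) (lin0 lI) add0r.
split; first split.
- split=> //.
    rewrite gam2E -[tree_fst 1]/(1 : T k) -[tree_snd 1]/(1 : B k.+1) g1 a1 I1 R1 -tensDr.
    rewrite -tens1; congr tens.
    by rewrite -[LHS]/(1 + 0 : T k, 0 + 1 : B k.+1) addr0 add0r.
  move=> x y; rewrite !gam2E mulrDl !mulrDr IR RI addr0 add0r -IM -RM.
  by rewrite -gM -aM.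
- move=> x; rewrite !gam2E starD; congr (_ + _).
    rewrite -(star_tmap lid li) //; first by rewrite -gst.
    exact: tree_inl_star.
  rewrite -(star_tmap lid lr) //; first by rewrite -ast.
  exact: tree_inr_star.
- move=> x; have lw := @linear_weight C n k.+1.
  have lws := wslice_linear (A := H) lw.
  rewrite gam2E (linD lws) !wslice_tmapr //.
  have -> : (@tree_weight C n.+1 k.+1 : _ -> C^o) \o @tree_inl C n k = @tree_weight C n.+1 k.
    by apply: funext => z; exact: weight_inl.
  have -> : (@tree_weight C n.+1 k.+1 : _ -> C^o) \o @tree_inr C n k = mtrace (tpow_units C n k.+1).
    by apply: funext => z; exact: weight_inr.
  rewrite gw wslice_mtrace atr -scalerDl -weight_inl -weight_inr -(linD lw).
  by rewrite -tree_split.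
- move=> x; have lsh := @linear_shift C n k.+1; have lsh' := @linear_shift C n k.
  have ltop := @linear_top C n k.
  have lone : linear (@tens_one_r C (B k) (Mat C n.+1)) by exact: linear_tensl.
  rewrite {1}gam2E (linD (linear_tmap lid lsh)) !tmap_compr //.
  rewrite [X in _ + X]tmap_zero ?addr0; last by move=> z; exact: shift_inr.
  have -> : @tree_shift C n.+1 k.+1 \o @tree_inl C n k =
      fun x => (@tree_inl C n k \o @tree_shift C n.+1 k) x +
        ((@tree_inr C n k \o @tens_one_r C (B k) (Mat C n.+1)) \o @tree_top C n.+1 k) x.
    by apply: funext => z; exact: shift_inl.
  have l1 := linear_comp lsh' li; have l2 := linear_comp lone lr; have l3 := linear_comp ltop l2.
  rewrite tmap_addr // gam2E; congr (_ + _).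
    by rewrite -tmap_compr // gsh.
  rewrite -tmap_compr // gtop -tmap_compr //; congr tmap.
  exact/esym/aT.
- move=> x; split.
    have las := @tassoc_linear C H H (T k.+1).
    have lcm := linear_tmap (comul_linear (H := H)) (@linear_id C (T k.+1)).
    have lg2 := linear_tmap lid g2l.
    rewrite {1}gam2E (linD lcm) (linD las) !tassoc_tmapr //.
    rewrite (gco _).1 (aco _).1 gam2E (linD lg2) !tmap_compr //.
    by congr (_ + _); apply: eq_tmap => // y; rewrite /= ?g2i ?g2r.
  rewrite -/(cslice _) gam2E (linD (@cslice_linear C H (T k.+1))) !cslice_tmapr //.
  by rewrite /cslice (gco _).2 (aco _).2 -tree_split.
move=> x; rewrite -[tree_top x]/(tree_snd x) -[@tree_top C n.+1 k.+1]/(@tree_snd C n k).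
by rewrite gam2E (linD (linear_tmap lid ls)) tmap_snd_inl tmap_snd_inr add0r.
Qed.

End Assembly.
End TreeTowers.

(** * Hopf subalgebras *)

Section UnitaryCoreps.
Variables (C : numClosedFieldType) (U : cqgType C) (n : nat) (v : 'M[U]_n).
Hypothesis vC : unitary_corep v.

Lemma corep_comul i j : comul (v i j) = \sum_k tens (v i k) (v k j).
Proof. by case: vC. Qed.

Lemma corep_unitary_r i j : \sum_k v i k * star (v j k) = (i == j)%:R.
Proof.
have [_ [h _]] := vC; have := congr1 (fun A : 'M_n => A i j) h.
by rewrite !mxE => <-; apply: eq_bigr => k _; rewrite !mxE.
Qed.

Lemma corep_unitary_l i j : \sum_k star (v k i) * v k j = (i == j)%:R.
Proof.
have [_ [_ h]] := vC; have := congr1 (fun A : 'M_n => A i j) h.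
by rewrite !mxE => <-; apply: eq_bigr => k _; rewrite !mxE.
Qed.

(** The counit axiom gives counit(v) v = v, and v is invertible. *)
Lemma corep_counit i j : counit (v i j) = (i == j)%:R.
Proof.
have lcu := tlift_linear (counit_bil U U).
have e l : \sum_k (counit (v i k) : C) *: v k l = v i l.
  rewrite -[RHS]counitl corep_comul (lin_sum lcu); apply: eq_bigr => k _.
  by rewrite (tlift_tens _ _ (counit_bil U U)).
have : (counit (v i j) : C) *: (1 : U) = (i == j)%:R *: 1.
  rewrite [RHS]scaler_nat -corep_unitary_r.
  under eq_bigr => l _ do rewrite -e mulr_suml.
  rewrite exchange_big /=.
  rewrite (eq_bigr (fun k => (k == j)%:R *: ((counit (v i k) : C) *: (1 : U)))).
    by rewrite sum_deltaZ.
  move=> k _; under eq_bigr => l _ do rewrite -scalerAl.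
  by rewrite -scaler_sumr corep_unitary_r scalerA mulrC -scalerA scaler_nat.
by move=> /eqP; rewrite -subr_eq0 -scalerBl scaler_eq0 oner_eq0 orbF subr_eq0 => /eqP.
Qed.

(** The antipode provides a left inverse of v, the adjoint a right inverse. *)
Lemma corep_antipode i j : antipode (v i j) = star (v j i).
Proof.
have lS : linear (@antipode C U) by exact: linearP.
have bS : bilinear_map (fun a b : U => antipode a * b).
  split=> [b | a] c x y; first by rewrite lS mulrDl scalerAl.
  by rewrite mulrDr scalerAr.
apply: (@left_inverse_eq_right _ _ (fun p q => antipode (v p q)) v (fun p q => star (v q p))).
  move=> p q; have := antipodel (v p q); rewrite corep_comul (lin_sum (tlift_linear bS)).
  rewrite corep_counit scaler_nat => <-; apply: eq_bigr => k _.
  by rewrite tlift_tens.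
exact: corep_unitary_r.
Qed.

End UnitaryCoreps.

Section Retraction.
Variables (C : numClosedFieldType) (V : lmodType C) (S : V -> Prop).
Hypothesis S0 : S 0.
Hypothesis Slin : forall c x y, S x -> S y -> S (c *: x + y).
Local Open Scope classical_set_scope.

(** The kernel is a subspace M maximal among those meeting S in 0: if some x were outside S + M,
    adding x to M would contradict maximality. The retraction is what makes the tensor square of S
    embed in that of V. *)
Lemma exists_retraction : exists r : V -> V,
  [/\ linear r, forall x, S (r x) & forall x, S x -> r x = x].
Proof.
pose P (M : set V) :=
  (forall (c : C) x y, M x -> M y -> M (c *: x + y)) /\ forall x, M x -> S x -> x = 0.
have [|M [[Mlin MS] Mmax]] := @Zorn_bigcup V P.
  move=> F FP Ftot; split; last by move=> x [X FX Xx]; exact: (FP X FX).2.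
  move=> c x y [X FX Xx] [Y FY Yy].
  have [XY|YX] := Ftot X Y FX FY.
    by exists Y => //; apply: (FP Y FY).1 => //; exact: XY.
  by exists X => //; apply: (FP X FX).1 => //; exact: YX.
(* P holds of the empty set, as the empty chain requires, so that 0 in M must be drawn from
   maximality. *)
have M0 : M 0.
  apply: contrapT => M0.
  have Mempty x : ~ M x.
    by move=> Mx; apply: M0; have := Mlin (- 1) x x Mx Mx; rewrite scaleN1r addNr.
  apply: (Mmax [set 0]); first split.
  - by move=> x /Mempty.
  - by move=> /(_ 0 erefl)/Mempty.
  - split=> [c x y -> -> | x -> //] /=; by rewrite /= scaler0 addr0.
have MZ c x : M x -> M (c *: x) by move=> Mx; have := Mlin c x 0 Mx M0; rewrite addr0.
have MB x y : M x -> M y -> M (x - y).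
  by move=> Mx My; have := Mlin (- 1) y x My Mx; rewrite scaleN1r addrC.
have SZ c x : S x -> S (c *: x) by move=> Sx; have := Slin c Sx S0; rewrite addr0.
have SB x y : S x -> S y -> S (x - y).
  by move=> Sx Sy; have := Slin (- 1) Sy Sx; rewrite scaleN1r addrC.
have dec x : exists s, S s /\ M (x - s).
  apply: contrapT => nx.
  have nMx : ~ M x by move=> Mx; apply: nx; exists 0; rewrite subr0.
  pose Q : set V := [set z | exists t m, M m /\ z = t *: x + m].
  have MQ : M `<=` Q by move=> z Mz; exists 0, z; rewrite scale0r add0r.
  have Qx : Q x by exists 1, 0; rewrite scale1r addr0.
  have : ~ P Q by apply: Mmax; split=> // QM; exact: nMx (QM _ Qx).
  apply; split=> [c y z [t [m [Mm ->]]] [t' [m' [Mm' ->]]] | z [t [m [Mm ez]]] Sz].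
    exists (c * t + t'), (c *: m + m'); split; first exact: Mlin.
    by rewrite scalerDr scalerA scalerDl addrACA.
  have [t0|t0] := eqVneq t 0.
    by apply: MS => //; rewrite ez t0 scale0r add0r.
  exfalso; apply: nx; exists (t^-1 *: z); split; first exact: SZ.
  rewrite ez scalerDr scalerA mulVf // scale1r opprD addNKr -scaleNr; exact: MZ.
have uniq x s s' : S s -> S s' -> M (x - s) -> M (x - s') -> s = s'.
  move=> Ss Ss' Ms Ms'; apply/eqP; rewrite -subr_eq0; apply/eqP/MS; last exact: SB.
  have := MB _ _ Ms' Ms; rewrite opprB addrC addrA subrK addrC => h.
  by have := MZ 1 _ h; rewrite scale1r // addrC.
pose r x := sval (cid (dec x)).
have rP x : S (r x) /\ M (x - r x) := svalP (cid (dec x)).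
exists r; split=> [c x y|x|x Sx].
- apply: uniq (rP _).1 _ (rP _).2 _; first exact: Slin (rP _).1 (rP _).1.
  rewrite opprD addrACA -scalerBr; exact: Mlin (rP _).2 (rP _).2.
- exact: (rP x).1.
- by apply: uniq (rP x).1 Sx (rP x).2 _; rewrite subrr.
Qed.

End Retraction.

(** The field [hs_span] stands for closure under comultiplication and antipode: both are explicit on
    the coefficients of a unitary corepresentation, all of which are required to lie in the set. *)
Record hopf_subset (C : numClosedFieldType) (U : cqgType C) := HopfSubset {
  hs_mem :> U -> Prop;
  hs_one : hs_mem 1;
  hs_lin : forall (c : C) x y, hs_mem x -> hs_mem y -> hs_mem (c *: x + y);
  hs_mul : forall x y, hs_mem x -> hs_mem y -> hs_mem (x * y);
  hs_star : forall x, hs_mem x -> hs_mem (star x);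
  hs_span : forall x, hs_mem x ->
    lin_span (fun y => exists n (v : 'M[U]_n) i j,
      [/\ unitary_corep v, forall i j, hs_mem (v i j) & y = v i j]) x
}.

Section HopfSubset.
Variables (C : numClosedFieldType) (U : cqgType C) (S : hopf_subset U).

Definition hs_pred : {pred U} := fun x => `[< S x >].

Lemma hs_predP x : reflect (S x) (x \in hs_pred).
Proof. exact: asboolP. Qed.

Fact hs_subalg_closed : subalg_closed hs_pred.
Proof.
split=> [|c x y /hs_predP Sx /hs_predP Sy|x y /hs_predP Sx /hs_predP Sy]; apply/hs_predP.
- exact: hs_one.
- exact: hs_lin.
- exact: hs_mul.
Qed.

Definition hs_type : Type := {x : U | hs_pred x}.
HB.instance Definition _ := SubType.on hs_type.
HB.instance Definition _ := [Choice of hs_type by <:].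
HB.instance Definition _ := GRing.SubChoice_isSubAlgebra.Build C U hs_pred hs_type
  (GRing.subalg_closed_semi hs_subalg_closed).

Definition hs_val (x : hs_type) : U := val x.

Lemma hs_val_hom : alg_hom hs_val.
Proof. by split; [exact: linearP | exact: rmorph1 | exact: rmorphM]. Qed.

Lemma hs_valP (x : hs_type) : S (hs_val x).
Proof. by apply/asboolP; exact: (valP x). Qed.

Lemma hs_val_inj : injective hs_val.
Proof. exact: val_inj. Qed.

End HopfSubset.

Section HopfSubsetStar.
Variables (C : numClosedFieldType) (U : cqgType C) (S : hopf_subset U).
Local Notation G := (hs_type S).
Local Notation iv := (@hs_val C U S).

Definition hs_make (x : U) (Sx : S x) : G := exist _ x (introT (asboolP _) Sx).

Lemma hs_makeK x (Sx : S x) : iv (hs_make Sx) = x.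
Proof. by []. Qed.

Let vl : linear iv. Proof. by case: (hs_val_hom S). Qed.
Let v1 : iv 1 = 1. Proof. by case: (hs_val_hom S). Qed.
Let vM : {morph iv : x y / x * y}. Proof. by case: (hs_val_hom S). Qed.

Definition hs_starf (x : G) : G := hs_make (hs_star (hs_valP x)).

Fact hs_starD : {morph hs_starf : x y / x + y}.
Proof. by move=> x y; apply: hs_val_inj; rewrite (linD vl) !hs_makeK (linD vl) starD. Qed.
Fact hs_starZ (c : C) (x : G) : hs_starf (c *: x) = c^* *: hs_starf x.
Proof. by apply: hs_val_inj; rewrite (linZ vl) !hs_makeK (linZ vl) starZ. Qed.
Fact hs_starM (x y : G) : hs_starf (x * y) = hs_starf y * hs_starf x.
Proof. by apply: hs_val_inj; rewrite vM !hs_makeK vM starM. Qed.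
Fact hs_starK : involutive hs_starf.
Proof. by move=> x; apply: hs_val_inj; rewrite !hs_makeK starK. Qed.

HB.instance Definition _ := isStarAlgebra.Build C (hs_type S)
  hs_starD hs_starZ hs_starM hs_starK.

Lemma hs_val_star : star_compatible iv.
Proof. by []. Qed.

Lemma hs0 : S 0.
Proof. by rewrite -(lin0 vl); exact: hs_valP. Qed.

Lemma exists_hs_retraction : exists r : U -> G,
  linear r /\ forall x, r (iv x) = x.
Proof.
have [r [lr rS rid]] := exists_retraction hs0 (@hs_lin _ _ S).
exists (fun x => hs_make (rS x)); split=> [c x y|x]; apply: hs_val_inj.
  by rewrite vl !hs_makeK lr.
by rewrite hs_makeK rid //; exact: hs_valP.
Qed.

Definition hs_retr : U -> G := sval (cid exists_hs_retraction).
Lemma hs_retr_linear : linear hs_retr.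
Proof. by case: (svalP (cid exists_hs_retraction)). Qed.
Lemma hs_retrK x : hs_retr (iv x) = x.
Proof. by have [_ h] := svalP (cid exists_hs_retraction); exact: h. Qed.
Lemma hs_retr_val x : S x -> iv (hs_retr x) = x.
Proof. by move=> Sx; rewrite -[x](hs_makeK Sx) hs_retrK. Qed.

Lemma hs_lin_ind (V : lmodType C) (F G' : U -> V) : linear F -> linear G' ->
  (forall n (v : 'M[U]_n) i j, unitary_corep v -> (forall i j, S (v i j)) ->
    F (v i j) = G' (v i j)) -> forall x, S x -> F x = G' x.
Proof.
move=> lF lG FG x /hs_span[s sS ->]; rewrite (lin_sum lF) (lin_sum lG).
rewrite big_seq [RHS]big_seq; apply: eq_bigr => p /sS[n [v [i [j [vC vS ->]]]]].
by rewrite (linZ lF) (linZ lG) FG.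
Qed.

Definition hs_vv : tensor G G -> tensor U U := tmap iv iv.
Let vvh : alg_hom hs_vv. Proof. by apply: alg_hom_tmap; exact: hs_val_hom. Qed.
Let vvl : linear hs_vv. Proof. by case: vvh. Qed.

Lemma hs_vv_inj : injective hs_vv.
Proof.
apply: (can_inj (g := tmap hs_retr hs_retr)) => z.
rewrite /hs_vv tmap_comp //; try exact: hs_retr_linear.
by rewrite -[RHS]tmap_id; apply: eq_tmap => x; exact: hs_retrK.
Qed.

(** The retraction merely selects a preimage: by [hs_comulE] the comultiplication of U takes S into
    the tensor square of S. *)
Definition hs_comul (x : G) : tensor G G := tmap hs_retr hs_retr (comul (iv x)).

Lemma hs_comulE x : hs_vv (hs_comul x) = comul (iv x).
Proof.
have lrr := linear_tmap hs_retr_linear hs_retr_linear.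
have lc := comul_linear (H := U).
rewrite /hs_comul; move: (hs_valP x); move: (iv x).
apply: hs_lin_ind => //; first exact: linear_comp lc (linear_comp lrr vvl).
move=> n v i j vC vS; rewrite (corep_comul vC) (lin_sum lrr) (lin_sum vvl).
apply: eq_bigr => k _; rewrite /hs_vv !tmapE //; try exact: hs_retr_linear.
by rewrite !hs_retr_val.
Qed.

Fact hs_comul_hom : alg_hom hs_comul.
Proof.
have [lc c1 cM] := alg_hom_of (@comul C U); have [_ vv1 vvM] := vvh.
split=> [c x y||x y]; apply: hs_vv_inj.
- by rewrite vvl !hs_comulE vl lc.
- by rewrite hs_comulE v1 c1 vv1.
- by rewrite vvM !hs_comulE vM cM.
Qed.

Fact hs_counit_linear : linear_for *%R (fun x : G => counit (iv x) : C).
Proof. by move=> c x y; rewrite vl linearP. Qed.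
Fact hs_counit_monoid : monoid_morphism (fun x : G => counit (iv x) : C).
Proof. by split=> [|x y]; rewrite ?v1 ?rmorph1 // vM rmorphM. Qed.

Lemma hs_antipode_mem x : S x -> S (antipode x).
Proof.
move=> /hs_span[s sS ->].
have lS : linear (@antipode C U) by exact: linearP.
rewrite (lin_sum lS) big_seq; elim/big_rec: _ => [|p y /sS[n [v [i [j [vC vS e]]]]] Sy].
  exact: hs0.
rewrite (linZ lS) e (corep_antipode vC); apply: hs_lin => //.
exact/hs_star/vS.
Qed.

Definition hs_antipode (x : G) : G := hs_make (hs_antipode_mem (hs_valP x)).
Fact hs_antipode_linear : linear hs_antipode.
Proof.
by move=> c x y; apply: hs_val_inj; rewrite vl !hs_makeK vl linearP.
Qed.

Definition hs_comul_lr := sval (alg_hom_pack hs_comul_hom).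
Lemma hs_comul_lrE : hs_comul_lr =1 hs_comul.
Proof. exact: svalP (alg_hom_pack hs_comul_hom). Qed.
Definition hs_counit_lr : {lrmorphism G -> C | *%R} :=
  HB.pack_for {lrmorphism G -> C | *%R} (fun x : G => counit (iv x) : C)
    (GRing.isLinear.Build C G C *%R _ hs_counit_linear)
    (GRing.isMonoidMorphism.Build G C _ hs_counit_monoid).
Definition hs_antipode_l : {linear G -> G} :=
  HB.pack_for {linear G -> G} hs_antipode
    (GRing.isLinear.Build C G G *:%R _ hs_antipode_linear).

Lemma val_tlift (V : lmodType C) (f : U -> U -> V) (z : tensor G G) :
  bilinear_map f -> tlift f (hs_vv z) = tlift (fun x y => f (iv x) (iv y)) z.
Proof.
move=> bf; have bf' : bilinear_map (fun x y => f (iv x) (iv y)).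
  by split=> [b | a]; [exact: linear_comp vl (bf.1 _) | exact: linear_comp vl (bf.2 _)].
move: z; apply: tensor_lin_eq => [||a b].
- exact: linear_comp vvl (tlift_linear bf).
- exact: tlift_linear.
by rewrite /hs_vv tmapE // !tlift_tens.
Qed.

Lemma lin_tlift (V W : lmodType C) (g : V -> W) (f : G -> G -> V) (z : tensor G G) :
  linear g -> bilinear_map f -> g (tlift f z) = tlift (fun x y => g (f x y)) z.
Proof.
move=> lg bf; have bf' : bilinear_map (fun x y => g (f x y)).
  by split=> [b | a]; [exact: linear_comp (bf.1 _) lg | exact: linear_comp (bf.2 _) lg].
move: z; apply: tensor_lin_eq => [||a b].
- exact: linear_comp (tlift_linear bf) lg.
- exact: tlift_linear.
by rewrite !tlift_tens.
Qed.

Fact hs_comul_star : star_compatible hs_comul_lr.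
Proof.
move=> x; rewrite !hs_comul_lrE; apply: hs_vv_inj; rewrite hs_comulE.
have e z : hs_vv (star z) = star (hs_vv z) by exact: star_tmap.
by rewrite e hs_comulE hs_val_star comul_star.
Qed.

Fact hs_counit_star (a : G) : hs_counit_lr (star a) = (hs_counit_lr a)^*.
Proof. exact: counit_star. Qed.

Fact hs_comulA (a : G) : tassoc (tmap hs_comul_lr id (hs_comul_lr a)) =
  tmap id hs_comul_lr (hs_comul_lr a).
Proof.
have lc : linear hs_comul_lr by exact: linearP.
have lG := @linear_id C G; have lU := comul_linear (H := U).
(* Coassociativity is checked in the tensor cube of U, where that of G embeds thanks to the
   retraction. *)
have vi : injective (tmap iv hs_vv).
  apply: (can_inj (g := tmap (@hs_retr) (tmap hs_retr hs_retr))) => z.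
  have lr := hs_retr_linear; have lrr := linear_tmap lr lr.
  rewrite tmap_comp // -[RHS]tmap_id; apply: eq_tmap => x; first exact: hs_retrK.
  rewrite /hs_vv /= tmap_comp // -[RHS]tmap_id; apply: eq_tmap => y; exact: hs_retrK.
have nat w : tmap iv hs_vv (tassoc w) = tassoc (tmap hs_vv iv w).
  have l1 := linear_tmap vl vvl; have l2 := linear_tmap vvl vl.
  move: w; apply: tensor_lin_eq => [||w d].
  - exact: linear_comp (@tassoc_linear _ _ _ _) l1.
  - exact: linear_comp l2 (@tassoc_linear _ _ _ _).
  rewrite tmapE //; move: w; apply: tensor_lin_eq => [||x y].
  - exact: linear_comp (linear_tensl d) (linear_comp (@tassoc_linear _ _ _ _) l1).
  - have l3 := linear_comp (linear_tensl (iv d)) (@tassoc_linear C U U U).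
    exact: linear_comp vvl l3.
  by rewrite tassocE /hs_vv !tmapE // tassocE.
have cE : hs_vv \o hs_comul_lr = comul \o iv.
  by apply: funext => x; rewrite /= hs_comul_lrE hs_comulE.
apply: vi; rewrite nat tmap_comp // [in RHS]tmap_comp // cE.
have lid := @linear_id C U.
have eL z : tmap (comul \o iv) (iv \o id) z = tmap comul id (hs_vv z).
  by rewrite /hs_vv tmap_comp.
have eR z : tmap (iv \o id) (comul \o iv) z = tmap id comul (hs_vv z).
  by rewrite /hs_vv tmap_comp.
by rewrite eL eR hs_comul_lrE hs_comulE comulA.
Qed.

Fact hs_counitl (a : G) : tlift (fun x y => hs_counit_lr x *: y) (hs_comul_lr a) = a.
Proof.
apply: hs_val_inj; have bG : bilinear_map (fun x y : G => (hs_counit_lr x : C) *: y).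
  split=> [y | x] c u v; first by rewrite linearP scalerDl scalerA.
  by rewrite scalerDr !scalerA mulrC.
rewrite (lin_tlift _ vl bG) -[RHS](counitl (iv a)) -hs_comulE -hs_comul_lrE.
rewrite (val_tlift _ (counit_bil U U)).
by congr tlift; do 2!apply: funext => ?; rewrite (linZ vl).
Qed.

Fact hs_counitr (a : G) : tlift (fun x y => hs_counit_lr y *: x) (hs_comul_lr a) = a.
Proof.
apply: hs_val_inj; have bG : bilinear_map (fun x y : G => (hs_counit_lr y : C) *: x).
  split=> [y | x] c u v; last by rewrite linearP scalerDl scalerA.
  by rewrite scalerDr !scalerA mulrC.
have bU : bilinear_map (fun x y : U => (counit y : C) *: x).
  split=> [y | x] c u v; last by rewrite linearP scalerDl scalerA.
  by rewrite scalerDr !scalerA mulrC.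
rewrite (lin_tlift _ vl bG) -[RHS](counitr (iv a)) -hs_comulE -hs_comul_lrE.
rewrite (val_tlift _ bU).
by congr tlift; do 2!apply: funext => ?; rewrite (linZ vl).
Qed.

Fact hs_antipodel (a : G) :
  tlift (fun x y => hs_antipode_l x * y) (hs_comul_lr a) = hs_counit_lr a *: 1.
Proof.
apply: hs_val_inj; have bG : bilinear_map (fun x y : G => hs_antipode_l x * y).
  split=> [y | x] c u v; first by rewrite linearP mulrDl scalerAl.
  by rewrite mulrDr scalerAr.
have bU : bilinear_map (fun x y : U => antipode x * y).
  split=> [y | x] c u v; first by rewrite linearP mulrDl scalerAl.
  by rewrite mulrDr scalerAr.
rewrite (lin_tlift _ vl bG) (linZ vl) v1 -[RHS](antipodel (iv a)) -hs_comulE -hs_comul_lrE.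
rewrite (val_tlift _ bU).
by congr tlift; do 2!apply: funext => ?; rewrite vM.
Qed.

Fact hs_antipoder (a : G) :
  tlift (fun x y => x * hs_antipode_l y) (hs_comul_lr a) = hs_counit_lr a *: 1.
Proof.
apply: hs_val_inj; have bG : bilinear_map (fun x y : G => x * hs_antipode_l y).
  split=> [y | x] c u v; last by rewrite linearP mulrDr scalerAr.
  by rewrite mulrDl scalerAl.
have bU : bilinear_map (fun x y : U => x * antipode y).
  split=> [y | x] c u v; last by rewrite linearP mulrDr scalerAr.
  by rewrite mulrDl scalerAl.
rewrite (lin_tlift _ vl bG) (linZ vl) v1 -[RHS](antipoder (iv a)) -hs_comulE -hs_comul_lrE.
rewrite (val_tlift _ bU).
by congr tlift; do 2!apply: funext => ?; rewrite vM.
Qed.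

Fact hs_coreps_span (a : G) :
  lin_span (fun x => exists n (v : 'M[G]_n) i j,
    unitary_corep_for hs_comul_lr v /\ x = v i j) a.
Proof.
have [s sS e] := hs_span (hs_valP a).
exists [seq (p.1, hs_retr p.2) | p <- s]; last first.
  rewrite big_map; apply: hs_val_inj; rewrite e (lin_sum vl) big_seq [RHS]big_seq.
  apply: eq_bigr => p /sS[n [v [i [j [vC vS ->]]]]].
  by rewrite (linZ vl) hs_retr_val.
move=> _ /mapP[p /sS[n [v [i [j [vC vS ev]]]]] ->] /=.
exists n, (\matrix_(i, j) hs_retr (v i j)), i, j; split; last by rewrite mxE ev.
split=> [k l|]; last split.
- rewrite hs_comul_lrE; apply: hs_vv_inj; rewrite hs_comulE mxE hs_retr_val //.
  rewrite (corep_comul vC) (lin_sum vvl); apply: eq_bigr => q _.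
  by rewrite !mxE /hs_vv tmapE // !hs_retr_val.
- apply/matrixP => k l; rewrite !mxE; apply: hs_val_inj; rewrite (lin_sum vl).
  rewrite [RHS](_ : _ = (k == l)%:R); last by case: (k == l); rewrite ?v1 ?(lin0 vl).
  rewrite -(corep_unitary_r vC); apply: eq_bigr => q _.
  by rewrite !mxE vM hs_val_star !hs_retr_val.
- apply/matrixP => k l; rewrite !mxE; apply: hs_val_inj; rewrite (lin_sum vl).
  rewrite [RHS](_ : _ = (k == l)%:R); last by case: (k == l); rewrite ?v1 ?(lin0 vl).
  rewrite -(corep_unitary_l vC); apply: eq_bigr => q _.
  by rewrite !mxE vM hs_val_star !hs_retr_val.
Qed.

HB.instance Definition _ := isCQG.Build C (hs_type S)
  hs_comul_star hs_counit_star hs_comulA hs_counitl hs_counitr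
  hs_antipodel hs_antipoder hs_coreps_span.

Lemma hs_comul_val (x : G) : hs_vv (comul x) = comul (iv x).
Proof. by rewrite -hs_comulE -hs_comul_lrE. Qed.

Lemma hs_counit_val (x : G) : counit x = counit (iv x).
Proof. by []. Qed.

Lemma hs_incl : exists incl : {lrmorphism G -> U},
  incl =1 iv /\ is_hopf_subalgebra S incl.
Proof.
have [f fE] := alg_hom_pack (hs_val_hom S).
exists f; split=> //; split.
- split=> [x|a|a]; rewrite ?fE //.
  rewrite -hs_comul_val /hs_vv; apply: eq_tmap => x; exact/esym/fE.
- by move=> x y; rewrite !fE; exact: hs_val_inj.
move=> x; split=> [Sx|[a <-]]; last by rewrite fE; exact: hs_valP.
by exists (hs_make Sx); rewrite fE hs_makeK.
Qed.

End HopfSubsetStar.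

(** * Words, paths and irreducible representations *)

Section LinSpan.
Variables (C : numClosedFieldType) (A : starAlgType C).
Implicit Types P Q R : A -> Prop.

Lemma lin_span_base P x : P x -> lin_span P x.
Proof.
by move=> Px; exists [:: (1, x)]; [move=> p /[!inE]/eqP -> | rewrite big_seq1 scale1r].
Qed.

Lemma lin_span0 P : lin_span P 0.
Proof. by exists [::] => //; rewrite big_nil. Qed.

Lemma lin_span_lin P (c : C) x y : lin_span P x -> lin_span P y -> lin_span P (c *: x + y).
Proof.
move=> [s sP ->] [t tP ->]; exists ([seq (c * p.1, p.2) | p <- s] ++ t).
  by move=> p; rewrite mem_cat => /orP[/mapP[q qs ->]|/tP //]; exact: (sP q).
rewrite big_cat big_map scaler_sumr; congr (_ + _).
by apply: eq_bigr => p _; rewrite scalerA.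
Qed.

Lemma lin_span_ind P Q : Q 0 -> (forall c x y, Q x -> Q y -> Q (c *: x + y)) ->
  (forall x, P x -> Q x) -> forall x, lin_span P x -> Q x.
Proof.
move=> Q0 Ql PQ x [s sP ->]; rewrite big_seq.
elim/big_rec: _ => // p y ps Qy; apply: Ql => //; exact/PQ/sP.
Qed.

Lemma lin_span_sub P Q : (forall x, P x -> lin_span Q x) ->
  forall x, lin_span P x -> lin_span Q x.
Proof. by apply: lin_span_ind; [exact: lin_span0 | exact: lin_span_lin]. Qed.

Lemma lin_spanZ P (c : C) x : lin_span P x -> lin_span P (c *: x).
Proof. by move=> Px; rewrite -[c *: x]addr0; apply: lin_span_lin => //; exact: lin_span0. Qed.

Lemma lin_spanD P x y : lin_span P x -> lin_span P y -> lin_span P (x + y).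
Proof. by move=> Px Py; rewrite -[x]scale1r; exact: lin_span_lin. Qed.

Lemma lin_span_sum P (I : finType) (F : I -> A) :
  (forall i, lin_span P (F i)) -> lin_span P (\sum_i F i).
Proof.
move=> PF; elim/big_rec: _ => [|i x _ Px]; first exact: lin_span0.
exact: lin_spanD.
Qed.

Lemma lin_span_mul P Q R : (forall x y, P x -> Q y -> lin_span R (x * y)) ->
  forall x y, lin_span P x -> lin_span Q y -> lin_span R (x * y).
Proof.
move=> PQR x y Px; move: x Px y; apply: lin_span_ind => [y _|c x x' Rx Rx' y Qy|x Px].
- by rewrite mul0r; exact: lin_span0.
- by rewrite mulrDl -scalerAl; apply: lin_span_lin; [exact: Rx | exact: Rx'].
apply: lin_span_ind => [|c y y' Ry Ry'|y Qy].
- by rewrite mulr0; exact: lin_span0.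
- by rewrite mulrDr -scalerAr; exact: lin_span_lin.
- exact: PQR.
Qed.

Lemma lin_span_star P Q : (forall x, P x -> lin_span Q (star x)) ->
  forall x, lin_span P x -> lin_span Q (star x).
Proof.
move=> PQ; apply: lin_span_ind => [|c x y Qx Qy|//].
  by rewrite star0; exact: lin_span0.
by rewrite starD starZ; exact: lin_span_lin.
Qed.

End LinSpan.

Section Paths.
Variable k : nat.

(** Paths from height 0 to height h inside [0, k], the lower bound being built into [nat]. Unlike
    [Wwhite], this records the final height and so allows induction on prefixes. *)
Inductive bpath : word -> nat -> Prop :=
| bpath_nil : bpath [::] 0
| bpath_up w h : bpath w h -> (h < k)%N -> bpath (rcons w true) h.+1
| bpath_down w h : bpath w h.+1 -> bpath (rcons w false) h.

Lemma balance_cat w w' : color_balance (w ++ w') = color_balance w + color_balance w'.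
Proof. by rewrite /color_balance !count_cat; lia. Qed.

Lemma balance_rcons w c :
  color_balance (rcons w c) = color_balance w + (if c then 1 else - 1).
Proof. by rewrite -cats1 balance_cat; congr (_ + _); case: c. Qed.

Lemma balance_conj w : color_balance (word_conj w) = - color_balance w.
Proof.
rewrite /color_balance /word_conj !count_rev !count_map.
rewrite -[X in X%:Z - _](eq_count (a1 := pred1 false)); last by case.
by rewrite -[X in _ - X%:Z](eq_count (a1 := pred1 true)); [lia | case].
Qed.

Lemma bpath_bounds w h : bpath w h -> color_balance w = h%:Z /\
  forall l, 0 <= color_balance (take l w) <= k%:Z.
Proof.
elim=> {w h} [|w h _ [bw tw] hk|w h _ [bw tw]].
- by split.
- split=> [|l]; first by rewrite balance_rcons bw; lia.
  have [lw|wl] := leqP l (size w).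
    by rewrite -cats1 takel_cat.
  rewrite take_oversize ?size_rcons // balance_rcons bw; lia.
split=> [|l]; first by rewrite balance_rcons bw; lia.
have [lw|wl] := leqP l (size w); first by rewrite -cats1 takel_cat.
have := tw (size w); rewrite take_size.
rewrite take_oversize ?size_rcons // balance_rcons bw; lia.
Qed.

Lemma bounds_bpath w : (forall l, 0 <= color_balance (take l w) <= k%:Z) ->
  bpath w `|color_balance w|%N.
Proof.
elim/last_ind: w => [_|w c IH tw]; first exact: bpath_nil.
have tw' l : 0 <= color_balance (take l w) <= k%:Z.
  have [lw|wl] := leqP l (size w).
    by have := tw l; rewrite -cats1 takel_cat.
  have := tw (size w); rewrite -cats1 take_size_cat // take_oversize //; exact: ltnW.
have := tw (size (rcons w c)); rewrite take_size balance_rcons.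
have := tw' (size w); rewrite take_size.
case: c {tw} (IH tw') => bw b1 b2.
  have -> : `|(color_balance w + 1)%R|%N = `|color_balance w|%N.+1 by lia.
  apply: bpath_up => //; lia.
apply: bpath_down; have -> : `|(color_balance w + -1)%R|%N.+1 = `|color_balance w|%N by lia.
by [].
Qed.

Lemma WwhiteP w : Wwhite k w <-> bpath w 0.
Proof.
split=> [[w0 wl]|/bpath_bounds[bw tw]]; last by split=> // l _.
have -> : 0%N = `|color_balance w|%N by rewrite w0.
apply: bounds_bpath => l; case: (posnP l) => [->|l0]; first by rewrite take0.
have [lw|wl'] := leqP l (size w); first by apply: wl; rewrite l0.
by rewrite take_oversize ?w0 //; exact: ltnW.
Qed.

Lemma bpath_cat w w' h : bpath w 0 -> bpath w' h -> bpath (w ++ w') h.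
Proof.
move=> w0; elim=> {w' h} [|w' h _ IH hk|w' h _ IH]; first by rewrite cats0.
  by rewrite -rcons_cat; exact: bpath_up.
by rewrite -rcons_cat; exact: bpath_down.
Qed.

(** The conjugate word is the path read backwards: since w has balance 0, the prefix of length l of
    the conjugate has the balance of the prefix of w of length size w - l. *)
Lemma bpath_conj w : bpath w 0 -> bpath (word_conj w) 0.
Proof.
move=> /bpath_bounds[bw tw].
have -> : 0%N = `|color_balance (word_conj w)|%N by rewrite balance_conj bw.
apply: bounds_bpath => l.
rewrite /word_conj take_rev size_map -map_drop -/(word_conj _) balance_conj.
have := tw (size w - l)%N; move: bw.
rewrite -{1}(cat_take_drop (size w - l) w) balance_cat; lia.
Qed.

Lemma bpath_rconsV w c h : bpath (rcons w c) h ->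
  if c then exists2 h', h = h'.+1 & bpath w h' else bpath w h.+1.
Proof.
move Ew : (rcons w c) => w' bw; case: w' h / bw Ew => [|w' h bw' _|w' h bw'].
- by case: w.
- by move=> /rcons_inj[-> ->]; exists h.
- by move=> /rcons_inj[-> ->].
Qed.

End Paths.

Lemma free_unitary_biunitary (C : numClosedFieldType) (N : nat) (A : starAlgType C)
    (u : 'M[A]_N) :
  free_unitary_relations u <-> biunitary (fun i j => u i j).
Proof.
have E (M M' : 'M[A]_N) : M *m M' = 1%:M <-> forall a c, \sum_b M a b * M' b c = (a == c)%:R *: 1.
  split=> [h a c|h].
    by have := congr1 (fun X : 'M_N => X a c) h; rewrite !mxE scaler_nat.
  by apply/matrixP => a c; rewrite !mxE h scaler_nat.
rewrite /free_unitary_relations /unitary_mx !E; split.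
- move=> [[h1 h2] [h3 h4]]; split=> a c.
  + by rewrite -h1; apply: eq_bigr => b _; rewrite !mxE.
  + by rewrite -h2; apply: eq_bigr => b _; rewrite !mxE.
  + by rewrite -h4; apply: eq_bigr => b _; rewrite !mxE starK.
  + by rewrite -h3; apply: eq_bigr => b _; rewrite !mxE starK.
- move=> [h1 h2 h3 h4]; split; split=> a c.
  + by rewrite -h1; apply: eq_bigr => b _; rewrite !mxE.
  + by rewrite -h2; apply: eq_bigr => b _; rewrite !mxE.
  + by rewrite -h4; apply: eq_bigr => b _; rewrite !mxE starK.
  + by rewrite -h3; apply: eq_bigr => b _; rewrite !mxE starK.
Qed.

(** * Monomials in the generators and peaks *)

Section Monomials.
Variables (C : numClosedFieldType) (n : nat) (U : cqgType C) (u : 'M[U]_n.+1).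

Definition letter (c : bool) i j : U := if c then u i j else star (u i j).

(* mono w: the coefficients of the tensor product of the letters of w. *)
Inductive mono : word -> U -> Prop :=
| mono_nil : mono [::] 1
| mono_cons c w i j x : mono w x -> mono (c :: w) (letter c i j * x).

Lemma mono1 c i j : mono [:: c] (letter c i j).
Proof. by rewrite -[letter c i j]mulr1; do 2!constructor. Qed.

Lemma mono_cat w w' x y : mono w x -> mono w' y -> mono (w ++ w') (x * y).
Proof.
move=> wx w'y; elim: wx => [|c v i j z _ IH]; first by rewrite mul1r.
by rewrite -mulrA; constructor.
Qed.

Lemma mono_consV c w x : mono (c :: w) x -> exists i j y, mono w y /\ x = letter c i j * y.
Proof.
move Ew : (c :: w) => w' m; case: w' x / m Ew => // c' v i j y vy [-> ->].
by exists i, j, y.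
Qed.

Lemma mono_nilV x : mono [::] x -> x = 1.
Proof. by move Ew : [::] => w' m; case: w' x / m Ew. Qed.

Lemma mono_catV w w' z : mono (w ++ w') z ->
  exists x y, [/\ mono w x, mono w' y & z = x * y].
Proof.
elim: w z => [|c w IH] z; first by exists 1, z; split; rewrite ?mul1r //; constructor.
move=> /mono_consV[i [j [y [/IH[x [y' [wx w'y ->]]] ->]]]].
by exists (letter c i j * x), y'; split; rewrite ?mulrA //; constructor.
Qed.

Lemma star_letter c i j : star (letter c i j) = letter (~~ c) i j.
Proof. by case: c; rewrite /= ?starK. Qed.

Lemma mono_star w x : mono w x -> mono (word_conj w) (star x).
Proof.
elim=> [|c v i j y _ IH]; first by rewrite star1; constructor.
rewrite /word_conj /= rev_cons -cats1 starM star_letter.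
by apply: mono_cat => //; exact: mono1.
Qed.

Hypothesis hu : free_unitary_relations u.

Lemma letter_pair c : \sum_j letter c ord0 j * letter (~~ c) ord0 j = 1.
Proof.
move: hu => /free_unitary_biunitary[h1 _ _ h4].
by case: c; rewrite /= ?h1 ?h4 eqxx scale1r.
Qed.

(** The inserted sum over j equals 1 by unitarity of u and of its entrywise adjoint; row 0 in
    [letter_pair] is an arbitrary choice. *)
Lemma mono_insert w w' c z : mono (w ++ w') z ->
  lin_span (mono (w ++ [:: c; ~~ c] ++ w')) z.
Proof.
move=> /mono_catV[x [y [wx w'y ->]]].
rewrite -[x]mulr1 -(letter_pair c) mulr_sumr mulr_suml.
apply: lin_span_sum => j; apply: lin_span_base; rewrite -mulrA.
apply: mono_cat => //; apply: mono_cat => //.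
by apply: (mono_cat (w := [:: c]) (w' := [:: ~~ c])); exact: mono1.
Qed.

Variable k : nat.

(** The unital subalgebra generated by the coefficients of white^k black^k, as an inductive
    predicate so as to argue by induction on its elements. *)
Inductive peak_gen : U -> Prop :=
| peak_in x : mono (nseq k true ++ nseq k false) x -> peak_gen x
| peak_one : peak_gen 1
| peak_lin (c : C) x y : peak_gen x -> peak_gen y -> peak_gen (c *: x + y)
| peak_mul x y : peak_gen x -> peak_gen y -> peak_gen (x * y).

Lemma peak_gen0 : peak_gen 0.
Proof. by rewrite -(addNr 1) -scaleN1r; apply: peak_lin; exact: peak_one. Qed.

Lemma peak_gen_span w : (forall x, mono w x -> peak_gen x) ->
  forall x, lin_span (mono w) x -> peak_gen x.
Proof. by move=> wT; apply: lin_span_ind => //; [exact: peak_gen0 | exact: peak_lin]. Qed.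

Lemma nseq_rcons T m (x : T) : nseq m.+1 x = rcons (nseq m x) x.
Proof. by elim: m => //= m <-. Qed.

(** Inserting white black at the summit raises a peak by one, until height k is reached. *)
Lemma peak_gen_le m x : (m <= k)%N -> mono (nseq m true ++ nseq m false) x -> peak_gen x.
Proof.
move=> mk; rewrite -(subKn mk); move: (k - m)%N (leq_subr m k) => {mk}m mk.
elim: m mk x => [|m IH] mk x; first by rewrite subn0; exact: peak_in.
move=> /(mono_insert (w := nseq _ true) true); apply: peak_gen_span => y.
have -> : nseq (k - m.+1) true ++ [:: true; ~~ true] ++ nseq (k - m.+1) false =
    nseq (k - m) true ++ nseq (k - m) false.
  have -> : (k - m = (k - m.+1).+1)%N by rewrite subnSK.
  by rewrite (nseq_rcons _ true) -cats1 -catA.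
by apply: IH; exact: ltnW.
Qed.

Lemma mono_insert_peak w w' m z : mono (w ++ w') z ->
  lin_span (mono (w ++ nseq m false ++ nseq m true ++ w')) z.
Proof.
elim: m z => [|m IH] z wz; first exact: lin_span_base.
apply: lin_span_sub (IH z wz) => y.
rewrite catA => /(mono_insert false); rewrite !catA -[(_ ++ [:: false; _])]catA.
by rewrite (nseq_rcons m false) -cats1 /= -!catA.
Qed.

(* By unitarity, a descent to 0 followed by an ascent back may be inserted at
   each step up, which cuts a path into peaks. *)
Lemma bpath_peak_gen w h x : bpath k w h -> mono (w ++ nseq h false) x -> peak_gen x.
Proof.
move=> bw; elim: bw x => {w h} [|w h bw IH hk|w h bw IH] x.
- by move=> /mono_nilV ->; exact: peak_one.
- rewrite -cats1 -catA => /(mono_insert_peak h); apply: peak_gen_span => y.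
  rewrite catA => /mono_catV[a [b [/IH Ta]]].
  rewrite catA cats1 -nseq_rcons => /(peak_gen_le hk) Tb ->.
  exact: peak_mul.
- by rewrite -cats1 -catA; exact: IH.
Qed.

End Monomials.

(** * Coefficients of irreducible representations *)

Section MatrixCoefficients.
Variables (C : numClosedFieldType) (U : cqgType C).

Definition mx_coefs n (v : 'M[U]_n) (x : U) : Prop := exists i j, x = v i j.

Lemma scalar_mx_mulE m n p (T : 'M[C]_(m, n)) (v : 'M[U]_(n, p)) i j :
  (map_mx (in_alg U) T *m v) i j = \sum_k T i k *: v k j.
Proof. by rewrite mxE; apply: eq_bigr => k _; rewrite mxE mulr_algl. Qed.

Lemma mul_scalar_mxE m n p (v : 'M[U]_(m, n)) (T : 'M[C]_(n, p)) i j :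
  (v *m map_mx (in_alg U) T) i j = \sum_k T k j *: v i k.
Proof. by rewrite mxE; apply: eq_bigr => k _; rewrite mxE mulr_algr. Qed.

Lemma corep_equiv_coefs m n (v : 'M[U]_m) (w : 'M[U]_n) : corep_equiv v w ->
  (forall x, mx_coefs w x -> lin_span (mx_coefs v) x) /\
  (forall x, mx_coefs v x -> lin_span (mx_coefs w) x).
Proof.
move=> [T [S [TS ST vT]]].
have mapM a b c (X : 'M[C]_(a, b)) (Y : 'M[C]_(b, c)) :
    map_mx (in_alg U) X *m map_mx (in_alg U) Y = map_mx (in_alg U) (X *m Y).
  by rewrite map_mxM.
have map1 a : map_mx (in_alg U) (1%:M : 'M[C]_a) = 1%:M by rewrite map_mx1.
split=> x [i [j ->]].
  have -> : w = map_mx (in_alg U) S *m (v *m map_mx (in_alg U) T).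
    by rewrite [v *m _]vT mulmxA mapM ST map1 mul1mx.
  rewrite scalar_mx_mulE; apply: lin_span_sum => k; apply: lin_spanZ.
  rewrite mul_scalar_mxE; apply: lin_span_sum => l; apply: lin_spanZ.
  by apply: lin_span_base; exists k, l.
have -> : v = map_mx (in_alg U) T *m (w *m map_mx (in_alg U) S).
  by rewrite mulmxA -[map_mx _ T *m w]vT -mulmxA mapM TS map1 mulmx1.
rewrite scalar_mx_mulE; apply: lin_span_sum => k; apply: lin_spanZ.
rewrite mul_scalar_mxE; apply: lin_span_sum => l; apply: lin_spanZ.
by apply: lin_span_base; exists k, l.
Qed.

Lemma corep_equiv_dim m n (v : 'M[U]_m) (w : 'M[U]_n) : corep_equiv v w -> m = n.
Proof.
move=> [T [S [TS ST _]]]; apply/eqP; rewrite eqn_leq.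
by rewrite (mulmx1_min TS) (mulmx1_min ST).
Qed.

Lemma corep_tensor_coefs m n (v : 'M[U]_m) (w : 'M[U]_n) x :
  mx_coefs (corep_tensor v w) x <-> exists i j k l, x = v i k * w j l.
Proof.
split=> [[i [j ->]]|[i [j [k [l ->]]]]].
  case: (mxtens_indexP i) => a b; case: (mxtens_indexP j) => c e.
  by exists a, b, c, e; rewrite tensmxE.
by exists (mxtens_index (i, j)), (mxtens_index (k, l)); rewrite tensmxE.
Qed.

Lemma mxdiag_coefs p (p_ : 'I_p -> nat) (B : forall i, 'M[U]_(p_ i)) x :
  (mx_coefs (\mxdiag_i B i) x -> x = 0 \/ exists i, mx_coefs (B i) x) /\
  (forall i, mx_coefs (B i) x -> mx_coefs (\mxdiag_i B i) x).
Proof.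
have RE i a b : (\mxdiag_i B i) (tagnat.Rank i a) (tagnat.Rank i b) = B i a b.
  by rewrite -[in RHS](submxblock_diag B) /submxblock [RHS]mxE.
split=> [[a [b ->]]|i [a [b ->]]]; last first.
  by exists (tagnat.Rank i a), (tagnat.Rank i b); rewrite RE.
rewrite -(tagnat.sig2K a) -(tagnat.sig2K b).
move: (tagnat.sig1 a) (tagnat.sig2 a) (tagnat.sig1 b) (tagnat.sig2 b) => {}a i {}b j.
have [ab|ab] := eqVneq a b.
  by right; subst b; exists a, i, j; rewrite RE.
left; have h := congr1 (fun X : 'M_(p_ a, p_ b) => X i j)
  (mxblockK (fun i j => if i == j then conform_mx 0 (B i) else 0) a b).
by rewrite /= /submxblock [LHS]mxE (negPf ab) [RHS]mxE in h.
Qed.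

End MatrixCoefficients.

Section Irreps.
Variables (C : numClosedFieldType) (n : nat) (U : cqgType C) (u : 'M[U]_n.+1).
Hypothesis hu : free_unitary_relations u.
Variables (d : word -> nat) (uw : forall w : word, 'M[U]_(d w)).
Hypothesis huw : is_irrep_indexing u uw.

Let fusion w w' : corep_equiv (corep_tensor (uw w) (uw w')) (fusion_sum uw w w').
Proof. by case: huw => _ _ _ [_ _]. Qed.

Lemma fusion_coefs w w' x y : mx_coefs (uw w) x -> mx_coefs (uw w') y ->
  lin_span (fun z => exists2 v, v \in fusion_words w w' & mx_coefs (uw v) z) (x * y).
Proof.
move=> [i [k ->]] [j [l ->]]; have [_ h] := corep_equiv_coefs (fusion w w').
have := h (uw w i k * uw w' j l); set P := mx_coefs _ => hP.
apply: lin_span_sub (hP _) => [z|]; last first.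
  by apply/corep_tensor_coefs; exists i, j, k, l.
have [hz _] := mxdiag_coefs (fun m : 'I_(size (fusion_words w w')) =>
  uw (nth [::] (fusion_words w w') m)) z.
move=> /hz[->|[m mz]]; first exact: lin_span0.
by apply: lin_span_base; exists (nth [::] (fusion_words w w') m) => //; exact: mem_nth.
Qed.

Lemma coefs_fusion w w' v z : v \in fusion_words w w' -> mx_coefs (uw v) z ->
  lin_span (fun y => exists i j k l, y = uw w i k * uw w' j l) z.
Proof.
move=> vf vz; have [h _] := corep_equiv_coefs (fusion w w').
have ix : (index v (fusion_words w w') < size (fusion_words w w'))%N by rewrite index_mem.
have : lin_span (mx_coefs (corep_tensor (uw w) (uw w'))) z.
  have [_ hz] := mxdiag_coefs (fun m : 'I_(size (fusion_words w w')) =>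
    uw (nth [::] (fusion_words w w') m)) z.
  by apply/h/(hz (Ordinal ix)); rewrite /= nth_index.
by apply: lin_span_sub => y /corep_tensor_coefs h'; exact: lin_span_base.
Qed.

(** The only fusion of the empty word with itself is the empty word, so the dimension equals its own
    square; irreducibility makes it positive. *)
Lemma dim_nil : d [::] = 1%N.
Proof.
have := corep_equiv_dim (fusion [::] [::]); rewrite big_ord_recl big_ord0 addn0 /=.
have [h _ _ _] := huw; have [_ [d0 _]] := h [::].
by move: d0; case: (d [::]) => // -[|m] // _; lia.
Qed.

(** That the empty word gives the trivial representation has to be derived from the fusion rules.
    Its only coefficient g is unitary and g g is a multiple of g, so g is a multiple of 1, and the
    counit shows that the multiple is 1. *)
Lemma uw_nil i j : uw [::] i j = 1.
Proof.
have ordE (a b : 'I_(d [::])) : a = b.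
  by move: a b; rewrite dim_nil => a b; rewrite !ord1.
have [h _ _ _] := huw; have [vC _] := h [::].
set g := uw [::] i j.
have gE a b : uw [::] a b = g by rewrite /g (ordE a i) (ordE b j).
have span_g P : (forall z, P z -> z = g) -> forall x, lin_span P x -> exists c : C, x = c *: g.
  move=> Pg; apply: lin_span_ind => [|c x y [a ->] [b ->]|x /Pg ->].
  - by exists 0; rewrite scale0r.
  - by exists (c * a + b); rewrite scalerDl scalerA.
  - by exists 1; rewrite scale1r.
have gC : mx_coefs (uw [::]) g by exists i, j.
have [c gg] : exists c : C, g * g = c *: g.
  apply: span_g (fusion_coefs gC gC) => z [v].
  by rewrite inE => /eqP -> [a [b ->]].
have gs : g * star g = 1.
  have := corep_unitary_r vC i i; rewrite eqxx (bigD1 i) //= big1 ?addr0 ?gE // => a.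
  by rewrite (ordE a i) eqxx.
have gc : g = c *: 1 by rewrite -[LHS]mulr1 -gs mulrA gg -scalerAl.
have : counit g = 1 by rewrite /g (corep_counit vC) (ordE i j) eqxx.
by rewrite gc linearZ rmorph1 /= mulr1 => ->; rewrite scale1r.
Qed.

Lemma uw_letter c : (forall x, mx_coefs (uw [:: c]) x -> lin_span (mono u [:: c]) x) /\
  (forall i j, lin_span (mx_coefs (uw [:: c])) (letter u c i j)).
Proof.
have [_ _ _ [ut uconj _]] := huw.
have [h1 h2] := corep_equiv_coefs ut.
have T1 x : mx_coefs (uw [:: true]) x -> lin_span (mx_coefs u) x by exact: h2.
have T2 x : mx_coefs u x -> lin_span (mx_coefs (uw [:: true])) x by exact: h1.
case: c.
  split=> [x /T1|i j]; last by apply: T2; exists i, j.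
  by apply: lin_span_sub => y [i [j ->]]; apply: lin_span_base; exact: (mono1 u true).
have [k1 k2] := corep_equiv_coefs (uconj [:: true]).
split=> [x /k1|i j].
  apply: lin_span_sub => y [i [j ->]]; rewrite mxE.
  apply: lin_span_star (T1 _ _); last by exists i, j.
  by move=> z [a [b ->]]; apply: lin_span_base; exact: (mono1 u false).
apply: lin_span_star (T2 _ _); last by exists i, j.
move=> z [a [b ->]]; apply: k2; exists a, b; by rewrite mxE.
Qed.

Lemma mem_fusion_cat w w' : w ++ w' \in fusion_words w w'.
Proof.
apply/mapP; exists (size w); last by rewrite take_size subnn drop0.
by rewrite mem_filter mem_iota subnn take0 drop_size /= add0n ltnSn.
Qed.

Lemma fusion_letter w c v : v \in fusion_words w [:: c] ->
  v = rcons w c \/ w = rcons v (~~ c).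
Proof.
move=> /mapP[l]; rewrite mem_filter mem_iota => /andP[/eqP te /andP[_ lw]] ->.
have {}lw : (l <= size w)%N by [].
have [e|lt] := eqVneq l (size w).
  by left; rewrite e take_size subnn drop0 cats1.
have e : (size w - l = 1)%N.
  have := congr1 size te; rewrite size_rev size_map size_drop size_take /=.
  case: ifP; lia.
have sz : size (drop l w) = 1%N by rewrite size_drop.
have ew := cat_take_drop l w; right; rewrite e cats0.
move: te ew sz; rewrite e; case: (drop l w) => [|b [|? ?]] //= [->] ew _.
by rewrite negbK -[LHS]ew cats1.
Qed.

Lemma uw_mono w x : mx_coefs (uw w) x -> lin_span (mono u w) x.
Proof.
elim/last_ind: w x => [|w c IH] x.
  by move=> [i [j ->]]; rewrite uw_nil; apply: lin_span_base; constructor.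
rewrite -cats1 => /(coefs_fusion (mem_fusion_cat w [:: c])).
apply: lin_span_sub => y [i [j [a [b ->]]]].
apply: lin_span_mul (IH _ _) ((uw_letter c).1 _ _); last 2 first.
- by exists i, a.
- by exists j, b.
by move=> s t ws ct; apply: lin_span_base; exact: mono_cat.
Qed.

(** Multiplying by a letter either extends a word or cancels its last letter. Both yield paths
    ending at the expected height, because a prefix of a path is a path. *)
Lemma mono_uw k w h x : bpath k w h -> mono u w x ->
  lin_span (fun y => exists2 v, bpath k v h & mx_coefs (uw v) y) x.
Proof.
move=> bw; elim: bw x => {w h} [|w h bw IH hk|w h bw IH] x.
- move=> /mono_nilV ->; apply: lin_span_base; exists [::]; first exact: bpath_nil.
  have i0 : 'I_(d [::]) by rewrite dim_nil; exact: ord0.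
  by exists i0, i0; rewrite uw_nil.
- rewrite -cats1 => /mono_catV[a [b [/IH Sa]]].
  move=> /mono_consV[i [j [y [/mono_nilV -> ->]]]] ->; rewrite mulr1.
  apply: lin_span_mul Sa ((uw_letter true).2 i j) => s t [v bv vs] tt.
  apply: lin_span_sub (fusion_coefs vs tt) => z [v' /fusion_letter v'f v'z].
  apply: lin_span_base; exists v' => //.
  case: v'f => [->|ev]; first exact: bpath_up.
  by move: bv; rewrite ev => /bpath_rconsV.
- rewrite -cats1 => /mono_catV[a [b [/IH Sa]]].
  move=> /mono_consV[i [j [y [/mono_nilV -> ->]]]] ->; rewrite mulr1.
  apply: lin_span_mul Sa ((uw_letter false).2 i j) => s t [v bv vs] tt.
  apply: lin_span_sub (fusion_coefs vs tt) => z [v' /fusion_letter v'f v'z].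
  apply: lin_span_base; exists v' => //.
  case: v'f => [->|ev]; first exact: bpath_down.
  by move: bv; rewrite ev => /bpath_rconsV[h' [<-]].
Qed.

Variable k : nat.

(** This trades irreducible coefficients for monomials, whose products and adjoints are governed by
    concatenation and conjugation of words. *)
Lemma coef_span_mono x : coef_span uw (Wwhite k) x <->
  lin_span (fun y => exists2 w, bpath k w 0 & mono u w y) x.
Proof.
split; apply: lin_span_sub => y.
  move=> [w [i [j [/WwhiteP bw ->]]]].
  apply: lin_span_sub (uw_mono (w := w) _); last by exists i, j.
  by move=> z wz; apply: lin_span_base; exists w.
move=> [w bw wy]; apply: lin_span_sub (mono_uw bw wy) => z [v bv [i [j ->]]].
by apply: lin_span_base; exists v, i, j; split=> //; apply/WwhiteP.
Qed.

Lemma coef_span_one : coef_span uw (Wwhite k) 1.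
Proof.
apply/coef_span_mono/lin_span_base; exists [::]; [exact: bpath_nil | constructor].
Qed.

Lemma coef_span_mul x y : coef_span uw (Wwhite k) x -> coef_span uw (Wwhite k) y ->
  coef_span uw (Wwhite k) (x * y).
Proof.
move=> /coef_span_mono Sx /coef_span_mono Sy; apply/coef_span_mono.
apply: lin_span_mul Sx Sy => a b [w bw wa] [v bv vb]; apply: lin_span_base.
by exists (w ++ v); [exact: bpath_cat | exact: mono_cat].
Qed.

Lemma coef_span_star x : coef_span uw (Wwhite k) x -> coef_span uw (Wwhite k) (star x).
Proof.
move=> /coef_span_mono Sx; apply/coef_span_mono.
apply: lin_span_star Sx => a [w bw wa]; apply: lin_span_base.
by exists (word_conj w); [exact: bpath_conj | exact: mono_star].
Qed.

Definition coef_hopf : hopf_subset U.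
Proof.
apply: (@HopfSubset C U (coef_span uw (Wwhite k))).
- exact: coef_span_one.
- by move=> c x y; exact: lin_span_lin.
- exact: coef_span_mul.
- exact: coef_span_star.
move=> x [s sP ->]; exists s => // p /sP[w [i [j [Ww ->]]]].
exists (d w), (uw w), i, j; split=> //; first by case: huw => h _ _ _; case: (h w).
by move=> a b; apply: lin_span_base; exists w, a, b.
Defined.

Lemma coef_hopf_gen x : coef_hopf x -> peak_gen u k x.
Proof.
move=> /coef_span_mono; apply: lin_span_ind; [exact: peak_gen0 | exact: peak_lin |].
by move=> y [w bw wy]; apply: (bpath_peak_gen hu bw); rewrite cats0.
Qed.

Lemma coef_hopf_peak m x : (m <= k)%N ->
  mono u (nseq m true ++ nseq m false) x -> coef_hopf x.
Proof.
move=> mk mx; apply/coef_span_mono/lin_span_base.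
exists (nseq m true ++ nseq m false) => //.
have up j : (j <= k)%N -> bpath k (nseq j true) j.
  elim: j => [|j IH] jk; first exact: bpath_nil.
  by rewrite nseq_rcons; apply: bpath_up => //; exact/IH/ltnW.
have down j i : bpath k (nseq m true) (i + j) -> bpath k (nseq m true ++ nseq j false) i.
  elim: j i => [|j IH] i bw; first by rewrite cats0 -(addn0 i).
  rewrite nseq_rcons -rcons_cat; apply: bpath_down; apply: IH.
  by rewrite addSnnS.
by apply: down; exact: up.
Qed.

End Irreps.

(** * The universal property *)

Section WordMatrices.
Variables (C : numClosedFieldType) (n : nat) (U : cqgType C) (u : 'M[U]_n.+1).
Hypothesis hu : free_unitary_relations u.
Hypothesis uC : forall i j, comul (u i j) = \sum_k tens (u i k) (u k j).

Let comulM (x y : U) : comul (x * y) = comul x * comul y := rmorphM _ x y.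
Let counitM (x y : U) : counit (x * y) = counit x * counit y := rmorphM _ x y.

Definition upow k (I K : idx n k) : U := \prod_(0 <= j < k) u (digit I j) (digit K j).

Lemma upow0 I K : @upow 0 I K = 1.
Proof. by rewrite /upow big_geq. Qed.

Lemma upowS k (I K : idx n k) a b : @upow k.+1 (I, a) (K, b) = upow I K * u a b.
Proof.
rewrite /upow big_nat_recr //= eqxx; congr (_ * _).
by apply: eq_big_nat => j /andP[_ jk]; rewrite ltn_eqF.
Qed.

(** The inner sum has to be taken first: over the last letter when the adjoint stands on the right,
    over the earlier letters when it stands on the left. *)
Lemma upow_biunitary k : biunitary (@upow k).
Proof.
have [u1 u2 u3 u4] := (free_unitary_biunitary u).1 hu.
elim: k => [|k [h1 h2 h3 h4]].
  by split=> [] [] []; rewrite (big_pred1 tt) ?upow0 ?star1 ?mulr1 ?scale1r // => -[].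
have E (F : idx n k.+1 -> U) : \sum_X F X = \sum_I \sum_a F (I, a).
  by rewrite pair_big; apply: eq_bigr => -[].
have dE (I J : idx n k) (a b : 'I_n.+1) :
    ((I, a) == (J, b) :> idx n k.+1)%:R = (I == J)%:R * (a == b)%:R :> C.
  by rewrite -natb_and.
split=> [] [I a] [J c]; rewrite E dE.
- under eq_bigr => K _.
    under eq_bigr => b _ do rewrite !upowS starM mulrA -[upow I K * _ * _]mulrA.
    rewrite -mulr_suml -mulr_sumr u1 -scalerAr mulr1 -scalerAl.
  over.
  by rewrite -scaler_sumr h1 scalerA mulrC.
- rewrite exchange_big /=; under eq_bigr => b _.
    under eq_bigr => K _ do rewrite !upowS starM mulrA -[star (u b a) * _ * _]mulrA.
    rewrite -mulr_suml -mulr_sumr h2 -scalerAr mulr1 -scalerAl.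
  over.
  by rewrite -scaler_sumr u2 scalerA.
- under eq_bigr => K _.
    under eq_bigr => b _ do rewrite !upowS starM mulrA -[upow K I * _ * _]mulrA.
    rewrite -mulr_suml -mulr_sumr u3 -scalerAr mulr1 -scalerAl.
  over.
  by rewrite -scaler_sumr h3 scalerA mulrC.
- rewrite exchange_big /=; under eq_bigr => b _.
    under eq_bigr => K _ do rewrite !upowS starM mulrA -[star (u a b) * _ * _]mulrA.
    rewrite -mulr_suml -mulr_sumr h4 -scalerAr mulr1 -scalerAl.
  over.
  by rewrite -scaler_sumr u4 scalerA.
Qed.

Lemma upow_comul k (I K : idx n k) : comul (upow I K) = \sum_M tens (upow I M) (upow M K).
Proof.
elim: k I K => [|k IH] I K.
  by rewrite !upow0 rmorph1 (big_pred1 tt) ?upow0 ?tens1 // => -[].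
case: I K => [I a] [K b]; rewrite upowS comulM IH uC mulr_suml.
rewrite (eq_bigr (fun X => tens (upow I X.1 * u a X.2) (upow X.1 K * u X.2 b))); last first.
  by move=> [M c] _; rewrite !upowS.
rewrite -(pair_big xpredT xpredT (fun M c => tens (upow I M * u a c) (upow M K * u c b))) /=.
apply: eq_bigr => M _; rewrite mulr_sumr; apply: eq_bigr => c _.
by rewrite tensM.
Qed.

Lemma upow_counit k (I K : idx n k) : counit (upow I K) = (I == K)%:R.
Proof.
have uu : unitary_corep u by split=> //; case: hu.
elim: k I K => [|k IH] I K; first by rewrite upow0 rmorph1; case: I K => [] [].
case: I K => [I a] [K b]; rewrite upowS counitM IH (corep_counit uu).
by rewrite -natb_and.
Qed.

Lemma mono_upow k (I K : idx n k) : mono u (nseq k true) (upow I K).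
Proof.
elim: k I K => [|k IH] I K; first by rewrite upow0; constructor.
case: I K => [I a] [K b]; rewrite upowS nseq_rcons -cats1.
by apply: mono_cat => //; exact: (mono1 u true).
Qed.

Lemma mono_upowV k x : mono u (nseq k true) x -> exists I K : idx n k, x = upow I K.
Proof.
elim: k x => [|k IH] x.
  by move=> /mono_nilV ->; exists tt, tt; rewrite upow0.
rewrite nseq_rcons -cats1 => /mono_catV[y [z [/IH[I [K ->]]]]].
move=> /mono_consV[a [b [w [/mono_nilV -> ->]]]] ->.
by exists (I, a), (K, b); rewrite upowS mulr1.
Qed.

Lemma word_conj_nseq k c : word_conj (nseq k c) = nseq k (~~ c).
Proof.
rewrite /word_conj map_nseq; elim: k => //= k IH.
by rewrite rev_cons IH -nseq_rcons.
Qed.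

(** The lemmas below show that these elements satisfy the identities required of the coefficients of
    an invariant action. *)
Definition peak_coef k (I J K M : idx n k) : U := upow I K * star (upow J M).

Lemma mono_peak k (I J K M : idx n k) :
  mono u (nseq k true ++ nseq k false) (peak_coef I J K M).
Proof.
apply: mono_cat; first exact: mono_upow.
by rewrite -(word_conj_nseq k true); apply: mono_star; exact: mono_upow.
Qed.

Lemma mono_peakV k x : mono u (nseq k true ++ nseq k false) x ->
  exists I J K M : idx n k, x = peak_coef I J K M.
Proof.
move=> /mono_catV[y [z [/mono_upowV[I [K ->]] /mono_star]]].
rewrite word_conj_nseq => /mono_upowV[J [M zE]] ->.
by exists I, J, K, M; rewrite /peak_coef -zE starK.
Qed.

Lemma peak_coefM k (I J J' I' K M : idx n k) :
  \sum_L peak_coef I J K L * peak_coef J' I' L M = (J == J')%:R * peak_coef I I' K M.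
Proof.
have [_ _ _ h4] := upow_biunitary k.
under eq_bigr => L _ do rewrite /peak_coef mulrA -[upow I K * _ * _]mulrA.
rewrite -mulr_suml -mulr_sumr h4 -scalerAr mulr1 -scalerAl.
by rewrite scaler_nat mulr_natl.
Qed.

Lemma peak_coef_one k (K L : idx n k) : \sum_I peak_coef I I K L = (K == L)%:R.
Proof. by have [_ _ h3 _] := upow_biunitary k; rewrite h3 scaler_nat. Qed.

Lemma peak_coef_star k (I J K L : idx n k) : star (peak_coef I J K L) = peak_coef J I L K.
Proof. by rewrite /peak_coef starM starK. Qed.

Lemma peak_coef_trace k (I J : idx n k) : \sum_K peak_coef I J K K = (I == J)%:R.
Proof. by have [h1 _ _ _] := upow_biunitary k; rewrite h1 scaler_nat. Qed.

Lemma peak_coef_comul k (I J K L : idx n k) : comul (peak_coef I J K L) =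
  \sum_M \sum_N tens (peak_coef I J M N) (peak_coef M N K L).
Proof.
rewrite /peak_coef comulM comul_star !upow_comul star_sum mulr_suml.
apply: eq_bigr => M _; rewrite mulr_sumr; apply: eq_bigr => N _.
by rewrite star_tens tensM.
Qed.

Lemma peak_coef_counit k (I J K L : idx n k) :
  counit (peak_coef I J K L) = (I == K)%:R * (J == L)%:R.
Proof. by rewrite /peak_coef counitM counit_star !upow_counit rmorph_nat. Qed.

(** Unitarity of the entrywise adjoint of u collapses the two innermost letters; this is the
    compatibility with x |-> x (x) 1. *)
Lemma peak_coef_last k (I J K L : idx n k) c d :
  \sum_a @peak_coef k.+1 (I, a) (J, a) (K, c) (L, d) = (c == d)%:R * peak_coef I J K L.
Proof.
have [_ _ u3 _] := (free_unitary_biunitary u).1 hu.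
under eq_bigr => a _ do rewrite /peak_coef !upowS starM mulrA -[upow I K * _ * _]mulrA.
rewrite -mulr_suml -mulr_sumr u3 -scalerAr mulr1 -scalerAl.
by rewrite scaler_nat mulr_natl.
Qed.

End WordMatrices.

Section TreeActionStatements.
Variables (C : numClosedFieldType) (n k : nat) (G : cqgType C).
Local Notation T := (tree_alg C n.+1 k).
Variable alpha : {lrmorphism T -> tensor G T}.

Lemma delta_sum_neq0 : delta_sum C n.+1 k != 0.
Proof.
have : 0 < delta_sum C n.+1 k.
  rewrite /delta_sum big_nat_recl // expr0 ltr_pwDl // sumr_ge0 // => i _.
  by rewrite exprn_ge0 // ler0n.
by move=> /lt0r_neq0.
Qed.

(** The nonzero constant delta_k cancels from the invariance of the state, and the identity part of
    the adjacency matrix cancels from the commutation. *)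
Lemma graph_actionP : is_graph_action (@tree_state C n.+1 k) (@tree_adj C n.+1 k) alpha <->
  tree_action alpha /\ is_coaction alpha.
Proof.
have lid := @linear_id C T; have lsh := @linear_shift C n k.
have lw := @linear_weight C n k.
have adjE (z : tensor G T) : tmap id (@tree_adj C n.+1 k) z = z + tmap id (@tree_shift C n.+1 k) z.
  by rewrite -{2}(tmap_id z) -tmap_addr.
have stE (z : tensor G T) : tlift (fun a y => tree_state y *: a) z =
    (delta_sum C n.+1 k)^-1 *: wslice (@tree_weight C n.+1 k) z.
  rewrite /wslice /tlift scaler_sumr; apply: eq_bigr => p _.
  by rewrite scalerA.
have ah := alg_hom_of alpha; have [la _ _] := ah.
split=> [[s co w adj]|[[_ s w sh] co]]; split=> //.
- split=> // x.
    have := w x; rewrite stE /tree_state -scalerA => /(scalerI _); apply.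
    by rewrite invr_eq0 delta_sum_neq0.
  by have := adj x; rewrite adjE /tree_adj (linD la) => /addrI.
- by move=> x; rewrite stE w /tree_state scalerA.
- by move=> x; rewrite adjE sh /tree_adj (linD la).
Qed.

End TreeActionStatements.

Lemma tree_action_tmap (C : numClosedFieldType) (n k : nat) (G H : starAlgType C)
    (f : G -> H) (gam : tree_alg C n.+1 k -> tensor G (tree_alg C n.+1 k)) :
  alg_hom f -> star_compatible f -> tree_action gam ->
  tree_action (fun x => tmap f id (gam x)).
Proof.
move=> fh fs [gh gs gw gsh]; have [lf f1 _] := fh.
have lid := @linear_id C (tree_alg C n.+1 k).
split.
- exact: alg_hom_comp gh (alg_hom_tmap fh (alg_hom_id _)).
- by move=> x; rewrite gs star_tmap.
- move=> x; rewrite wslice_tmapl //; last exact: linear_weight.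
  by rewrite gw (linZ lf) f1.
- move=> x; rewrite tmap_swap //; last exact: linear_shift.
  by rewrite gsh.
Qed.

(** * The action of the Hopf subalgebra and its universality *)

Section Main.
Variables (C : numClosedFieldType) (n k : nat) (U : cqgType C) (u : 'M[U]_n.+1).
Hypothesis fu : is_free_unitary u.
Variables (d : word -> nat) (uw : forall w : word, 'M[U]_(d w)).
Hypothesis huw : is_irrep_indexing u uw.
Local Notation B i := (tpow C n.+1 i).
Local Notation T := (tree_alg C n.+1 k).

Let hu : free_unitary_relations u. Proof. by case: fu. Qed.
Let uC i j : comul (u i j) = \sum_l tens (u i l) (u l j). Proof. by case: fu. Qed.

Let S : hopf_subset U := coef_hopf huw k.
Local Notation G := (hs_type S : cqgType C).
Let iv : G -> U := @hs_val C U S.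
Let ivh : alg_hom iv := hs_val_hom S.
Let ivl : linear iv. Proof. by case: ivh. Qed.
Let ivM : {morph iv : x y / x * y}. Proof. by case: ivh. Qed.
Let iv1 : iv 1 = 1. Proof. by case: ivh. Qed.
Let iv_nat (b : bool) : iv b%:R = b%:R.
Proof. by case: b; rewrite ?iv1 ?(lin0 ivl). Qed.

(** The retraction makes this a total definition; for i <= k it is the intended element, by
    [qcoefE]. *)
Definition qcoef i (I J K M : idx n i) : G := hs_retr S (peak_coef u I J K M).

Lemma qcoefE i (I J K M : idx n i) : (i <= k)%N -> iv (qcoef I J K M) = peak_coef u I J K M.
Proof.
move=> ik; apply: hs_retr_val; apply: (coef_hopf_peak huw ik).
exact: mono_peak.
Qed.

Definition qact i : B i -> tensor G (B i) := coef_action (tpow_units C n i) (@qcoef i).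

Lemma qact_invariant i : (i <= k)%N -> invariant_action (tpow_units C n i) (@qact i).
Proof.
move=> ik; split.
- apply: alg_hom_coef_action => [I J J' I' K M|K L]; apply: (@hs_val_inj _ _ S).
    rewrite -/iv (lin_sum ivl) ivM iv_nat qcoefE // -(peak_coefM hu).
    by apply: eq_bigr => L _; rewrite -/iv ivM !qcoefE.
  rewrite -/iv (lin_sum ivl) iv_nat -(peak_coef_one hu).
  by apply: eq_bigr => I _; rewrite -/iv qcoefE.
- apply: coef_action_star => I J K L; apply: (@hs_val_inj _ _ S).
  by rewrite hs_val_star -/iv !qcoefE // peak_coef_star.
- apply: is_coaction_coef_action => I J K L.
    apply: (@hs_vv_inj _ _ S); rewrite hs_comul_val -/iv qcoefE // (peak_coef_comul uC).
    have [vl _ _] := alg_hom_tmap ivh ivh.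
    rewrite [RHS](lin_sum vl); apply: eq_bigr => M _.
    rewrite [RHS](lin_sum vl); apply: eq_bigr => N _.
    by rewrite tmapE // !qcoefE.
  by rewrite hs_counit_val -/iv qcoefE // (peak_coef_counit hu uC).
- apply: trace_preserving_coef_action => I J; apply: (@hs_val_inj _ _ S).
  rewrite -/iv (lin_sum ivl) iv_nat -(peak_coef_trace hu).
  by apply: eq_bigr => K _; rewrite -/iv qcoefE.
Qed.

Lemma qact_tower i (x : B i) : (i < k)%N ->
  @qact i.+1 (tens x 1) = up (Mat C n.+1) (@qact i x).
Proof.
move=> ik.
have lq j : linear (@qact j) by exact: coef_action_linear.
have lup : linear (@up C (B i) (Mat C n.+1) G) by case: (up_hom (B i) (Mat C n.+1) G).
move: x; apply: (munit_lin_eq (m := tpow_units C n i)) => [||I J].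
- exact: linear_comp (linear_tensl _) (lq i.+1).
- exact: linear_comp (lq i) lup.
apply: (tcoef_ext (m := tpow_units C n i.+1)) => -[K c] [L e].
have -> : tens (tpow_units C n i I J) 1 =
    \sum_a tpow_units C n i.+1 (I, a) (J, a) :> B i.+1.
  by rewrite -(munit1 (matrix_matunits C n)) tens_sumr.
rewrite (lin_sum (lq _)) (lin_sum (tcoef_linear _ _ _)).
rewrite [RHS]tcoef_up /qact !tcoef_action.
under eq_bigr => a _ do rewrite tcoef_action.
apply: (@hs_val_inj _ _ S); rewrite -/iv ivM iv_nat (lin_sum ivl) qcoefE ?(ltnW ik) //.
rewrite -(peak_coef_last hu); apply: eq_bigr => a _.
by rewrite -/iv qcoefE.
Qed.

(** By [coef_hopf_gen], G is generated as a unital algebra by the coefficients of white^k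
    black^k. *)
Lemma qgen_eq (A : algType C) (F F' : G -> A) : alg_hom F -> alg_hom F' ->
  (forall I J K M : idx n k, F (qcoef I J K M) = F' (qcoef I J K M)) -> F =1 F'.
Proof.
move=> [Fl F1 FM] [Fl' F1' FM'] FF'.
have key y : peak_gen u k y -> exists2 x : G, iv x = y & F x = F' x.
  elim=> {y} [y /mono_peakV[I [J [K [M ->]]]]||c y z _ [x <- xE] _ [x' <- xE']
    |y z _ [x <- xE] _ [x' <- xE']].
  - by exists (qcoef I J K M); rewrite ?qcoefE.
  - by exists 1; rewrite ?F1 ?F1'.
  - by exists (c *: x + x'); rewrite ?ivl // Fl Fl' xE xE'.
  - by exists (x * x'); rewrite ?ivM // FM FM' xE xE'.
move=> x; have [x1 x1x e] := key _ (coef_hopf_gen hu (hs_valP x)).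
by have <- : x1 = x by exact: hs_val_inj x1x.
Qed.

Section Universality.
Variables (H : cqgType C) (beta : T -> tensor H T).
Hypotheses (bA : tree_action beta) (bco : is_coaction beta).

(** The map is the inclusion in U, then the map to A from the universal property of U, then the
    compression [chi]. *)
Lemma qgraph_morphism : exists f : {lrmorphism G -> H}, cqg_morphism f /\
  forall I J K M : idx n k, f (qcoef I J K M) =
    tcoef (tpow_units C n k) K M
      (tmap id (@tree_top C n.+1 k) (beta (tree_topin (tpow_units C n k I J)))).
Proof.
have [bk bT btop] := tree_tower bA bco.
have [bkh bks bkco bktr] := tower_invariant bT.
have [A [W [chi [P [Wb [chil chi1 chis chiM] [P1 PM Pl] Pt]]]]] := tower_biunitary bT.
have [w1 w2 w3 w4] := Wb.
(* The transpose is taken because the row index of W comes from K and its column index from I, in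
   the notation U_IK. Transposition permutes the four relations. *)
have vb : free_unitary_relations (\matrix_(i, j) W j i : 'M[A]_n.+1).
  apply/free_unitary_biunitary; split=> a c.
  - by rewrite -w3; apply: eq_bigr => b _; rewrite !mxE.
  - by rewrite -w4; apply: eq_bigr => b _; rewrite !mxE.
  - by rewrite -w1; apply: eq_bigr => b _; rewrite !mxE.
  - by rewrite -w2; apply: eq_bigr => b _; rewrite !mxE.
have [_ _ /(_ A _ vb) [g [gs gu _]]] := fu.
have [gl g1 gM] := alg_hom_of g.
have gup I K : g (@upow _ n U u k I K) = \prod_(0 <= j < k) W (digit K j) (digit I j).
  rewrite (alg_hom_prod _ _ (alg_hom_of g)); apply: eq_bigr => j _.
  by rewrite gu mxE.
have gt I J K M : g (@peak_coef _ n U u k I J K M) =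
    (\prod_(0 <= j < k) W (digit K j) (digit I j)) *
    star (\prod_(0 <= j < k) W (digit M j) (digit J j)).
  by rewrite /peak_coef gM gs !gup.
(* [chi] is multiplicative only on P; the image of G lies there because P is closed under the
   algebra operations and contains the images of the generators. *)
have gP y : peak_gen u k y -> P (g y).
  elim=> {y} [y /mono_peakV[I [J [K [M ->]]]]||c y z _ Py _ Pz|y z _ Py _ Pz].
  - by rewrite gt; have [] := Pt I J K M.
  - by rewrite g1.
  - by rewrite gl; exact: Pl.
  - by rewrite gM; exact: PM.
have ivP (x : G) : P (g (iv x)) by have := coef_hopf_gen hu (hs_valP x); exact: gP.
pose f0 (x : G) : H := chi (g (iv x)).
have f0h : alg_hom f0.
  split=> [||x y]; first exact: linear_comp (linear_comp ivl gl) chil.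
    by rewrite /f0 iv1 g1.
  by rewrite /f0 ivM gM chiM.
have f0t I J K M : f0 (qcoef I J K M) = tcoef (tpow_units C n k) K M
    (bk (tpow_units C n k I J)).
  by rewrite /f0 qcoefE // gt; have [] := Pt I J K M.
have [f fE] := alg_hom_pack f0h.
exists f; split; last by move=> I J K M; rewrite fE f0t btop top_topin.
have [f0l _ _] := f0h.
have [fl _ _] := alg_hom_of f.
split.
- by move=> x; rewrite !fE /f0 -chis -gs.
(* Both sides are algebra maps, so generators suffice; on them, the coefficients of the two actions
   obey the same formula for the comultiplication. *)
- apply: qgen_eq.
  + exact: alg_hom_comp (alg_hom_of f) (alg_hom_of (@comul C H)).
  + exact: alg_hom_comp (alg_hom_of (@comul C G)) (alg_hom_tmap (alg_hom_of f) (alg_hom_of f)).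
  move=> I J K M /=; rewrite fE f0t (action_coefs_comul (tpow_units C n k) bkh bkco).
  have [qh _ qco _] := qact_invariant (leqnn k).
  have qE I' J' K' M' : @qcoef k I' J' K' M' =
      tcoef (tpow_units C n k) K' M' (@qact k (tpow_units C n k I' J')).
    by rewrite /qact tcoef_action.
  rewrite qE (action_coefs_comul (tpow_units C n k) qh qco) (lin_sum (linear_tmap fl fl)).
  apply: eq_bigr => X _; rewrite (lin_sum (linear_tmap fl fl)); apply: eq_bigr => Y _.
  by rewrite tmapE // -!qE !fE !f0t.
- have cl (X : cqgType C) : alg_hom (@counit C X : X -> C^o).
    split=> [||x y]; [exact: linearP | exact: rmorph1 | exact: rmorphM].
  apply: (qgen_eq (A := C^o)).
  + exact: alg_hom_comp (alg_hom_of f) (cl H).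
  + exact: cl.
  move=> I J K M /=; rewrite fE f0t (action_coefs_counit (tpow_units C n k) bkco).
  by rewrite -(peak_coef_counit hu uC) -(qcoefE _ _ _ _ (leqnn k)); exact: esym (hs_counit_val _).
Qed.

End Universality.

Lemma free_unitary_tree : exists (G : cqgType C) (incl : {lrmorphism G -> U}),
  is_hopf_subalgebra (coef_span uw (Wwhite k)) incl /\
  exists alpha : {lrmorphism T -> tensor G T},
    is_quantum_automorphism_group (@tree_state C n.+1 k) (@tree_adj C n.+1 k) alpha.
Proof.
have [incl [_ inclP]] := hs_incl S.
exists G, incl; split; first exact: inclP.
have [qA qco qtop] := tree_assembly_action qact_invariant qact_tower.
have [qh _ _ _] := qA.
have [alpha aE] := alg_hom_pack qh.
have {}aE : @tree_assembly C n G qact k = alpha by apply/esym/funext.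
rewrite {}aE in qA qco qtop.
exists alpha; split; first exact/graph_actionP.
move=> H beta /graph_actionP[bA bco].
have [f [fm ft]] := qgraph_morphism bA bco.
have [fs _ _] := fm.
have [fl _ _] := alg_hom_of f.
have ltop := @linear_top C n k.
have topE (g : {lrmorphism G -> H}) y :
    tmap id (@tree_top C n.+1 k) (tmap g id (alpha (tree_topin y))) = tmap g id (@qact k y).
  by rewrite tmap_swap // ?qtop ?top_topin //; exact: linearP.
have coefE (g : {lrmorphism G -> H}) (I J K M : idx n k) :
    tcoef (tpow_units C n k) K M (tmap id (@tree_top C n.+1 k)
      (tmap g id (alpha (tree_topin (tpow_units C n k I J))))) = g (qcoef I J K M).
  rewrite topE tcoef_tmap; last exact: linearP.
  by rewrite /qact tcoef_action.
exists f; split=> //.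
(* An action on the tree is determined by its top level, and there by its coefficients on matrix
   units. *)
- apply: tree_action_ext => //.
    exact: tree_action_tmap (alg_hom_of f) fs qA.
  have lin_top (gam : T -> tensor H T) : linear gam ->
      linear (fun y => tmap id (@tree_top C n.+1 k) (gam (tree_topin y))).
    move=> lg; have lti : linear (@tree_topin C n k) by case: (k) => // ?; exact: linear_inr.
    exact: linear_comp lti (linear_comp lg (linear_tmap (@linear_id C H) ltop)).
  have la := linearP alpha; have lb := linearP beta.
  apply: (munit_lin_eq (m := tpow_units C n k)).
  + apply: (lin_top (fun x => tmap f id (alpha x))).
    exact: linear_comp la (linear_tmap fl (@linear_id C T)).
  + exact: lin_top.
  move=> I J; apply: (tcoef_ext (m := tpow_units C n k)) => K M.
  by rewrite coefE ft.
move=> g gm gE; apply: qgen_eq; [exact: alg_hom_of | exact: alg_hom_of |].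
by move=> I J K M; rewrite ft -coefE gE.
Qed.

End Main.

Theorem theorem7p4 (R : realType) (N k : nat) (hN : (2 <= N)%N) (hk : (1 <= k)%N)
    (U : cqgType (complex R)) (u : 'M[U]_N) (hU : is_free_unitary u)
    (d : word -> nat) (uw : forall w : word, 'M[U]_(d w))
    (huw : is_irrep_indexing u uw) :
  exists (G : cqgType (complex R)) (incl : {lrmorphism G -> U}),
    is_hopf_subalgebra (coef_span uw (Wwhite k)) incl /\
    exists alpha : {lrmorphism tree_alg (complex R) N k ->
                      tensor G (tree_alg (complex R) N k)},
      is_quantum_automorphism_group (@tree_state (complex R) N k)
        (@tree_adj (complex R) N k) alpha.
Proof.
(* The matrices in [tree_alg] have size N.-1.+1, which becomes N once N is a successor. *)
case: N hN u hU huw => // n _ u hU huw.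
exact: (@free_unitary_tree (complex R) n k U u hU d uw huw).
Qed.
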